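(* Let $X$ be an elliptic curve and let $p,q\in X$ with $q\neq p$. The bundle $E=\mathcal{O}(q)\oplus\mathcal{O}$ is unstable with instability degree 1, and its possible Hecke modifications $\alpha:F\to E$ at $p$, parameterized by the line $\ell_p=\mathrm{im}(\alpha_p)\in\mathbb{P}(E_p)$, are $$F\cong\begin{cases}\mathcal{O}(q)\oplus\mathcal{O}(-p)&\text{if }\ell_p=\mathcal{O}(q)_p\ (\text{a bad line}),\\ \mathcal{O}(q-p)\oplus\mathcal{O}&\text{otherwise (a good line).}\end{cases}$$
   Context: Let $E$ be a rank 2 holomorphic vector bundle over a curve $C$. A Hecke modification of $E$ at $p\in C$ is a rank 2 holomorphic bundle $F$ with a bundle map $\alpha:F\to E$ that is an isomorphism on fibers away from $p$ and that, in a local coordinate $z$ centered at $p$ and suitable local trivializations of $E$ and $F$ near $p$, is given by the matrix $\mathrm{diag}(1,z)$. Two Hecke modifications $\alpha:F\to E$, $\alpha':F'\to E$ at $p$ are equivalent if there is an isomorphism $\phi:F\to F'$ with $\alpha=\alpha'\circ\phi$. Equivalence classes correspond bijectively to lines $\ell_p\in\mathbb{P}(E_p)$ via $\ell_p=\mathrm{im}(\alpha_p:F_p\to E_p)$; the bundle $F$ for $\ell_p$ is the one whose sheaf of sections consists of the sections of $E$ whose value at $p$ lies in $\ell_p$. The instability degree of $E$ is $\deg M-\deg(E/M)$, where $M\subset E$ is a line subbundle of maximal degree. A line $\ell_p\in\mathbb{P}(E_p)$ is bad if there is a line subbundle $M\subset E$ of maximal degree with $M_p=\ell_p$, and good otherwise.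 *)

(* Defs.v *)
From HB Require Import structures.
From mathcomp Require Import all_boot all_order all_algebra.
From mathcomp Require Import complex freeg.
From mathcomp Require Import all_classical all_reals all_analysis.

Set Implicit Arguments.
Unset Strict Implicit.
Unset Printing Implicit Defensive.

Import Order.TTheory GRing.Theory Num.Theory.
Import numFieldNormedType.Exports.

Local Open Scope classical_set_scope.
Local Open Scope ring_scope.

(* R[i] with its numClosedFieldType structure as head, so that it carries the
   topology and the norm of a numFieldType. *)
Definition CC (R : realType) : numClosedFieldType := R[i].

(* A (smooth complete complex) curve is a compact connected Riemann surface.
   [chart_inv i] is only meaningful on the image of [chart i]. *)
Record curve (R : realType) := Curve {
  curve_sort :> topologicalType;
  chart_idx : Type;
  chart_dom : chart_idx -> set curve_sort;
  chart : chart_idx -> curve_sort -> CC R;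
  chart_inv : chart_idx -> CC R -> curve_sort;
  chart_dom_open : forall i, open (chart_dom i);
  chart_cover : forall x, exists i, chart_dom i x;
  chart_im_open : forall i, open (chart i @` chart_dom i);
  chartK : forall i x, chart_dom i x -> chart_inv i (chart i x) = x;
  chart_continuous : forall i x, chart_dom i x -> {for x, continuous (chart i)};
  chart_inv_continuous : forall i x, chart_dom i x ->
    {for chart i x, continuous (chart_inv i)};
  chart_transition : forall i j x, chart_dom i x -> chart_dom j x ->
    derivable (chart j \o chart_inv i) (chart i x) 1;
  curve_hausdorff : hausdorff_space curve_sort;
  curve_compact : compact [set: curve_sort];
  curve_connected : connected [set: curve_sort]
}.

(* An elliptic curve is a curve biholomorphic to C / (Z w1 + Z w2): [u] is the
   uniformization, a locally biholomorphic map inducing a bijection from the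
   quotient. *)
Definition elliptic_curve (R : realType) (X : curve R) : Prop :=
  exists (w1 w2 : CC R) (u : CC R -> X),
    [/\ (forall a b : R,
           (a%:C)%C * w1 + (b%:C)%C * w2 = 0 :> CC R -> a = 0 /\ b = 0),
        continuous u,
        (forall z i, chart_dom i (u z) ->
           derivable (@chart R X i \o u) z 1 /\
           'D_1 (@chart R X i \o u) z != 0),
        (forall x, exists z, u z = x) &
        (forall z z', u z = u z' <->
           exists m n : int, z - z' = m%:~R * w1 + n%:~R * w2)].

Section Holomorphic.
Context {R : realType} {X : curve R}.

(* Meant for open [U]. *)
Definition holo_on (U : set X) (f : X -> CC R) : Prop :=
  forall i x, U x -> chart_dom i x ->
    derivable (f \o @chart_inv R X i) (chart i x) 1.

Definition holo_mx m n (U : set X) (g : X -> 'M[CC R]_(m, n)) : Prop :=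
  forall i j, holo_on U (fun x => g x i j).

(* [z] is biholomorphic from [U] onto its image, and centered at [p]. *)
Definition local_coord (p : X) (U : set X) (z : X -> CC R) : Prop :=
  [/\ open U, U p /\ z p = 0, holo_on U z,
      (forall i x, U x -> chart_dom i x ->
         'D_1 (z \o @chart_inv R X i) (chart i x) != 0) &
      forall x y, U x -> U y -> z x = z y -> x = y].

Lemma near_chart_inv (U : set X) i x : open U -> U x -> chart_dom i x ->
  \forall y \near chart i x, U (@chart_inv R X i y).
Proof.
move=> oU Ux ix; have := chart_inv_continuous ix.
by apply; rewrite chartK//; exact: open_nbhs_nbhs.
Qed.

Lemma holo_on_cst U (c : CC R) : holo_on U (fun=> c).
Proof. by move=> i x _ _; exact: derivable_cst. Qed.

Lemma holo_on_eq U (f g : X -> CC R) : open U -> (forall x, U x -> f x = g x) ->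
  holo_on U f -> holo_on U g.
Proof.
move=> oU fg hf i x Ux ix; have := hf i x Ux ix.
apply: near_eq_derivable.
near=> y; apply: fg.
by near: y; exact: near_chart_inv.
Unshelve. all: by end_near. Qed.

Lemma holo_onS U V (f : X -> CC R) : U `<=` V -> holo_on V f -> holo_on U f.
Proof. by move=> UV hf i x /UV; exact: hf. Qed.

Lemma holo_onM U (f g : X -> CC R) : holo_on U f -> holo_on U g ->
  holo_on U (fun x => f x * g x).
Proof.
by move=> hf hg i x Ux ix; apply: derivableM; [exact: hf | exact: hg].
Qed.

Lemma holo_onB U (f g : X -> CC R) : holo_on U f -> holo_on U g ->
  holo_on U (fun x => f x - g x).
Proof.
by move=> hf hg i x Ux ix; apply: derivableB; [exact: hf | exact: hg].
Qed.

Lemma holo_onV U (f : X -> CC R) : (forall x, U x -> f x != 0) ->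
  holo_on U f -> holo_on U (fun x => (f x)^-1).
Proof.
move=> f0 hf i x Ux ix; apply: derivableV; last exact: hf.
by rewrite /= chartK//; exact: f0.
Qed.

Lemma holo_onX U (f : X -> CC R) n : holo_on U f -> holo_on U (fun x => f x ^+ n).
Proof.
move=> hf; elim: n => [|n IH].
  by under [X in holo_on U X]funext do rewrite expr0; exact: holo_on_cst.
by under [X in holo_on U X]funext do rewrite exprS; exact: holo_onM.
Qed.

Lemma holo_onXz U (f : X -> CC R) (n : int) : holo_on U f ->
  n = 0 \/ (forall x, U x -> f x != 0) -> holo_on U (fun x => f x ^ n).
Proof.
move=> hf; case: n => n.
  move=> _; rewrite (_ : (fun x => f x ^ n) = fun x => f x ^+ n); last first.
    by apply/funext => x; rewrite exprnP.
  exact: holo_onX.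
case=> [|f0]; first by clear hf.
rewrite (_ : (fun x => f x ^ Negz n) = fun x => (f x ^+ n.+1)^-1); last first.
  by apply/funext => x; rewrite NegzE exprnN.
apply: holo_onV; last exact: holo_onX.
by move=> x Ux; rewrite expf_neq0// f0.
Qed.

Lemma holo_on_chart i : holo_on (chart_dom i) (@chart R X i).
Proof. by move=> j x ix jx; exact: chart_transition. Qed.

End Holomorphic.

(* Matrices act on row vectors on the right: in local trivializations a bundle
   map is v |-> v *m g. *)
Record vbundle (R : realType) (X : curve R) (r : nat) := VBundle {
  fiber :> X -> lmodType (CC R);
  triv_idx : Type;
  triv_dom : triv_idx -> set X;
  triv : forall (i : triv_idx) (x : X), {linear fiber x -> 'rV[CC R]_r};
  triv_dom_open : forall i, open (triv_dom i);
  triv_cover : forall x, exists i, triv_dom i x;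
  triv_bij : forall i x, triv_dom i x -> bijective (triv i x);
  triv_transition : forall i j, exists g : X -> 'M[CC R]_r,
    holo_mx (triv_dom i `&` triv_dom j) g /\
    (forall x, triv_dom i x -> triv_dom j x ->
       forall v, triv j x v = triv i x v *m g x)
}.

Section Bundles.
Context {R : realType} {X : curve R}.

Definition local_triv r (E : vbundle X r) (U : set X)
    (t : forall x, {linear E x -> 'rV[CC R]_r}) : Prop :=
  [/\ open U,
      (forall x, U x -> bijective (t x)) &
      (forall i, exists g : X -> 'M[CC R]_r,
         holo_mx (triv_dom i `&` U) g /\
         (forall x, triv_dom i x -> U x ->
            forall v, t x v = triv i x v *m g x))].

Record bundle_map r s (E : vbundle X r) (F : vbundle X s) := BundleMap {
  bundle_fun :> forall x, {linear E x -> F x};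
  bundle_fun_holo : forall i j, exists g : X -> 'M[CC R]_(r, s),
    holo_mx (triv_dom i `&` triv_dom j) g /\
    (forall x, triv_dom i x -> triv_dom j x ->
       forall v, triv j x (bundle_fun x v) = triv i x v *m g x)
}.

Definition bundle_iso r (E F : vbundle X r) (f : bundle_map E F) : Prop :=
  exists g : bundle_map F E,
    (forall x, cancel (f x) (g x)) /\ (forall x, cancel (g x) (f x)).

Definition isomorphic r (E F : vbundle X r) : Prop :=
  exists f : bundle_map E F, bundle_iso f.

(* [D] is the divisor of the meromorphic section s_1 /\ ... /\ s_r of det E;
   for r = 1 this is the divisor of a meromorphic section of a line bundle. The
   values of the s_k at zeros and poles are irrelevant. *)
Definition has_divisor r (E : vbundle X r) (s : 'I_r -> forall x, E x)
    (D : {freeg X / int}) : Prop :=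
  forall x, exists (U : set X) (z : X -> CC R) (u : X -> CC R)
      (t : forall y, {linear E y -> 'rV[CC R]_r}),
    [/\ local_coord x U z, local_triv U t, holo_on U u, u x != 0 &
        forall y, U y -> y != x ->
          \det (\matrix_(k < r) t y (s k y)) = z y ^ (coeff x D) * u y].

(* The degree of any nonzero meromorphic section of det E. *)
Definition degree r (E : vbundle X r) : int :=
  xget 0 [set d | exists s D, has_divisor (E := E) s D /\ d = freeg.deg D].

Definition slope r (E : vbundle X r) : rat := (degree E)%:~R / r%:R.

Definition line_subbundle r (E : vbundle X r) (M : vbundle X 1)
    (f : bundle_map M E) : Prop :=
  forall x, injective (f x).

Definition max_line_subbundle r (E : vbundle X r) (M : vbundle X 1)
    (f : bundle_map M E) : Prop :=
  line_subbundle f /\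
  forall (M' : vbundle X 1) (f' : bundle_map M' E),
    line_subbundle f' -> (degree M' <= degree M)%R.

(* [h] exhibits [Q] as the quotient of [E] by the subbundle [f]. *)
Definition quotient_bundle r s k (E : vbundle X r) (M : vbundle X k)
    (Q : vbundle X s) (f : bundle_map M E) (h : bundle_map E Q) : Prop :=
  forall x, (forall w, exists v, h x v = w) /\
            (forall v, h x v = 0 <-> exists m, f x m = v).

Definition instability_degree (E : vbundle X 2) : int :=
  xget 0 [set d | exists (M Q : vbundle X 1) (f : bundle_map M E)
                         (h : bundle_map E Q),
    [/\ max_line_subbundle f, quotient_bundle f h & d = degree M - degree Q]].

Definition unstable (E : vbundle X 2) : Prop :=
  exists (M : vbundle X 1) (f : bundle_map M E),
    line_subbundle f /\ slope E < slope M.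

Definition is_line (V : lmodType (CC R)) (l : set V) : Prop :=
  exists2 v : V, v != 0 & l = range (fun c : CC R => c *: v).

Definition bad_line (E : vbundle X 2) (p : X) (l : set (E p)) : Prop :=
  is_line l /\
  exists (M : vbundle X 1) (f : bundle_map M E),
    max_line_subbundle f /\ range (f p) = l.

Definition good_line (E : vbundle X 2) (p : X) (l : set (E p)) : Prop :=
  is_line l /\ ~ bad_line l.

Definition hecke (p : X) (F E : vbundle X 2) (a : bundle_map F E) : Prop :=
  (forall x, x != p -> bijective (a x)) /\
  exists (U : set X) (z : X -> CC R)
      (tF : forall x, {linear F x -> 'rV[CC R]_2})
      (tE : forall x, {linear E x -> 'rV[CC R]_2}),
    [/\ local_coord p U z, local_triv U tF, local_triv U tE &
        forall x, U x -> forall v,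
          tE x (a x v) =
          tF x v *m diag_mx (\row_(j < 2) if j == 0 then 1 else z x)].

Definition hecke_equiv (F F' E : vbundle X 2) (a : bundle_map F E)
    (a' : bundle_map F' E) : Prop :=
  exists2 phi : bundle_map F F', bundle_iso phi &
    forall x v, a x v = a' x (phi x v).

End Bundles.

Section DirectSum.
Context {R : realType} {X : curve R} (r s : nat).
Variables (E : vbundle X r) (F : vbundle X s).

Definition dsum_fiber (x : X) : lmodType (CC R) := (E x * F x)%type.

Definition dsum_dom (ij : triv_idx E * triv_idx F) : set X :=
  triv_dom ij.1 `&` triv_dom ij.2.

Definition dsum_triv (ij : triv_idx E * triv_idx F) (x : X)
    (v : dsum_fiber x) : 'rV[CC R]_(r + s) :=
  row_mx (triv ij.1 x v.1) (triv ij.2 x v.2).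

Lemma dsum_triv_linear ij x : linear (@dsum_triv ij x).
Proof.
by move=> c v w; rewrite /dsum_triv /= !linearP scale_row_mx add_row_mx.
Qed.

HB.instance Definition _ ij x :=
  GRing.isLinear.Build (CC R) (dsum_fiber x) 'rV[CC R]_(r + s) _
    (@dsum_triv ij x) (@dsum_triv_linear ij x).

Lemma dsum_dom_open ij : open (dsum_dom ij).
Proof. by apply: openI; exact: triv_dom_open. Qed.

Lemma dsum_cover x : exists ij, dsum_dom ij x.
Proof. by have [i Ei] := triv_cover E x; have [j Fj] := triv_cover F x; exists (i, j). Qed.

Lemma dsum_bij ij x : dsum_dom ij x -> bijective (@dsum_triv ij x).
Proof.
case=> /triv_bij[g gK Kg] /triv_bij[h hK Kh].
exists (fun w => (g (lsubmx w), h (rsubmx w))) => [[v w]|w].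
  by rewrite /dsum_triv /= row_mxKl row_mxKr gK hK.
by rewrite /dsum_triv /= Kg Kh hsubmxK.
Qed.

Lemma dsum_transition ij kl : exists g : X -> 'M[CC R]_(r + s),
  holo_mx (dsum_dom ij `&` dsum_dom kl) g /\
  (forall x, dsum_dom ij x -> dsum_dom kl x ->
     forall v, @dsum_triv kl x v = @dsum_triv ij x v *m g x).
Proof.
have [g [hg gE]] := triv_transition ij.1 kl.1.
have [h [hh hE]] := triv_transition ij.2 kl.2.
exists (fun x => block_mx (g x) 0 0 (h x)); split.
  move=> a b; case: (split_ordP a) => a' ->; case: (split_ordP b) => b' ->.
  - under [X in holo_on _ X]funext do rewrite block_mxEul.
    by apply: holo_onS (hg a' b') => x [[? ?] [? ?]].
  - under [X in holo_on _ X]funext do rewrite block_mxEur mxE.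
    exact: holo_on_cst.
  - under [X in holo_on _ X]funext do rewrite block_mxEdl mxE.
    exact: holo_on_cst.
  - under [X in holo_on _ X]funext do rewrite block_mxEdr.
    by apply: holo_onS (hh a' b') => x [[? ?] [? ?]].
move=> x [i1 i2] [k1 k2] v; rewrite /dsum_triv mul_row_block.
by rewrite !mulmx0 addr0 add0r gE// hE.
Qed.

Definition dsum : vbundle X (r + s) :=
  @VBundle R X (r + s) dsum_fiber _ dsum_dom
    (fun ij x => @dsum_triv ij x : {linear _ -> _})
    dsum_dom_open dsum_cover dsum_bij dsum_transition.

(* The fiber at x of the summand E, as a subspace of the fiber of E (+) F. *)
Definition summand1 (x : X) : set (dsum x) := range (fun v : E x => (v, 0)).

End DirectSum.

(* The line bundle O(D): a meromorphic function f with div f + D >= 0 is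
   recorded by its values away from the support of D, and near a point a by
   its coordinate f z_a ^ (D a), where z_a is a coordinate centered at a. So
   each fiber is C, and the trivialization around a is multiplication by
   z_a ^ (D a) away from a, and the identity at a. *)
Section LineBundleOfDivisor.
Context {R : realType} {X : curve R}.
Variable D : {freeg X / int}.

Definition centered_chart (a : X) : chart_idx X := projT1 (cid (chart_cover a)).

Definition centered_coord (a x : X) : CC R :=
  chart (centered_chart a) x - chart (centered_chart a) a.

Definition OD_dom (a : X) : set X :=
  chart_dom (centered_chart a) `&` [set x | x = a \/ coeff x D = 0].

Definition OD_scale (a x : X) : CC R :=
  if x == a then 1 else centered_coord a x ^ (coeff a D).

Definition OD_fiber (x : X) : lmodType (CC R) := (CC R)^o.

Definition OD_triv (a x : X) (v : OD_fiber x) : 'rV[CC R]_1 :=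
  const_mx (OD_scale a x * v).

Lemma OD_triv_linear a x : linear (@OD_triv a x).
Proof.
move=> c v w; apply/matrixP => i j; rewrite !mxE mulrDr; congr (_ + _).
by rewrite mulrCA.
Qed.

HB.instance Definition _ a x :=
  GRing.isLinear.Build (CC R) (OD_fiber x) 'rV[CC R]_1 _
    (@OD_triv a x) (@OD_triv_linear a x).

Lemma centered_chartP a : chart_dom (centered_chart a) a.
Proof. exact: (projT2 (cid (chart_cover a))). Qed.

Lemma centered_coord_neq0 a x : chart_dom (centered_chart a) x -> x != a ->
  centered_coord a x != 0.
Proof.
move=> ax; apply: contra; rewrite subr_eq0 => /eqP e; apply/eqP.
by rewrite -(chartK ax) e chartK//; exact: centered_chartP.
Qed.

Lemma OD_scale_neq0 a x : OD_dom a x -> OD_scale a x != 0.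
Proof.
rewrite /OD_scale => -[ax _]; case: (eqVneq x a) => [_|xa].
  by rewrite oner_eq0.
by rewrite expfz_neq0// centered_coord_neq0.
Qed.

Lemma OD_dom_open a : open (OD_dom a).
Proof.
apply: openI; first exact: chart_dom_open.
set S := [set x | _]; rewrite -(setCK S); apply: closed_openC.
have : finite_set (~` S).
  apply: (@sub_finite_set _ _ [set` freeg.dom D]); last exact: finite_seq.
  move=> x /= /not_orP[_ /eqP Dx]; rewrite mem_dom.
  exact: Dx.
have /hausdorff_accessible/accessible_finite_set_closed h := @curve_hausdorff R X.
exact: h.
Qed.

Lemma OD_cover x : exists a, OD_dom a x.
Proof. by exists x; split; [exact: centered_chartP | left]. Qed.

Lemma OD_bij a x : OD_dom a x -> bijective (@OD_triv a x).
Proof.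
move=> /OD_scale_neq0 c0.
exists (fun w : 'rV_1 => (OD_scale a x)^-1 * w 0 0 : OD_fiber x) => [v|w].
  by rewrite !mxE mulKf.
by apply/matrixP => i j; rewrite !mxE mulVKf// !ord1.
Qed.

Lemma OD_transition a b : exists g : X -> 'M[CC R]_1,
  holo_mx (OD_dom a `&` OD_dom b) g /\
  (forall x, OD_dom a x -> OD_dom b x ->
     forall v, @OD_triv b x v = @OD_triv a x v *m g x).
Proof.
pose h x := OD_scale b x / OD_scale a x.
exists (fun x => (h x)%:M); split; last first.
  move=> x ax bx v; apply/matrixP => i j.
  by rewrite mul_mx_scalar !mxE /h mulrA divfK// OD_scale_neq0.
move=> i j; rewrite !ord1.
under [X in holo_on _ X]funext do rewrite mxE eqxx mulr1n.
have oab : open (OD_dom a `&` OD_dom b) by apply: openI; exact: OD_dom_open.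
have [eab|ab] := eqVneq a b.
  rewrite /h -eab setIid; apply: (@holo_on_eq R X _ (fun=> 1)); first exact: OD_dom_open.
    by move=> x ax; rewrite divff// OD_scale_neq0.
  exact: holo_on_cst.
have scale_holo c d : c != d -> holo_on (OD_dom c `&` OD_dom d) (OD_scale c).
  move=> cd; have ocd : open (OD_dom c `&` OD_dom d).
    by apply: openI; exact: OD_dom_open.
  apply: (holo_on_eq (f := fun x => centered_coord c x ^ coeff c D)) => //.
    move=> x [_ [_ dx]]; rewrite /OD_scale; case: (eqVneq x c) => // xc.
    move: dx; rewrite xc => -[/eqP|->]; last by rewrite expr0z.
    by rewrite (negPf cd).
  apply: holo_onXz.
    apply: holo_onB; last exact: holo_on_cst.
    apply: (@holo_onS R X _ (chart_dom (centered_chart c))); first by move=> x [[]].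
    exact: holo_on_chart.
  have [|Dc] := eqVneq (coeff c D) 0; [by left|right] => x [[cx _] [_ dx]].
  apply: centered_coord_neq0 => //; apply/eqP => xc.
  move: dx; rewrite xc => -[/eqP|/eqP]; first by rewrite (negPf cd).
  by rewrite (negPf Dc).
apply: holo_onM; first by rewrite setIC; apply: scale_holo; rewrite eq_sym.
apply: holo_onV; last exact: scale_holo.
by move=> x [ax _]; exact: OD_scale_neq0.
Qed.

Definition OD : vbundle X 1 :=
  @VBundle R X 1 OD_fiber X OD_dom
    (fun a x => @OD_triv a x : {linear _ -> _})
    OD_dom_open OD_cover OD_bij OD_transition.

End LineBundleOfDivisor.

(* Main.v *)
Require Import Defs.
From HB Require Import structures.
From mathcomp Require Import all_boot all_order all_algebra.
From mathcomp Require Import complex freeg.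
From mathcomp Require Import all_classical all_reals all_analysis.
From mathcomp Require Import ring lra.
From mathcomp Require Import zify.

(** Everything about bundles rests on one fact of function theory: on an elliptic curve, a
    meromorphic function that is not zero has as many zeros as poles. In the form used here,
    a function whose divisor is at least [D] vanishes if [D] has positive degree
    ([elliptic_zero]). It makes degrees well defined ([has_divisor_degree]) and shows that a
    line bundle with a nonzero map to the trivial bundle has degree at most zero
    ([map_to_trivial]).

    The proof of that fact is elementary. The function is pulled back to the plane, where it
    has periods [1] and [tau]. Goursat's theorem on rectangles shows that the integral of a
    function of period one over a horizontal segment of length one does not depend on the
    height, and winding horizontal lines onto circles by [e1 z = exp (2 pi i z)] turns this
    into Cauchy's theorem for discs, removable singularities ([holo_div]) and a Cauchy formula
    in strips ([strip_formula]). The pulled back function [F] is divided by a finite product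
    [theta M] of factors [1 - e1 (z - c)] that absorbs its zeros and poles in the strip
    [|Im z| <= M * Im tau]. If the sum of the orders is positive, this product is much larger
    on the boundary of the strip than on the real axis, and the Cauchy formula gives [F 0 = 0]
    when [M] tends to infinity ([elliptic_core]); moving the origin, [F] is zero.

    Let [E = O(q) + O]. A line subbundle of positive degree is killed by the projection to
    [O], hence is the summand [O(q)], of degree one ([max_sub]). So this is the only maximal
    line subbundle and its fiber at [p] is the only bad line; the other summand maps
    isomorphically to the quotient, of degree zero. This gives the instability degree
    [1 - 0], and [1 / 2 < 1] the instability.

    A Hecke modification is determined by its image at [p] ([hecke_unique]): away from [p] two
    modifications with the same image differ by an isomorphism, whose matrix extends over [p].
    It is therefore enough to exhibit one modification for each line. For the fiber of [O(q)]
    it is the inclusion of [O(q) + O(- p)] ([hecke_summand]). The other lines are spanned by a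
    vector [(c, 1)], and are the images of the maps [(v, w) |-> (v + c s w, w)] from
    [O(q - p) + O], where [s] is the section of [O(q)] with divisor [q], which is not zero at
    [p] since [q != p] ([hecke_graph]). *)

Set Implicit Arguments.
Unset Strict Implicit.
Unset Printing Implicit Defensive.

Import Order.TTheory GRing.Theory Num.Theory.
Import numFieldNormedType.Exports.

Local Open Scope classical_set_scope.
Local Open Scope ring_scope.

(** * Complex derivatives by linear approximation *)

Section ComplexPlane.
Context {R : realType}.
Implicit Types (z w l : CC R) (f g : CC R -> CC R).

(** The norm of [CC R] takes values in [CC R]; estimates are made with this real one. *)
Definition cnorm z : R := Normc.normc z.
Definition cRe z : R := complex.Re z.
Definition cIm z : R := complex.Im z.
Definition mkC (x y : R) : CC R := Complex x y.

Lemma cnorm_ge0 z : 0 <= cnorm z.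
Proof. by case: z => a b; exact: sqrtr_ge0. Qed.

Lemma cnorm0 : cnorm 0 = 0. Proof. exact: Normc.normc0. Qed.
Lemma cnorm1 : cnorm 1 = 1. Proof. exact: Normc.normc1. Qed.

Lemma cnorm_eq0 z : (cnorm z == 0) = (z == 0).
Proof.
apply/eqP/eqP => [/Normc.eq0_normc//|->]; exact: cnorm0.
Qed.

Lemma cnorm_gt0 z : (0 < cnorm z) = (z != 0).
Proof. by rewrite lt0r cnorm_eq0 cnorm_ge0 andbT. Qed.

Lemma cnormM z w : cnorm (z * w) = cnorm z * cnorm w.
Proof. exact: Normc.normcM. Qed.

Lemma cnormV z : cnorm z^-1 = (cnorm z)^-1.
Proof. exact: Normc.normcV. Qed.

Lemma cnormN z : cnorm (- z) = cnorm z.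
Proof. exact: normcN. Qed.

Lemma ler_cnormD z w : cnorm (z + w) <= cnorm z + cnorm w.
Proof. exact: le_normcD. Qed.

Lemma cnormB z w : cnorm (z - w) = cnorm (w - z).
Proof. by rewrite -cnormN opprB. Qed.

Lemma ler_cnormB z w : cnorm (z - w) <= cnorm z + cnorm w.
Proof. by rewrite -(cnormN w); exact: ler_cnormD. Qed.

Lemma ler_cdistD u z w : cnorm (z - w) <= cnorm (z - u) + cnorm (u - w).
Proof. by rewrite (_ : z - w = (z - u) + (u - w)) ?ler_cnormD//; ring. Qed.

Lemma ler_cnorm_sub z w : cnorm z - cnorm w <= cnorm (z - w).
Proof. by rewrite lerBlDr -{1}(subrK w z) ler_cnormD. Qed.

Lemma cnormX z n : cnorm (z ^+ n) = cnorm z ^+ n.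
Proof. by elim: n => [|n IH]; rewrite ?expr0 ?cnorm1// !exprS cnormM IH. Qed.

Lemma cnormXz z (n : int) : cnorm (z ^ n) = cnorm z ^ n.
Proof. by case: n => n; rewrite ?NegzE -?exprnN ?cnormV -?exprnP cnormX. Qed.

Lemma cnorm_prod I (s : seq I) (P : pred I) (F : I -> CC R) :
  cnorm (\prod_(i <- s | P i) F i) = \prod_(i <- s | P i) cnorm (F i).
Proof. exact: (big_morph cnorm cnormM cnorm1). Qed.

Lemma ler_Re_cnorm z : `|cRe z| <= cnorm z.
Proof.
case: z => a b; rewrite /cRe/cnorm/= -sqrtr_sqr ler_wsqrtr// lerDl sqr_ge0//.
Qed.

Lemma ler_Im_cnorm z : `|cIm z| <= cnorm z.
Proof.
case: z => a b; rewrite /cIm/cnorm/= -sqrtr_sqr ler_wsqrtr// lerDr sqr_ge0//.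
Qed.

Lemma mkCE z : z = mkC (cRe z) (cIm z). Proof. by case: z. Qed.

Lemma cnorm_real (x : R) : cnorm (mkC x 0) = `|x|.
Proof. by rewrite /cnorm/= expr0n addr0 sqrtr_sqr. Qed.

Lemma cnorm_imag (y : R) : cnorm (mkC 0 y) = `|y|.
Proof. by rewrite /cnorm/= expr0n add0r sqrtr_sqr. Qed.

Lemma ler_cnorm_ReIm z : cnorm z <= `|cRe z| + `|cIm z|.
Proof.
rewrite {1}(mkCE z) (_ : mkC _ _ = mkC (cRe z) 0 + mkC 0 (cIm z)).
  by rewrite (le_trans (ler_cnormD _ _))// cnorm_real cnorm_imag.
by rewrite /mkC; simpc.
Qed.

Lemma mkC_real_gt0 (e : R) : (0 < (mkC e 0 : CC R)) = (0 < e).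
Proof. exact: ltcR. Qed.

Lemma gt0_mkC (e : CC R) : 0 < e -> exists2 d : R, 0 < d & e = mkC d 0.
Proof.
case: e => a b; rewrite ltcE/= => /andP[/eqP b0 a0]; exists a => //.
by rewrite b0.
Qed.

Lemma normC_lt z (e : R) : (`|z| < mkC e 0) = (cnorm z < e).
Proof. exact: ltcR. Qed.

Lemma normC_le z (e : R) : (`|z| <= mkC e 0) = (cnorm z <= e).
Proof. exact: lecR. Qed.

Lemma nbhs_cnorm (z : CC R) (P : set (CC R)) : nbhs z P <->
  exists2 d : R, 0 < d & forall w, cnorm (w - z) < d -> P w.
Proof.
split => [/nbhs_ballP[e /= /gt0_mkC[d d0 ->] sub]|[d d0 sub]].
  by exists d => // w wz; apply: sub; rewrite /ball/= distrC normC_lt.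
apply/nbhs_ballP; exists (mkC d 0); rewrite /= ?mkC_real_gt0//.
by move=> w; rewrite /ball/= distrC normC_lt => /sub.
Qed.

Definition ccont f z : Prop := forall e : R, 0 < e -> exists2 d : R, 0 < d &
  forall w, cnorm (w - z) < d -> cnorm (f w - f z) < e.

Lemma ccontP f z : {for z, continuous f} <-> ccont f z.
Proof.
rewrite /continuous_at/prop_for; split => [cf e e0|cf].
  have H0 := (iffLR (@cvgrPdist_lt _ _ _ (nbhs z) _ f (f z))) cf (mkC e 0) (etrans (mkC_real_gt0 e) e0).
  have [d d0 H] := iffLR (nbhs_cnorm z (fun w => `|f z - f w| < mkC e 0)) (H0 (nbhs_filter z)).
  by exists d => // w /H; rewrite cnormB -normC_lt.
apply: (iffRL (@cvgrPdist_lt _ _ _ (nbhs z) (nbhs_filter z) f (f z))) => _ /gt0_mkC[e e0 ->].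
have [d d0 H] := cf e e0; apply: (iffRL (nbhs_cnorm z _)); exists d => // w /H.
by rewrite cnormB -normC_lt.
Qed.

Lemma ccontD f g z : ccont f z -> ccont g z -> ccont (fun w => f w + g w) z.
Proof. by move=> /ccontP cf /ccontP cg; apply/ccontP; exact: (cvgD cf cg). Qed.

Lemma ccontB f g z : ccont f z -> ccont g z -> ccont (fun w => f w - g w) z.
Proof. by move=> /ccontP cf /ccontP cg; apply/ccontP; exact: (cvgB cf cg). Qed.

Lemma ccontM f g z : ccont f z -> ccont g z -> ccont (fun w => f w * g w) z.
Proof. by move=> /ccontP cf /ccontP cg; apply/ccontP; exact: (cvgM cf cg). Qed.

Lemma ccontV f z : f z != 0 -> ccont f z -> ccont (fun w => (f w)^-1) z.
Proof. by move=> f0 /ccontP cf; apply/ccontP; exact: (cvgV f0 cf). Qed.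

Lemma ccont_cst (c : CC R) z : ccont (fun=> c) z.
Proof. by move=> e e0; exists 1 => // w _; rewrite subrr cnorm0. Qed.

Lemma ccont_id z : ccont id z.
Proof. by move=> e e0; exists e. Qed.

Lemma ccont_comp f g z : ccont f z -> ccont g (f z) -> ccont (g \o f) z.
Proof.
move=> cf cg e /cg[d d0 Hd]; have [d' d'0 Hd'] := cf d d0.
by exists d' => // w /Hd'/Hd.
Qed.

(** Derivatives as linear approximations: explicit errors are what Goursat's theorem and
    the estimates of integrals consume. *)
Definition cder f z l : Prop := forall e : R, 0 < e -> exists2 d : R, 0 < d &
  forall w, cnorm (w - z) < d -> cnorm (f w - f z - l * (w - z)) <= e * cnorm (w - z).

Lemma cder_is_derive f z l : cder f z l <-> is_derive z 1 f l.
Proof.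
have key : cder f z l <-> h^-1 *: ((f \o shift z) (h *: (1 : CC R)) - f z) @[h --> 0^'] --> l.
  split => [H|H e e0].
    apply: (iffRL (@cvgrPdist_le _ _ _ (0^') (dnbhs_filter 0) _ l)) => _ /gt0_mkC[e e0 ->].
    have [d d0 Hd] := H e e0; apply: (iffRL (nbhs_cnorm 0 _)).
    exists d => // h; rewrite subr0 => hd h0 /=.
    rewrite normC_le /shift/= [h *: _]mulr1 cnormB /GRing.scale/=.
    rewrite (_ : _ - l = h^-1 * (f (h + z) - f z - l * h)); last by field.
    rewrite cnormM cnormV ler_pdivrMl ?cnorm_gt0// [leRHS]mulrC.
    by have := Hd (h + z); rewrite addrK; apply.
  have /= H0 := (iffLR (@cvgrPdist_le _ _ _ (0^') (dnbhs_filter 0) _ l)) H (mkC e 0) (etrans (mkC_real_gt0 e) e0).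
  have [d d0 Hd] := iffLR (nbhs_cnorm 0 _) H0; exists d => // w wd.
  have [->|wz] := eqVneq w z.
    by rewrite !subrr mulr0 subr0 cnorm0 mulr0.
  have wz0 : w - z != 0 by rewrite subr_eq0.
  have := Hd (w - z); rewrite subr0 => /(_ wd wz0) /=.
  rewrite normC_le /shift/= [(w - z)%:A]mulr1 subrK [cnorm (l - _)]cnormB /GRing.scale/=.
  rewrite (_ : _ - l = (w - z)^-1 * (f w - f z - l * (w - z))); last by field.
  by rewrite cnormM cnormV ler_pdivrMl ?cnorm_gt0// [leRHS]mulrC.
split=> [/(iffLR key) H|[fz El]].
  apply: DeriveDef; first by apply: cvgP H.
  exact: cvg_lim H.
by apply: (iffRL key); rewrite -El; exact: fz.
Qed.

Lemma cderP f z : derivable f z 1 <-> exists l, cder f z l.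
Proof.
split=> [fz|[l /cder_is_derive[]]//].
by exists ('D_1 f z); apply/cder_is_derive; exact: derivableP.
Qed.

Lemma cder_cont f z l : cder f z l -> ccont f z.
Proof.
move=> /cder_is_derive[/derivable1_diffP/differentiable_continuous cf _].
exact/ccontP.
Qed.

Lemma cder_lip f z l : cder f z l -> exists2 d : R, 0 < d &
  forall w, cnorm (w - z) < d -> cnorm (f w - f z) <= (cnorm l + 1) * cnorm (w - z).
Proof.
move=> /(_ 1 ltr01)[d d0 H]; exists d => // w /H; rewrite mul1r => h.
rewrite -(subrK (l * (w - z)) (f w - f z)) (le_trans (ler_cnormD _ _))//.
by rewrite cnormM mulrDl mul1r addrC lerD2l.
Qed.

Lemma cder_comp f g z l m : cder f z l -> cder g (f z) m -> cder (g \o f) z (m * l).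
Proof.
move=> fl gm e e0.
have l1 : 0 < cnorm l + 1 by rewrite ltr_wpDl ?cnorm_ge0.
have m1 : 0 < cnorm m + 1 by rewrite ltr_wpDl ?cnorm_ge0.
have [d1 d10 H1] := fl (e / 2 / (cnorm m + 1)) (divr_gt0 (divr_gt0 e0 (ltr0Sn _ 1)) m1).
have [d2 d20 H2] := gm (e / 2 / (cnorm l + 1)) (divr_gt0 (divr_gt0 e0 (ltr0Sn _ 1)) l1).
have [d3 d30 H3] := cder_lip fl.
have [d4 d40 H4] := cder_cont fl d20.
exists (Num.min (Num.min d1 d3) d4); first by rewrite !lt_min d10 d30 d40.
move=> w; rewrite !lt_min => /andP[/andP[/H1{}H1 /H3{}H3] /H4/H2{}H2] /=.
set u := f w - f z in H1 H2 H3 *.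
rewrite (_ : _ - _ - _ = (g (f w) - g (f z) - m * u) + m * (u - l * (w - z))); last by ring.
rewrite (le_trans (ler_cnormD _ _))// cnormM.
have -> : e * cnorm (w - z) = e / 2 * cnorm (w - z) + e / 2 * cnorm (w - z) by field.
apply: lerD.
  apply: (le_trans H2).
  apply: (le_trans (ler_wpM2l _ H3)); first by rewrite ltW// !divr_gt0.
  by rewrite mulrA divfK// gt_eqF.
apply: (le_trans (ler_wpM2l (cnorm_ge0 _) H1)).
rewrite mulrA ler_wpM2r ?cnorm_ge0// mulrCA ler_piMr ?divr_ge0 ?ltW//.
by rewrite ltr_pdivrMr// mul1r ltrDl.
Qed.

Lemma cder_unique f z l m : cder f z l -> cder f z m -> l = m.
Proof. by move=> /cder_is_derive[_ <-] /cder_is_derive[_ <-]. Qed.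

Lemma cder_near f g z l : (exists2 d : R, 0 < d & forall w, cnorm (w - z) < d -> f w = g w) ->
  cder f z l -> cder g z l.
Proof.
move=> [d d0 fg] fl e /fl[d' d'0 H]; exists (Num.min d d'); first by rewrite lt_min d0.
move=> w; rewrite lt_min => /andP[wd /H]; rewrite !fg//.
by rewrite subrr cnorm0.
Qed.

Lemma cderD f g z l m : cder f z l -> cder g z m -> cder (fun w => f w + g w) z (l + m).
Proof. by move=> /cder_is_derive fl /cder_is_derive gm; apply/cder_is_derive; exact: is_deriveD. Qed.

Lemma cderB f g z l m : cder f z l -> cder g z m -> cder (fun w => f w - g w) z (l - m).
Proof. by move=> /cder_is_derive fl /cder_is_derive gm; apply/cder_is_derive; exact: is_deriveB. Qed.

Lemma cderM f g z l m : cder f z l -> cder g z m ->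
  cder (fun w => f w * g w) z (f z * m + g z * l).
Proof. by move=> /cder_is_derive fl /cder_is_derive gm; apply/cder_is_derive; exact: is_deriveM. Qed.

Lemma cder_id z : cder id z 1.
Proof. by apply/cder_is_derive; exact: is_derive_id. Qed.

Lemma cder_cst (c : CC R) z : cder (fun=> c) z 0.
Proof. by apply/cder_is_derive; exact: is_derive_cst. Qed.

Lemma cderV f z l : f z != 0 -> cder f z l -> cder (fun w => (f w)^-1) z (- l / f z ^+ 2).
Proof.
move=> fz /cder_is_derive fl; apply/cder_is_derive.
have [df El] := fl; apply: DeriveDef; first exact: derivableV.
by rewrite deriveV// El /GRing.scale/= mulrC mulNr mulrN.
Qed.

End ComplexPlane.

(** * Integrals of complex functions of a real variable *)

Section Integral.
Context {R : realType}.
Implicit Types (f g : R -> CC R) (a b c : R).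
Local Notation mu := (@lebesgue_measure R).

Definition rcont f (x : R) : Prop := forall e : R, 0 < e -> exists2 d : R, 0 < d &
  forall y : R, `|y - x| < d -> cnorm (f y - f x) < e.

Definition rcont_on a b f : Prop := forall x, a <= x <= b -> rcont f x.

Lemma cReB (z w : CC R) : cRe (z - w) = cRe z - cRe w. Proof. by case: z; case: w. Qed.
Lemma cImB (z w : CC R) : cIm (z - w) = cIm z - cIm w. Proof. by case: z; case: w. Qed.
Lemma cReD (z w : CC R) : cRe (z + w) = cRe z + cRe w. Proof. by case: z; case: w. Qed.
Lemma cImD (z w : CC R) : cIm (z + w) = cIm z + cIm w. Proof. by case: z; case: w. Qed.
Lemma cReM (z w : CC R) : cRe (z * w) = cRe z * cRe w - cIm z * cIm w. Proof. by case: z; case: w. Qed.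
Lemma cImM (z w : CC R) : cIm (z * w) = cRe z * cIm w + cIm z * cRe w. Proof. by case: z => ? ?; case: w. Qed.

Lemma rcont_Re f x : rcont f x -> {for x, continuous (fun t => cRe (f t) : R)}.
Proof.
move=> cf; rewrite /continuous_at; apply/cvgrPdist_lt => e /cf[d d0 H].
rewrite near_simpl; apply/nbhs_ballP; exists d => //= y; rewrite /ball/= distrC => /H h.
by rewrite distrC -cReB; exact: le_lt_trans (ler_Re_cnorm _) h.
Qed.

Lemma rcont_Im f x : rcont f x -> {for x, continuous (fun t => cIm (f t) : R)}.
Proof.
move=> cf; rewrite /continuous_at; apply/cvgrPdist_lt => e /cf[d d0 H].
rewrite near_simpl; apply/nbhs_ballP; exists d => //= y; rewrite /ball/= distrC => /H h.
by rewrite distrC -cImB; exact: le_lt_trans (ler_Im_cnorm _) h.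
Qed.

Lemma integrable_cont a b (u : R -> R) : (forall x, a <= x <= b -> {for x, continuous u}) ->
  mu.-integrable `[a, b] (EFin \o u).
Proof.
move=> cu; apply: continuous_compact_integrable; first exact: segment_compact.
by apply: continuous_in_subspaceT => x; rewrite inE/= in_itv/= => /cu.
Qed.

Lemma integrable_Re a b f : rcont_on a b f ->
  mu.-integrable `[a, b] (EFin \o (fun t => cRe (f t))).
Proof. by move=> cf; apply: integrable_cont => x /cf/rcont_Re. Qed.

Lemma integrable_Im a b f : rcont_on a b f ->
  mu.-integrable `[a, b] (EFin \o (fun t => cIm (f t))).
Proof. by move=> cf; apply: integrable_cont => x /cf/rcont_Im. Qed.

Definition cint a b f : CC R :=
  mkC (\int[mu]_(t in `[a, b]) cRe (f t)) (\int[mu]_(t in `[a, b]) cIm (f t)).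

Lemma eq_cint a b f g : (forall x, a <= x <= b -> f x = g x) -> cint a b f = cint a b g.
Proof.
move=> fg; rewrite /cint; congr mkC; apply: eq_Rintegral => x; rewrite inE/= in_itv/= => /fg -> //.
Qed.

Lemma cintD a b f g : rcont_on a b f -> rcont_on a b g ->
  cint a b (fun t => f t + g t) = cint a b f + cint a b g.
Proof.
move=> cf cg; rewrite /cint (_ : mkC _ _ + mkC _ _ =
  mkC (\int[mu]_(t in `[a, b]) cRe (f t) + \int[mu]_(t in `[a, b]) cRe (g t))
      (\int[mu]_(t in `[a, b]) cIm (f t) + \int[mu]_(t in `[a, b]) cIm (g t)))//.
rewrite -!RintegralD//; try exact: integrable_Re; try exact: integrable_Im.
by congr mkC; apply: eq_Rintegral => x _; rewrite ?cReD ?cImD.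
Qed.

Lemma cintZ a b f (c : CC R) : rcont_on a b f ->
  cint a b (fun t => c * f t) = c * cint a b f.
Proof.
move=> cf; have iRe := integrable_Re cf; have iIm := integrable_Im cf.
have mD : measurable `[a, b]%classic by [].
have ZRe (r : R) : mu.-integrable `[a, b] (EFin \o (fun t => r * cRe (f t))).
  by apply: integrable_cont => x /cf/rcont_Re h; apply: continuousM => //; exact: cst_continuous.
have ZIm (r : R) : mu.-integrable `[a, b] (EFin \o (fun t => r * cIm (f t))).
  by apply: integrable_cont => x /cf/rcont_Im h; apply: continuousM => //; exact: cst_continuous.
rewrite /cint; set I := \int[mu]_(t in _) cRe (f t); set J := \int[mu]_(t in _) cIm (f t).
rewrite [RHS](_ : _ = mkC (cRe c * I - cIm c * J) (cRe c * J + cIm c * I)); last by case: c.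
rewrite /I /J -!RintegralZl//.
congr mkC.
  rewrite -RintegralB//.
  by apply: eq_Rintegral => x _; rewrite cReM.
rewrite -RintegralD//.
by apply: eq_Rintegral => x _; rewrite cImM.
Qed.

Lemma cintB a b f g : rcont_on a b f -> rcont_on a b g ->
  cint a b (fun t => f t - g t) = cint a b f - cint a b g.
Proof.
move=> cf cg; rewrite /cint (_ : mkC _ _ - mkC _ _ =
  mkC (\int[mu]_(t in `[a, b]) cRe (f t) - \int[mu]_(t in `[a, b]) cRe (g t))
      (\int[mu]_(t in `[a, b]) cIm (f t) - \int[mu]_(t in `[a, b]) cIm (g t)))//.
rewrite -!RintegralB//; try exact: integrable_Re; try exact: integrable_Im.
by congr mkC; apply: eq_Rintegral => x _; rewrite ?cReB ?cImB.
Qed.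

Lemma Rintegral_split a b c (u : R -> R) : a <= b -> b <= c ->
  (forall x, a <= x <= c -> {for x, continuous u}) ->
  \int[mu]_(t in `[a, c]) u t = \int[mu]_(t in `[a, b]) u t + \int[mu]_(t in `[b, c]) u t.
Proof.
move=> ab bc cu; have iu := integrable_cont cu.
apply/eqP; rewrite addrC -subr_eq; apply/eqP.
rewrite Rintegral_itvB// ?bnd_simp//.
rewrite Rintegral_itv_obnd_cbnd//.
apply: integrableS iu => //.
by apply: subset_itvr; rewrite bnd_simp.
Qed.

Lemma cint_split a b c f : a <= b -> b <= c -> rcont_on a c f ->
  cint a c f = cint a b f + cint b c f.
Proof.
move=> ab bc cf; rewrite /cint (@Rintegral_split a b c)//; last by move=> x /cf/rcont_Re.
by rewrite (@Rintegral_split a b c (fun t => cIm _))//; move=> x /cf/rcont_Im.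
Qed.

Lemma Rintegral_itv_cst a b (B : R) : a <= b -> \int[mu]_(t in `[a, b]) B = B * (b - a).
Proof.
move=> ab; rewrite Rintegral_cst//=; congr (_ * _).
have -> : lebesgue_measure `[a, b] = (b - a)%:E :> \bar R; last by [].
rewrite lebesgue_measure_itv/= lte_fin; case: ltP => //= ba.
by rewrite (@le_anti _ _ a b) ?ab ?ba// subrr.
Qed.

Lemma Rintegral_bound a b (u : R -> R) B : a <= b ->
  (forall x, a <= x <= b -> {for x, continuous u}) ->
  (forall x, a <= x <= b -> `|u x| <= B) ->
  `|\int[mu]_(t in `[a, b]) u t| <= B * (b - a).
Proof.
move=> ab cu uB; have iu := integrable_cont cu.
apply: le_trans (le_normr_Rintegral _ iu) _ => //.
rewrite -Rintegral_itv_cst//.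
apply: le_Rintegral => //.
- by have := integrable_norm iu; apply.
- by apply: integrable_cont => x _; exact: cst_continuous.
Qed.

(** The factor two comes from bounding real and imaginary parts separately. *)
Lemma cint_bound a b f B : a <= b -> rcont_on a b f ->
  (forall x, a <= x <= b -> cnorm (f x) <= B) ->
  cnorm (cint a b f) <= 2 * B * (b - a).
Proof.
move=> ab cf fB; apply: le_trans (ler_cnorm_ReIm _) _; rewrite /cint/=.
rewrite (_ : 2 * B * _ = B * (b - a) + B * (b - a)); last by ring.
apply: lerD; apply: Rintegral_bound => // x xab.
- exact/rcont_Re/cf.
- exact: le_trans (ler_Re_cnorm _) (fB _ xab).
- exact/rcont_Im/cf.
- exact: le_trans (ler_Im_cnorm _) (fB _ xab).
Qed.

Lemma cint_cst a b (c : CC R) : a <= b -> cint a b (fun=> c) = mkC (b - a) 0 * c.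
Proof.
move=> ab; rewrite /cint !Rintegral_itv_cst//.
by rewrite /mkC; case: c => x y; rewrite /cRe/cIm/=; simpc; rewrite ![_ * (b - a)]mulrC.
Qed.

Lemma Rintegral_id a b : a <= b -> \int[mu]_(t in `[a, b]) t = (b ^+ 2 - a ^+ 2) / 2.
Proof.
rewrite le_eqVlt => /orP[/eqP->|ab].
  by rewrite subrr mul0r set_itv1 Rintegral_set1.
rewrite /Rintegral (@continuous_FTC2 _ _ (fun t : R => t ^+ 2 / 2))//=; first by field.
- by apply: continuous_in_subspaceT => x _; exact: cvg_id.
- split => [x _||].
  + by apply: derivableM => //; exact: exprn_derivable.
  + apply: cvg_at_right_filter; apply: cvgM; last exact: cvg_cst.
    exact: exprn_continuous.
  + apply: cvg_at_left_filter; apply: cvgM; last exact: cvg_cst.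
    exact: exprn_continuous.
- move=> x _; rewrite derive1E.
  have := is_deriveM (is_deriveX 2 (is_derive_id x (1 : R))) (is_derive_cst (2^-1 : R) x (1 : R)).
  move=> [_ E]; rewrite [LHS]E.
  by rewrite /GRing.scale/=; field.
Qed.

Lemma cint_id a b : a <= b -> cint a b (fun t => mkC t 0) = mkC ((b ^+ 2 - a ^+ 2) / 2) 0.
Proof.
move=> ab; rewrite /cint /cRe/cIm/= Rintegral_id//; congr mkC.
by rewrite Rintegral_itv_cst// mul0r.
Qed.

End Integral.

(** * Goursat's theorem *)

Section Bisection.
Context {R : realType}.

(** If the property failed, it would fail for one of the quarters, and repeatedly so: these
    rectangles would shrink to a point, around which it holds. *)
Lemma bisection_rect (P : R -> R -> R -> R -> Prop) (a0 b0 c0 d0 : R) :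
  a0 <= b0 -> c0 <= d0 ->
  (forall a b c d, a0 <= a -> a <= b -> b <= b0 -> c0 <= c -> c <= d -> d <= d0 ->
     P a ((a + b) / 2) c ((c + d) / 2) -> P a ((a + b) / 2) ((c + d) / 2) d ->
     P ((a + b) / 2) b c ((c + d) / 2) -> P ((a + b) / 2) b ((c + d) / 2) d ->
     P a b c d) ->
  (forall x y, a0 <= x <= b0 -> c0 <= y <= d0 -> exists2 e : R, 0 < e &
     forall a b c d, a0 <= a -> b <= b0 -> c0 <= c -> d <= d0 ->
       a <= x <= b -> c <= y <= d -> (b - a) + (d - c) < e -> P a b c d) ->
  P a0 b0 c0 d0.
Proof.
move=> ab0 cd0 Pstep Ploc; apply: contrapT => nP0.
pose ok (r : R * R * R * R) := let: (a, b, c, d) := r in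
  [/\ a0 <= a, a <= b & b <= b0] /\ [/\ c0 <= c, c <= d & d <= d0].
pose bad (r : R * R * R * R) := let: (a, b, c, d) := r in ok r /\ ~ P a b c d.
pose quarter (r r' : R * R * R * R) := let: (a, b, c, d) := r in
  let: (a', b', c', d') := r' in
  [/\ a <= a', b' <= b & b' - a' = (b - a) / 2] /\
  [/\ c <= c', d' <= d & d' - c' = (d - c) / 2].
have next r : bad r -> exists r', bad r' /\ quarter r r'.
  case: r => [[[a b] c] d] [[[a0a ab bb0] [c0c cd dd0]] nP].
  have am : a <= (a + b) / 2 by lra.
  have mb : (a + b) / 2 <= b by lra.
  have cm : c <= (c + d) / 2 by lra.
  have md : (c + d) / 2 <= d by lra.
  apply: contrapT => /forallNP none; apply: nP.
  have sub a' b' c' d' : quarter (a, b, c, d) (a', b', c', d') -> P a' b' c' d'.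
    move=> q; apply: contrapT => nP; apply: (none (a', b', c', d')); split=> //.
    move: q => [[q1 q2 q3] [q4 q5 q6]]; split=> //; split; split; lra.
  by apply: Pstep => //; apply: sub; split; split => //; lra.
pose f r := xget r [set r' | bad r' /\ quarter r r'].
have fP r : bad r -> bad (f r) /\ quarter r (f r).
  by move=> /next[r' r'P]; exact: (@xgetPex _ r [set r' | bad r' /\ quarter r r'] (ex_intro _ r' r'P)).
pose rn n := iter n f (a0, b0, c0, d0).
have bad0 : bad (a0, b0, c0, d0) by [].
have badn n : bad (rn n) by elim: n => // n IH; have [] := fP _ IH.
have qn n : quarter (rn n) (rn n.+1) by have [] := fP _ (badn n).
pose an n := (rn n).1.1.1; pose bn n := (rn n).1.1.2.
pose cn n := (rn n).1.2; pose dn n := (rn n).2.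
have rnE n : rn n = (an n, bn n, cn n, dn n).
  by rewrite /an/bn/cn/dn; case: (rn n) => [[[? ?] ?] ?].
have nested (u v : nat -> R) : (forall n, [/\ u n <= u n.+1, v n.+1 <= v n & u n <= v n]) ->
    exists x, forall n, u n <= x <= v n.
  move=> uv; have umono n m : (n <= m)%N -> u n <= u m.
    by move=> /subnK <-; elim: (m - n)%N => // k /le_trans; apply; rewrite addSn; have [] := uv (k + n)%N.
  have vmono n m : (n <= m)%N -> v m <= v n.
    by move=> /subnK <-; elim: (m - n)%N => // k; apply: le_trans; rewrite addSn; have [] := uv (k + n)%N.
  have ubv n : ubound (range u) (v n).
    move=> _ [m _ <-]; have [_ _ h] := uv (maxn n m).
    apply: le_trans (umono _ _ (leq_maxr n m)) _; apply: le_trans h _.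
    exact: vmono (leq_maxl n m).
  have hs : has_sup (range u) by split; [exists (u 0%N), 0%N | exists (v 0%N)].
  exists (sup (range u)) => n; apply/andP; split.
    by apply: sup_upper_bound => //; exists n.
  by apply: sup_le_ub => //; exists (u 0%N), 0%N.
have [x xP] : exists x, forall n, an n <= x <= bn n.
  apply: nested => n; have := qn n; have := badn n; rewrite !rnE.
  by move=> [[[? ? ?] _] _] [[? ? ?] _].
have [y yP] : exists y, forall n, cn n <= y <= dn n.
  apply: nested => n; have := qn n; have := badn n; rewrite !rnE.
  by move=> [[_ [? ? ?]] _] [_ [? ? ?]].
have [e e0 He] := Ploc x y (xP 0%N) (yP 0%N).
have sz n : (bn n - an n) + (dn n - cn n) = ((b0 - a0) + (d0 - c0)) / 2 ^+ n.
  elim: n => [|n IH]; first by rewrite expr0 divr1.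
  have := qn n; rewrite !rnE => -[[_ _ ->] [_ _ ->]].
  by rewrite -mulrDl IH exprS; field; rewrite expf_neq0.
have [n nP] : exists n, ((b0 - a0) + (d0 - c0)) / 2 ^+ n < e.
  have [k kP] : exists k : nat, ((b0 - a0) + (d0 - c0)) / e < k%:R.
    exists (Num.bound (((b0 - a0) + (d0 - c0)) / e)).
    apply: archi_boundP; apply: divr_ge0; last exact: ltW.
    by apply: addr_ge0; rewrite subr_ge0.
  exists k; rewrite ltr_pdivrMr ?exprn_gt0//.
  move: kP; rewrite ltr_pdivrMr// mulrC => /lt_le_trans; apply.
  rewrite ler_pM2l// -natrX ler_nat; exact: ltnW (ltn_expl _ _).
have := badn n; rewrite rnE => -[[[h1 h2 h3] [h4 h5 h6]]]; apply.
by apply: He => //; rewrite sz.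
Qed.

End Bisection.

Section Goursat.
Context {R : realType}.
Implicit Types (h : CC R -> CC R) (a b c d : R).

Definition iC : CC R := mkC 0 1.

Definition rect_int h a b c d : CC R :=
  cint a b (fun x => h (mkC x c)) - cint a b (fun x => h (mkC x d)) +
  iC * (cint c d (fun y => h (mkC b y)) - cint c d (fun y => h (mkC a y))).

Definition on_rect a b c d (P : CC R -> Prop) : Prop :=
  forall x y, a <= x <= b -> c <= y <= d -> P (mkC x y).

Lemma mkCB x y x' y' : mkC x y - mkC x' y' = mkC (x - x') (y - y') :> CC R.
Proof. by []. Qed.

Lemma ccont_hline h x y : ccont h (mkC x y) -> rcont (fun t => h (mkC t y)) x.
Proof.
move=> ch e /ch[d d0 H]; exists d => // t td; apply: H.
by rewrite mkCB subrr cnorm_real.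
Qed.

Lemma ccont_vline h x y : ccont h (mkC x y) -> rcont (fun t => h (mkC x t)) y.
Proof.
move=> ch e /ch[d d0 H]; exists d => // t td; apply: H.
by rewrite mkCB subrr cnorm_imag.
Qed.

Lemma hline_on h a b y : (forall x, a <= x <= b -> ccont h (mkC x y)) ->
  rcont_on a b (fun t => h (mkC t y)).
Proof. by move=> H x /H/ccont_hline. Qed.

Lemma vline_on h c d x : (forall y, c <= y <= d -> ccont h (mkC x y)) ->
  rcont_on c d (fun t => h (mkC x t)).
Proof. by move=> H y /H/ccont_vline. Qed.

Lemma rect_int_split h a m b c n d : a <= m -> m <= b -> c <= n -> n <= d ->
  on_rect a b c d (ccont h) ->
  rect_int h a b c d = rect_int h a m c n + rect_int h a m n d +
                       (rect_int h m b c n + rect_int h m b n d).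
Proof.
move=> am mb cn nd H.
have ab := le_trans am mb; have cd := le_trans cn nd.
have hl y : c <= y <= d -> rcont_on a b (fun t => h (mkC t y)).
  by move=> yP; apply: hline_on => x xP; exact: H.
have vl x : a <= x <= b -> rcont_on c d (fun t => h (mkC x t)).
  by move=> xP; apply: vline_on => y yP; exact: H.
rewrite /rect_int.
rewrite (@cint_split _ a m b (fun t => h (mkC t c)))//; last by apply: hl; rewrite lexx.
rewrite (@cint_split _ a m b (fun t => h (mkC t d)))//; last by apply: hl; rewrite lexx cd.
rewrite (@cint_split _ c n d (fun t => h (mkC b t)))//; last by apply: vl; rewrite lexx ab.
rewrite (@cint_split _ c n d (fun t => h (mkC a t)))//; last by apply: vl; rewrite lexx ab.
ring.
Qed.

Lemma cnorm_iC : cnorm iC = 1.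
Proof. by rewrite cnorm_imag normr1. Qed.

Lemma rect_int_bound h a b c d B : a <= b -> c <= d ->
  on_rect a b c d (ccont h) -> on_rect a b c d (fun z => cnorm (h z) <= B) ->
  cnorm (rect_int h a b c d) <= 4 * B * ((b - a) + (d - c)).
Proof.
move=> ab cd H HB.
have aa : a <= a <= b by rewrite lexx. have bb : a <= b <= b by rewrite lexx ab.
have cc : c <= c <= d by rewrite lexx. have dd : c <= d <= d by rewrite lexx cd.
have hb y : c <= y <= d -> cnorm (cint a b (fun x => h (mkC x y))) <= 2 * B * (b - a).
  move=> yP; apply: cint_bound => //; last by move=> x xP; exact: HB.
  by apply: hline_on => x xP; exact: H.
have vb x : a <= x <= b -> cnorm (cint c d (fun y => h (mkC x y))) <= 2 * B * (d - c).
  move=> xP; apply: cint_bound => //; last by move=> y yP; exact: HB.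
  by apply: vline_on => y yP; exact: H.
rewrite /rect_int; apply: le_trans (ler_cnormD _ _) _; rewrite cnormM cnorm_iC mul1r.
have h1 := ler_cnormB (cint a b (fun x => h (mkC x c))) (cint a b (fun x => h (mkC x d))).
have h2 := ler_cnormB (cint c d (fun y => h (mkC b y))) (cint c d (fun y => h (mkC a y))).
have := hb c cc; have := hb d dd; have := vb a aa; have := vb b bb.
move: h1 h2; lra.
Qed.

Lemma rect_int_affine (A l z0 : CC R) a b c d : a <= b -> c <= d ->
  rect_int (fun z => A + l * (z - z0)) a b c d = 0.
Proof.
move=> ab cd.
have cstc (u v : R) (k : CC R) : rcont_on u v (fun=> k).
  by move=> x _ e e0; exists 1 => // y _; rewrite subrr cnorm0.
have idc (u v : R) : rcont_on u v (fun t => mkC t 0).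
  by move=> x _ e e0; exists e => // y; rewrite mkCB subrr cnorm_real.
have mulc (u v : R) (k : CC R) : rcont_on u v (fun t => k * mkC t 0).
  move=> x _ e e0; exists (e / (cnorm k + 1)) => [|y].
    by rewrite divr_gt0// ltr_wpDl ?cnorm_ge0.
  rewrite ltr_pdivlMr ?ltr_wpDl ?cnorm_ge0// => H.
  rewrite -mulrBr cnormM mkCB subrr cnorm_real; apply: le_lt_trans H.
  by rewrite mulrC ler_wpM2l// lerDl.
have hl y : cint a b (fun x => A + l * (mkC x y - z0)) =
    mkC (b - a) 0 * (A + l * (iC * mkC y 0 - z0)) + l * mkC ((b ^+ 2 - a ^+ 2) / 2) 0.
  rewrite -cint_id// -cintZ// -cint_cst// -cintD//.
  apply: eq_cint => x _; rewrite (_ : mkC x y = mkC x 0 + iC * mkC y 0); first by ring.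
  by rewrite /mkC/iC; simpc.
have vl x : cint c d (fun y => A + l * (mkC x y - z0)) =
    mkC (d - c) 0 * (A + l * (mkC x 0 - z0)) + (l * iC) * mkC ((d ^+ 2 - c ^+ 2) / 2) 0.
  rewrite -cint_id// -cintZ// -cint_cst// -cintD//.
  apply: eq_cint => y _; rewrite (_ : mkC x y = mkC x 0 + iC * mkC y 0); first by ring.
  by rewrite /mkC/iC; simpc.
rewrite /rect_int !hl !vl.
have mB (u v : R) : mkC (u - v) 0 = mkC u 0 - mkC v 0 :> CC R by rewrite mkCB subrr.
rewrite !mB; ring.
Qed.

(** Goursat's theorem: near a point the integral differs from that of an affine function by
    an error of smaller order than the square of the perimeter, a quantity that the four
    quarters of a rectangle share out exactly. *)
Lemma goursat h a b c d : a <= b -> c <= d ->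
  on_rect a b c d (fun z => exists l, cder h z l) -> rect_int h a b c d = 0.
Proof.
move=> ab cd H.
have Hc : on_rect a b c d (ccont h).
  by move=> x y xP yP; have [l /cder_cont] := H x y xP yP.
suff small e : 0 < e -> cnorm (rect_int h a b c d) <= e * ((b - a) + (d - c)) ^+ 2.
  apply/eqP; rewrite -cnorm_eq0 eq_le cnorm_ge0 andbT leNgt; apply/negP => J0.
  set s := (b - a) + (d - c) in small.
  have s1 : 0 < s ^+ 2 + 1 by rewrite ltr_wpDl ?sqr_ge0.
  have := small (cnorm (rect_int h a b c d) / (s ^+ 2 + 1)) (divr_gt0 J0 s1).
  rewrite mulrAC -mulrA leNgt => /negP; apply.
  by rewrite gtr_pMr// ltr_pdivrMr// mul1r ltrDl.
move=> e0.
apply: (@bisection_rect _ (fun a b c d =>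
  cnorm (rect_int h a b c d) <= e * ((b - a) + (d - c)) ^+ 2)) => //.
  move=> a' b' c' d' aa ab' bb cc cd' dd.
  have : rect_int h a' b' c' d' = _ := @rect_int_split h a' ((a' + b') / 2) b' c' ((c' + d') / 2) d' _ _ _ _ _.
  move=> -> //; try lra; last first.
    by move=> x y /andP[x1 x2] /andP[y1 y2]; apply: Hc; apply/andP; split; lra.
  set J1 := rect_int _ _ _ _ _; set J2 := rect_int _ _ _ _ _.
  set J3 := rect_int _ _ _ _ _; set J4 := rect_int _ _ _ _ _ => h1 h2 h3 h4.
  have := ler_cnormD (J1 + J2) (J3 + J4); have := ler_cnormD J1 J2; have := ler_cnormD J3 J4.
  move: h1 h2 h3 h4; set s := (b' - a') + (d' - c').
  rewrite (_ : (a' + b') / 2 - a' + ((c' + d') / 2 - c') = s / 2); last by rewrite /s; field.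
  rewrite (_ : (a' + b') / 2 - a' + (d' - (c' + d') / 2) = s / 2); last by rewrite /s; field.
  rewrite (_ : b' - (a' + b') / 2 + ((c' + d') / 2 - c') = s / 2); last by rewrite /s; field.
  rewrite (_ : b' - (a' + b') / 2 + (d' - (c' + d') / 2) = s / 2); last by rewrite /s; field.
  lra.
move=> x y xP yP; have [l hl] := H x y xP yP.
have [dl dl0 Hd] := hl (e / 4) (divr_gt0 e0 (ltr0Sn _ 3)).
exists dl => // a' b' c' d' aa bb cc dd /andP[ax xb] /andP[cy yd] sdl.
set s := (b' - a') + (d' - c') in sdl *.
pose A z := h (mkC x y) + l * (z - mkC x y).
have ab' : a' <= b' by lra.
have cd' : c' <= d' by lra.
have Ac z : ccont A z.
  apply: (@cder_cont _ _ _ (0 + (l * (1 - 0) + (z - mkC x y) * 0))).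
  exact: cderD (cder_cst _ _) (cderM (cder_cst _ _) (cderB (cder_id _) (cder_cst _ _))).
have hA z : ccont h z -> ccont (fun z => h z - A z) z.
  by move=> ch; apply: ccontB.
have sub (P : CC R -> Prop) : on_rect a b c d P -> on_rect a' b' c' d' P.
  by move=> HP u v /andP[u1 u2] /andP[v1 v2]; apply: HP; apply/andP; split; lra.
have -> : rect_int h a' b' c' d' = rect_int (fun z => h z - A z) a' b' c' d'.
  rewrite -[RHS]addr0 -(rect_int_affine (h (mkC x y)) l (mkC x y) ab' cd') -/A /rect_int.
  have hB v : c' <= v <= d' -> cint a' b' (fun u => h (mkC u v) - A (mkC u v)) =
      cint a' b' (fun u => h (mkC u v)) - cint a' b' (fun u => A (mkC u v)).
    move=> vP; apply: (@cintB _ _ _ (fun u => h (mkC u v)) (fun u => A (mkC u v))).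
      by apply: hline_on => u uP; exact: (sub _ Hc).
    by apply: hline_on => u uP; exact: Ac.
  have vB u : a' <= u <= b' -> cint c' d' (fun v => h (mkC u v) - A (mkC u v)) =
      cint c' d' (fun v => h (mkC u v)) - cint c' d' (fun v => A (mkC u v)).
    move=> uP; apply: (@cintB _ _ _ (fun v => h (mkC u v)) (fun v => A (mkC u v))).
      by apply: vline_on => v vP; exact: (sub _ Hc).
    by apply: vline_on => v vP; exact: Ac.
  by rewrite !hB ?vB ?lexx ?ab' ?cd'//; ring.
have -> : e * s ^+ 2 = 4 * (e / 4 * s) * s by field.
apply: rect_int_bound => // u v uP vP; first by apply: hA; exact: (sub _ Hc).
have uvs : cnorm (mkC u v - mkC x y) <= s.
  apply: le_trans (ler_cnorm_ReIm _) _; rewrite mkCB /cRe/cIm/= /s.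
  move: uP vP => /andP[u1 u2] /andP[v1 v2].
  by apply: lerD; rewrite ler_norml; apply/andP; split; lra.
rewrite /A opprD addrA; apply: le_trans (Hd _ _) _; first exact: le_lt_trans sdl.
by rewrite ler_wpM2l// divr_ge0// ltW.
Qed.

End Goursat.

(** * The complex exponential *)

Section ComplexExponential.
Context {R : realType}.
Implicit Types (z w : CC R).

Definition cexp z : CC R := mkC (expR (cRe z) * cos (cIm z)) (expR (cRe z) * sin (cIm z)).

Lemma cexpD z w : cexp (z + w) = cexp z * cexp w.
Proof.
rewrite /cexp cReD cImD expRD cosD sinD /mkC.
rewrite -[RHS]/(Complex _ _); congr Complex; ring.
Qed.

Lemma cnorm_cexp z : cnorm (cexp z) = expR (cRe z).
Proof.
rewrite /cnorm/cexp/mkC/= !exprMn -mulrDr cos2Dsin2 mulr1 sqrtr_sqr.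
by rewrite ger0_norm// expR_ge0.
Qed.

Lemma cexp_neq0 z : cexp z != 0.
Proof. by rewrite -cnorm_gt0 cnorm_cexp expR_gt0. Qed.

Lemma cexp0 : cexp 0 = 1.
Proof. by rewrite /cexp/cRe/cIm/= expR0 cos0 sin0 mulr1 mulr0. Qed.

Lemma cexpN z : cexp (- z) = (cexp z)^-1.
Proof.
apply: (mulfI (cexp_neq0 z)); rewrite divff ?cexp_neq0//.
by rewrite -cexpD subrr cexp0.
Qed.

Lemma real_is_derive_eps (u : R -> R) (x l : R) : is_derive x 1 u l ->
  forall e : R, 0 < e -> exists2 d : R, 0 < d &
  forall h, `|h| < d -> `|u (x + h) - u x - l * h| <= e * `|h|.
Proof.
move=> [du <-] e e0.
have H0 := (iffLR (@cvgrPdist_le _ _ _ (0^') (dnbhs_filter (0 : R)) _ _)) du e e0.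
have [d /= d0 Hd] := H0; exists d => // h hd.
have [->|h0] := eqVneq h 0; first by rewrite addr0 subrr mulr0 subr0 normr0 mulr0.
have := Hd h; rewrite /ball_/= sub0r normrN => /(_ hd h0).
rewrite /shift/= [h%:A]mulr1 [h + x]addrC distrC [lim _](_ : _ = 'D_1 u x)//.
move=> H.
rewrite (_ : _ - _ = h * (h^-1 *: (u (x + h) - u x) - 'D_1 u x)).
  by rewrite normrM mulrC ler_wpM2r.
by rewrite /GRing.scale/=; field.
Qed.

(** It is enough to differentiate at the origin, by [cexpD]. There the errors of the linear
    approximations of [expR], [cos] and [sin] are combined. *)
Lemma cder_cexp0 : cder cexp 0 1.
Proof.
move=> e e0; have e8 : 0 < e / 8 by rewrite divr_gt0.
have [d1 d10 H1] := real_is_derive_eps (is_derive_expR (0 : R)) e8.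
have [d2 d20 H2] := real_is_derive_eps (is_derive_cos (0 : R)) e8.
have [d3 d30 H3] := real_is_derive_eps (is_derive_sin (0 : R)) e8.
have [d4 d40 H4] := real_is_derive_eps (is_derive_expR (0 : R)) (@ltr01 R).
exists (Num.min (Num.min d1 (Num.min d2 d3)) (Num.min d4 (Num.min (1 / 2) (e / 8)))).
  by rewrite !lt_min d10 d20 d30 d40 e8 divr_gt0.
move=> w; rewrite subr0 !lt_min => /andP[/andP[w1 /andP[w2 w3]] /andP[w4 /andP[w5 w6]]].
rewrite mul1r cexp0; apply: le_trans (ler_cnorm_ReIm _) _.
rewrite !cReB !cImB /cexp [cRe (mkC _ _)]/= [cIm (mkC _ _)]/= [cRe 1]/= [cIm 1]/= subr0.
have nx := ler_Re_cnorm w; have ny := ler_Im_cnorm w.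
set x := cRe w in nx *; set y := cIm w in ny *; set N := cnorm w in nx ny w1 w2 w3 w4 w5 w6 *.
have {H1} := H1 x (le_lt_trans nx w1); rewrite add0r expR0 mul1r => H1.
have {H2} := H2 y (le_lt_trans ny w2); rewrite add0r cos0 sin0 oppr0 mul0r subr0 => H2.
have {H3} := H3 y (le_lt_trans ny w3); rewrite add0r sin0 cos0 mul1r subr0 => H3.
have {H4} := H4 x (le_lt_trans nx w4); rewrite add0r expR0 !mul1r => H4.
have N0 : 0 <= N by exact: cnorm_ge0.
have Ex1 : `|expR x - 1| <= 2 * N.
  rewrite -(subrK x (expR x - 1)); apply: le_trans (ler_normD _ _) _.
  by rewrite mulr2n mulrDl mul1r; apply: lerD => //; apply: le_trans H4 _.
have Ex2 : `|expR x| <= 2.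
  rewrite -(subrK 1 (expR x)); apply: le_trans (ler_normD _ _) _.
  rewrite normr1; lra.
rewrite (_ : expR x * cos y - 1 - x = (expR x - 1 - x) + expR x * (cos y - 1)); last by ring.
rewrite (_ : expR x * sin y - y = expR x * (sin y - y) + (expR x - 1) * y); last by ring.
have a1 := ler_normD (expR x - 1 - x) (expR x * (cos y - 1)).
have a2 := ler_normD (expR x * (sin y - y)) ((expR x - 1) * y).
rewrite !normrM in a1 a2.
have b1 : `|expR x| * `|cos y - 1| <= 2 * (e / 8 * N).
  apply: ler_pM => //; apply: le_trans H2 _; exact: ler_wpM2l (ltW e8) _ _ ny.
have b2 : `|expR x| * `|sin y - y| <= 2 * (e / 8 * N).
  apply: ler_pM => //; apply: le_trans H3 _; exact: ler_wpM2l (ltW e8) _ _ ny.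
have b3 : `|expR x - 1| * `|y| <= 2 * (e / 8) * N.
  by apply: ler_pM => //; apply: le_trans Ex1 _; rewrite ler_wpM2l// ltW.
have b4 : `|expR x - 1 - x| <= e / 8 * N.
  apply: le_trans H1 _; exact: ler_wpM2l (ltW e8) _ _ nx.
have eN : 0 <= e * N by rewrite mulr_ge0// ltW.
lra.
Qed.

Lemma cder_cexp z : cder cexp z (cexp z).
Proof.
have h : cder (fun w => cexp z * cexp (w - z)) z (cexp z).
  have s : cder (fun w => w - z) z 1.
    by rewrite -[X in cder _ _ X]subr0; exact: cderB (cder_id _) (cder_cst _ _).
  have c0 : cder cexp (z - z) 1 by rewrite subrr; exact: cder_cexp0.
  have := cderM (cder_cst (cexp z) z) (cder_comp s c0).
  by rewrite /= mulr1 mulr1 mulr0 addr0.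
apply: cder_near h; exists 1 => // w _.
by rewrite -cexpD addrC subrK.
Qed.

Definition twopii : CC R := mkC 0 (2 * pi).

(** Normalized to have period one. *)
Definition e1 z : CC R := cexp (twopii * z).

Lemma e1D z w : e1 (z + w) = e1 z * e1 w.
Proof. by rewrite /e1 mulrDr cexpD. Qed.

Lemma e1N z : e1 (- z) = (e1 z)^-1.
Proof. by rewrite /e1 mulrN cexpN. Qed.

Lemma e1_neq0 z : e1 z != 0. Proof. exact: cexp_neq0. Qed.

Lemma e1_0 : e1 0 = 1. Proof. by rewrite /e1 mulr0 cexp0. Qed.

Lemma e1_1 : e1 1 = 1.
Proof.
rewrite /e1/twopii mulr1 /cexp/cRe/cIm/= expR0 !mul1r mulrC mulr_natr.
by rewrite cos2pi sin2pi.
Qed.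

Lemma e1_per z : e1 (z + 1) = e1 z.
Proof. by rewrite e1D e1_1 mulr1. Qed.

Lemma cnorm_e1 z : cnorm (e1 z) = expR (- (2 * pi * cIm z)).
Proof. by rewrite cnorm_cexp cReM /twopii/= mul0r sub0r. Qed.

Lemma twopii_neq0 : twopii != 0.
Proof. by rewrite -cnorm_gt0 cnorm_imag normr_gt0 mulf_neq0// gt_eqF// pi_gt0. Qed.

Lemma cder_e1 z : cder e1 z (twopii * e1 z).
Proof.
have s : cder (fun w => twopii * w) z twopii.
  by have := cderM (cder_cst twopii z) (cder_id z); rewrite /= mulr1 mulr0 addr0.
by have := cder_comp s (cder_cexp _); rewrite mulrC.
Qed.

Lemma ccont_e1 z : ccont e1 z.
Proof. exact: cder_cont (cder_e1 z). Qed.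

(** The norm gives that [z] is real. Its fractional part [x] is below one, where
    [1 - cos (2 pi x) = 2 sin (pi x) ^ 2] only vanishes at zero. *)
Lemma e1_eq1 z : e1 z = 1 -> exists n : int, z = n%:~R.
Proof.
move=> ez.
have y0 : cIm z = 0.
  have := cnorm_e1 z; rewrite ez cnorm1 => /(congr1 (@ln R)); rewrite expRK ln1 => /eqP.
  by rewrite eq_sym oppr_eq0 !mulf_eq0 pnatr_eq0 (gt_eqF (pi_gt0 R))//= => /eqP.
pose n := Num.floor (cRe z); exists n.
pose x := cRe z - n%:~R.
have x01 : 0 <= x < 1.
  by have /andP[h1 h2] := floor_itv (cRe z); rewrite /x -/n; move: h2; rewrite intrD; lra.
have e1int (m : int) : e1 m%:~R = 1.
  case: m => m; last rewrite NegzE rmorphN /= e1N.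
    elim: m => [|m IH]; first exact: e1_0.
    by rewrite -addn1 PoszD intrD /= e1_per.
  suff -> : e1 (m.+1%:R) = 1 by rewrite invr1.
  by elim: m => [|m IH]; [exact: e1_1|rewrite -addn1 natrD e1_per].
have zx : z = n%:~R + mkC x 0.
  rewrite {1}(mkCE z) y0 /x (_ : mkC (_ - _) _ = mkC (cRe z) 0 - mkC n%:~R 0); last by rewrite mkCB subrr.
  rewrite (_ : mkC n%:~R 0 = n%:~R); first by rewrite addrC subrK.
  by rewrite -[mkC _ _]/((n%:~R)%:C%C : R[i]) rmorph_int.
have : e1 (mkC x 0) = 1 by rewrite -ez zx e1D e1int mul1r.
have re : cRe (twopii * mkC x 0) = 0 by rewrite cReM /cRe/cIm/=; ring.
have im : cIm (twopii * mkC x 0) = 2 * pi * x by rewrite cImM /cRe/cIm/=; ring.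
rewrite /e1 /cexp re im expR0 mul1r => /(congr1 cRe); rewrite [LHS]/= [RHS]/=.
rewrite (_ : 2 * pi * x = (pi * x) *+ 2); last by ring.
rewrite mulr2n cosD -!expr2 cos2sin2 => E.
have {E} : sin (pi * x) ^+ 2 = 0 by lra.
move=> /eqP; rewrite sqrf_eq0 => /eqP s0.
suff x0 : x = 0 by rewrite zx x0 -[mkC 0 0]/(0 : CC R) addr0.
apply/eqP; rewrite eq_le; move/andP: x01 => [-> x1]; rewrite andbT leNgt; apply/negP => x0.
have : 0 < sin (pi * x).
  apply: sin_gt0_pi; apply/andP; split; first exact: mulr_gt0 (pi_gt0 R) x0.
  by rewrite gtr_pMr// pi_gt0.
by rewrite s0 ltxx.
Qed.

End ComplexExponential.

(** * Cauchy's theorem in strips and discs *)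

Section Strip.
Context {R : realType}.
Implicit Types (h g : CC R -> CC R) (y : R).

Definition line_int h y : CC R := cint 0 1 (fun x => h (mkC x y)).

Definition cont_line h y : Prop := forall x, ccont h (mkC x y).

Lemma cont_line_on h y : cont_line h y -> rcont_on 0 1 (fun x => h (mkC x y)).
Proof. by move=> ch; apply: hline_on => x _; exact: ch. Qed.

Lemma eq_line_int h g y : (forall x, h (mkC x y) = g (mkC x y)) -> line_int h y = line_int g y.
Proof. by move=> hg; apply: eq_cint => x _; exact: hg. Qed.

Lemma line_intD h g y : cont_line h y -> cont_line g y ->
  line_int (fun z => h z + g z) y = line_int h y + line_int g y.
Proof. by move=> /cont_line_on ch /cont_line_on cg; exact: cintD. Qed.

Lemma line_intB h g y : cont_line h y -> cont_line g y ->
  line_int (fun z => h z - g z) y = line_int h y - line_int g y.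
Proof. by move=> /cont_line_on ch /cont_line_on cg; exact: cintB. Qed.

Lemma line_intZ (c : CC R) h y : cont_line h y ->
  line_int (fun z => c * h z) y = c * line_int h y.
Proof. by move=> /cont_line_on ch; exact: cintZ. Qed.

Lemma line_int_cst (c : CC R) y : line_int (fun=> c) y = c.
Proof. by rewrite /line_int cint_cst ?ler01// subr0 -[mkC 1 0]/(1 : CC R) mul1r. Qed.

Lemma line_int_bound h y B : cont_line h y ->
  (forall x, 0 <= x <= 1 -> cnorm (h (mkC x y)) <= B) -> cnorm (line_int h y) <= 2 * B.
Proof.
move=> /cont_line_on ch hB; apply: le_trans (cint_bound ler01 ch hB) _.
by rewrite subr0 mulr1.
Qed.

Definition periodic1 h : Prop := forall z, h (z + 1) = h z.

Lemma mkC1D (x y : R) : mkC (x + 1) y = mkC x y + 1 :> CC R.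
Proof. by rewrite -[mkC x y + 1]/(mkC (x + 1) (y + 0)) addr0. Qed.

Lemma mkC0_1 y : mkC 1 y = mkC 0 y + 1 :> CC R.
Proof. by rewrite -mkC1D add0r. Qed.

(** The two vertical sides of a rectangle of width one cancel. *)
Lemma line_int_strip h y1 y2 : periodic1 h -> y1 <= y2 ->
  (forall x y, y1 <= y <= y2 -> exists l, cder h (mkC x y) l) ->
  line_int h y1 = line_int h y2.
Proof.
move=> ph y12 H.
have := goursat ler01 y12 (fun x y _ => H x y).
rewrite /rect_int (_ : cint y1 y2 (fun y => h (mkC 1 y)) = cint y1 y2 (fun y => h (mkC 0 y))).
  by rewrite subrr mulr0 addr0 => /eqP; rewrite subr_eq0 => /eqP.
by apply: eq_cint => y _; rewrite mkC0_1 ph.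
Qed.

(** Bisection of the segment makes continuity along it uniform. *)
Lemma tube_cont h y0 (e : R) : 0 < e -> (forall x, 0 <= x <= 1 -> ccont h (mkC x y0)) ->
  exists2 d : R, 0 < d & forall x y, 0 <= x <= 1 -> `|y - y0| < d ->
    cnorm (h (mkC x y) - h (mkC x y0)) <= e.
Proof.
move=> e0 ch.
(* The second side of the rectangle is degenerate: only the segment is bisected. *)
apply: (@bisection_rect _ (fun a b _ _ => exists2 d : R, 0 < d & forall x y,
   a <= x <= b -> `|y - y0| < d -> cnorm (h (mkC x y) - h (mkC x y0)) <= e) 0 1 y0 y0) => //.
  move=> a b c d _ _ _ _ _ _ [d1 d10 H1] _ [d2 d20 H2] _.
  exists (Num.min d1 d2) => [|x y /andP[ax xb]]; first by rewrite lt_min d10.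
  rewrite lt_min => /andP[yd1 yd2]; have [xm|mx] := leP x ((a + b) / 2).
    by apply: H1 => //; rewrite ax.
  by apply: H2 => //; rewrite xb ltW.
move=> x y xP /andP[yy0 y0y].
have [d d0 Hd] := ch x xP (e / 2) (divr_gt0 e0 (ltr0Sn _ 1)).
exists (d / 2); first by rewrite divr_gt0.
move=> a b c c' _ _ c0 c1 /andP[ax xb] /andP[cy yd] small.
exists (d / 2); first by rewrite divr_gt0.
move=> u v /andP[au ub] vd.
have near w : `|w - y0| < d / 2 -> cnorm (mkC u w - mkC x y0) < d.
  move=> wd; apply: le_lt_trans (ler_cnorm_ReIm _) _; rewrite mkCB /cRe/cIm/= (splitr d).
  apply: ltrD => //; rewrite ltr_norml; apply/andP; split; lra.
have h1 := Hd _ (near v vd).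
have h2 : cnorm (h (mkC u y0) - h (mkC x y0)) < e / 2.
  by apply: Hd; apply: near; rewrite subrr normr0 divr_gt0.
rewrite cnormB in h2; apply: le_trans (ler_cdistD (h (mkC x y0)) _ _) _; rewrite [leRHS]splitr.
by apply: lerD; apply: ltW.
Qed.

Lemma line_int_cont h y0 (e : R) : 0 < e -> cont_line h y0 ->
  exists2 d : R, 0 < d & forall y, `|y - y0| < d -> cont_line h y ->
    cnorm (line_int h y - line_int h y0) <= e.
Proof.
move=> e0 ch; have [d d0 Hd] := @tube_cont h y0 (e / 2) (divr_gt0 e0 (ltr0Sn _ 1)) (fun x _ => ch x).
exists d => // y yd chy; rewrite /line_int -cintB; try exact: cont_line_on.
apply: le_trans (@cint_bound _ _ _ _ (e / 2) ler01 _ _) _.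
- move=> x xP; have c1 := ccont_hline (chy x); have c2 := ccont_hline (ch x).
  move=> e' e'0; have [d1 d10 H1] := c1 (e' / 2) (divr_gt0 e'0 (ltr0Sn _ 1)).
  have [d2 d20 H2] := c2 (e' / 2) (divr_gt0 e'0 (ltr0Sn _ 1)).
  exists (Num.min d1 d2); first by rewrite lt_min d10.
  move=> t; rewrite lt_min => /andP[/H1 h1 /H2 h2].
  rewrite (_ : _ + _ = (h (mkC t y) - h (mkC x y)) - (h (mkC t y0) - h (mkC x y0))); last by ring.
  by rewrite (le_lt_trans (ler_cnormB _ _))// (splitr e') ltrD.
- by move=> x xP; exact: Hd.
- by rewrite subr0 mulr1 mulrC divfK.
Qed.

(** Both sides of the line [Im z = y0] are compared with it, the integral being continuous
    in the height of the line. *)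
Lemma line_int_strip_exc h y0 y1 y2 : periodic1 h -> y1 < y0 < y2 ->
  (forall y, y1 <= y <= y2 -> cont_line h y) ->
  (forall x y, y1 <= y <= y2 -> y != y0 -> exists l, cder h (mkC x y) l) ->
  line_int h y1 = line_int h y2.
Proof.
move=> ph /andP[y10 y02] ch dh; have c0 : cont_line h y0 by apply: ch; rewrite !ltW.
have small e : 0 < e -> cnorm (line_int h y1 - line_int h y2) <= e.
  move=> e0; have [d d0 Hd] := line_int_cont (divr_gt0 e0 (ltr0Sn _ 1)) c0.
  pose t := Num.min (d / 2) (Num.min (y0 - y1) (y2 - y0)).
  have t0 : 0 < t by rewrite !lt_min divr_gt0//= !subr_gt0 y10.
  have td : t < d by rewrite gt_min; apply/orP; left; lra.
  have t1 : t <= y0 - y1 by rewrite ge_min ge_min lexx orbT.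
  have t2 : t <= y2 - y0 by rewrite ge_min ge_min lexx !orbT.
  have -> : line_int h y1 = line_int h (y0 - t).
    apply: line_int_strip => //; first by lra.
    move=> x y /andP[ya yb]; apply: dh; first by apply/andP; split; lra.
    by rewrite lt_eqF//; lra.
  have <- : line_int h (y0 + t) = line_int h y2.
    apply: line_int_strip => //; first by lra.
    move=> x y /andP[ya yb]; apply: dh; first by apply/andP; split; lra.
    by rewrite gt_eqF//; lra.
  have h1 : cnorm (line_int h (y0 - t) - line_int h y0) <= e / 2.
    apply: Hd; last by apply: ch; apply/andP; split; lra.
    by rewrite addrC addKr normrN gtr0_norm.
  have h2 : cnorm (line_int h (y0 + t) - line_int h y0) <= e / 2.
    apply: Hd; last by apply: ch; apply/andP; split; lra.
    by rewrite addrC addKr gtr0_norm.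
  rewrite cnormB in h2; apply: le_trans (ler_cdistD (line_int h y0) _ _) _.
  by rewrite [leRHS]splitr lerD.
apply/eqP; rewrite -subr_eq0 -cnorm_eq0 eq_le cnorm_ge0 andbT.
by apply/ler_addgt0Pr => e /small; rewrite add0r.
Qed.

Lemma line_bounded h y : cont_line h y ->
  exists2 M : R, 0 < M & forall x, 0 <= x <= 1 -> cnorm (h (mkC x y)) <= M.
Proof.
move=> ch; have [|c _ hc] := @EVT_max R (fun x => cnorm (h (mkC x y))) 0 1 ler01.
  apply: continuous_subspaceT => x; rewrite /continuous_at; apply/cvgrPdist_lt => e e0.
  have [d d0 Hd] := ccont_hline (ch x) e0; apply/nbhs_ballP; exists d => //= w.
  rewrite /ball/= distrC => /Hd h1; apply: le_lt_trans h1; rewrite cnormB.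
  by rewrite ler_norml ler_cnorm_sub andbT lerNl opprB cnormB ler_cnorm_sub.
exists (cnorm (h (mkC c y)) + 1) => [|x xP]; first by rewrite ltr_wpDl ?cnorm_ge0.
by apply: le_trans (hc x _) _; [rewrite in_itv | rewrite lerDl].
Qed.

End Strip.

Section Removable.
Context {R : realType}.
Implicit Types (f g : CC R -> CC R) (w z : CC R) (r rho y : R).

(** The upper half plane, wound onto the punctured disc of radius [rho]. *)
Definition disc_e rho z : CC R := mkC rho 0 * e1 z.

Lemma cnorm_disc_e rho x y : 0 <= rho -> cnorm (disc_e rho (mkC x y)) = rho * expR (- (2 * pi * y)).
Proof. by move=> r0; rewrite cnormM cnorm_real cnorm_e1 ger0_norm. Qed.

Lemma disc_e_per rho : periodic1 (disc_e rho).
Proof. by move=> z; rewrite /disc_e e1_per. Qed.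

Lemma cder_disc_e rho z : exists l, cder (disc_e rho) z l.
Proof. by eexists; exact: cderM (cder_cst _ _) (cder_e1 _). Qed.

Lemma ccont_disc_e rho z : ccont (disc_e rho) z.
Proof. by have [l /cder_cont] := cder_disc_e rho z. Qed.

Lemma disc_e_neq0 rho z : 0 < rho -> disc_e rho z != 0.
Proof. by move=> r0; rewrite mulf_neq0 ?e1_neq0// -cnorm_gt0 cnorm_real normr_gt0 gt_eqF. Qed.

Lemma expR_small rho (eta Y0 : R) : 0 < rho -> 0 < eta ->
  exists2 Y : R, Y0 < Y /\ 0 < Y & rho * expR (- (2 * pi * Y)) < eta.
Proof.
move=> r0 eta0; exists (`|Y0| + 1 + rho / eta).
  have := ler_norm Y0; have : 0 < rho / eta by rewrite divr_gt0.
  have := normr_ge0 Y0; lra.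
set Y := _ + _ + _; have Y1 : rho / eta < Y + 1 by rewrite /Y; have := normr_ge0 Y0; lra.
have Y0' : 0 <= Y by rewrite /Y !addr_ge0// ?ltW// divr_gt0.
apply: (@le_lt_trans _ _ (rho * expR (- Y))).
  rewrite ler_pM2l// ler_expR lerN2 ler_peMl//.
  by have := pi_ge2 R; lra.
rewrite expRN ltr_pdivrMr ?expR_gt0// mulrC -ltr_pdivrMr//.
by apply: lt_le_trans Y1 _; rewrite addrC expR_ge1Dx.
Qed.

(** Cauchy's theorem for a circle: the circle is the line [y = 0], and the integrals over
    higher lines, which are smaller and smaller circles, tend to zero. *)
Lemma circle_int_eq0 g r rho w0 : 0 < rho -> rho < r -> cnorm w0 < rho ->
  (forall w, cnorm w < r -> ccont g w) ->
  (forall w, cnorm w < r -> w != w0 -> exists l, cder g w l) ->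
  line_int (fun z => g (disc_e rho z) * disc_e rho z) 0 = 0.
Proof.
move=> r0 rr w0r cg dg; set H := fun z => _.
have inD x y : 0 <= y -> cnorm (disc_e rho (mkC x y)) < r.
  move=> y0; rewrite cnorm_disc_e ?ltW//; apply: le_lt_trans rr.
  rewrite ger_pMr// -expR0 ler_expR oppr_le0 mulr_ge0// mulr_ge0//; exact: pi_ge0.
have cH y : 0 <= y -> cont_line H y.
  move=> y0 x; apply: ccontM (ccont_disc_e _ _).
  by apply: (@ccont_comp _ (disc_e rho) g); [exact: ccont_disc_e | apply: cg; exact: inD].
have pH : periodic1 H by move=> z; rewrite /H disc_e_per.
(* The line that winds onto the circle through [w0]; when [w0 = 0] there is none, and any
   positive height will do. *)
pose y0 : R := if w0 == 0 then 1 else ln (rho / cnorm w0) / (2 * pi).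
have pi20 : 0 < 2 * pi :> R by rewrite mulr_gt0// pi_gt0.
have y00 : 0 < y0.
  rewrite /y0; case: ifPn => // w00; rewrite divr_gt0// ln_gt0//.
  by rewrite ltr_pdivlMr ?cnorm_gt0// mul1r.
have dH x y : 0 <= y -> y != y0 -> exists l, cder H (mkC x y) l.
  move=> yge yy0; have : disc_e rho (mkC x y) != w0.
    apply: contra yy0 => /eqP E; rewrite /y0 -E (negPf (disc_e_neq0 _ r0)).
    have -> : rho / cnorm (disc_e rho (mkC x y)) = expR (2 * pi * y).
      by rewrite cnorm_disc_e ?ltW// expRN; field; rewrite !gt_eqF ?expR_gt0.
    rewrite expRK.
    by rewrite mulrC mulKf// gt_eqF.
  move=> /(dg _ (inD x y yge))[l hl]; have [m hm] := cder_disc_e rho (mkC x y).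
  by eexists; exact: cderM (cder_comp hm hl) hm.
have c00 : cnorm (0 : CC R) < r by rewrite cnorm0; exact: lt_trans rr.
have [d d0 Hd] := cg 0 c00 1 ltr01.
pose B := cnorm (g 0) + 1; have B0 : 0 < B by rewrite ltr_wpDl ?cnorm_ge0.
apply/eqP; rewrite -cnorm_eq0 eq_le cnorm_ge0 andbT.
apply/ler_addgt0Pr => e e0; rewrite add0r.
have eta0 : 0 < Num.min d (e / (2 * B)) by rewrite lt_min d0 divr_gt0// mulr_gt0.
have [Y [Yy0 Y0]] := expR_small y0 r0 eta0; rewrite lt_min => /andP[Yd Ye].
have -> : line_int H 0 = line_int H Y.
  apply: (@line_int_strip_exc _ _ y0) => //; first by rewrite y00.
    by move=> y /andP[yge _]; exact: cH.
  by move=> x y /andP[yge _] yy0; exact: dH.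
apply: le_trans (@line_int_bound _ _ _ (e / 2) (cH _ (ltW Y0)) _) _; last by rewrite mulrC divfK.
move=> x _; rewrite /H cnormM.
have nY : cnorm (disc_e rho (mkC x Y)) < d by rewrite cnorm_disc_e// ltW.
have gB : cnorm (g (disc_e rho (mkC x Y))) <= B.
  have := Hd (disc_e rho (mkC x Y)); rewrite subr0 => /(_ nY).
  have := ler_cnorm_sub (g (disc_e rho (mkC x Y))) (g 0); rewrite /B; lra.
have -> : e / 2 = B * (e / (2 * B)) by field; rewrite gt_eqF.
apply: ler_pM => //; try exact: cnorm_ge0.
by rewrite cnorm_disc_e; exact: ltW.
Qed.

Definition dquot f w0 (l : CC R) w : CC R :=
  if w == w0 then l else (f w - f w0) / (w - w0).

Lemma ccont_punctured f g (a : CC R) : ccont f a -> ccont g a ->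
  (\forall w \near a, w != a -> f w = g w) -> f a = g a.
Proof.
move=> cf cg /nbhs_cnorm[d d0 Hd].
apply/eqP; rewrite -subr_eq0 -cnorm_eq0 eq_le cnorm_ge0 andbT.
apply/ler_addgt0Pr => e e0; rewrite add0r.
have [d1 d10 H1] := cf (e / 2) (divr_gt0 e0 (ltr0Sn _ 1)).
have [d2 d20 H2] := cg (e / 2) (divr_gt0 e0 (ltr0Sn _ 1)).
pose t := Num.min (Num.min d1 d2) d / 2.
have m0 : 0 < Num.min (Num.min d1 d2) d by rewrite !lt_min d10 d20 d0.
have : t < Num.min (Num.min d1 d2) d by rewrite /t; lra.
have t0 : 0 < t by rewrite divr_gt0.
rewrite !lt_min => /andP[/andP[td1 td2] td].
pose w := mkC t 0 + a.
have tn : cnorm (w - a) = t by rewrite /w addrK cnorm_real gtr0_norm.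
have wa : w != a by rewrite -subr_eq0 -cnorm_gt0 tn.
have h2 := H2 w; have h1 := H1 w; rewrite tn in h1 h2.
have {}h2 := h2 td2; have {}h1 := h1 td1.
have fg : f w = g w by apply: Hd => //; rewrite tn.
rewrite fg cnormB in h1.
apply: le_trans (ler_cdistD (g w) _ _) _; rewrite [leRHS]splitr.
by apply: lerD; exact: ltW.
Qed.

Lemma ccont_dquot f w0 l : cder f w0 l -> ccont (dquot f w0 l) w0.
Proof.
move=> fl e e0; have [d d0 Hd] := fl (e / 2) (divr_gt0 e0 (ltr0Sn _ 1)).
exists d => // w /Hd; rewrite /dquot eqxx; case: eqVneq => [->|ww0] h.
  by rewrite subrr cnorm0.
have nz : w - w0 != 0 by rewrite subr_eq0.
rewrite (_ : _ - l = (f w - f w0 - l * (w - w0)) / (w - w0)); last by field.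
rewrite cnormM cnormV ltr_pdivrMr ?cnorm_gt0//; apply: le_lt_trans h _.
rewrite ltr_pM2r ?cnorm_gt0//; lra.
Qed.

Lemma cder_dquot f w0 l w : w != w0 -> (exists m, cder f w m) ->
  exists m, cder (dquot f w0 l) w m.
Proof.
move=> ww0 [m fm]; have w0' : w - w0 != 0 by rewrite subr_eq0.
have hv := @cderV _ (fun v => v - w0) w _ w0' (cderB (cder_id w) (cder_cst w0 w)).
have h := cderM (cderB fm (cder_cst (f w0) w)) hv.
eexists; apply: cder_near h; exists (cnorm (w - w0)); first by rewrite cnorm_gt0.
move=> v vw; rewrite /dquot; case: eqVneq => // vw0.
by move: vw; rewrite vw0 cnormB ltxx.
Qed.

Lemma ccont_dquot_all f w0 l w : cder f w0 l -> (exists m, cder f w m) ->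
  ccont (dquot f w0 l) w.
Proof.
move=> fl fw; have [->|ww0] := eqVneq w w0; first exact: ccont_dquot.
by have [m /cder_cont] := cder_dquot l ww0 fw.
Qed.

(** Here the circles grow, along lines going down, and the integrand decays on them. *)
Lemma circle_kernel_eq0 rho w0 : 0 < rho -> cnorm w0 < rho ->
  line_int (fun z => (disc_e rho z - w0)^-1) 0 = 0.
Proof.
move=> r0 wr; set K := fun z => _.
have big x y : y <= 0 -> rho * expR (2 * pi * - y) - cnorm w0 <= cnorm (disc_e rho (mkC x y) - w0).
  move=> y0; apply: le_trans (ler_cnorm_sub _ _).
  by rewrite cnorm_disc_e ?(ltW r0)// mulrN lexx.
have big1 y : y <= 0 -> rho <= rho * expR (2 * pi * - y).
  move=> y0; rewrite ler_pMr// -expR0 ler_expR mulr_ge0// ?oppr_ge0// mulr_ge0//; exact: pi_ge0.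
have nz x y : y <= 0 -> disc_e rho (mkC x y) - w0 != 0.
  move=> y0; rewrite -cnorm_gt0; apply: lt_le_trans (big x y y0).
  rewrite subr_gt0; apply: lt_le_trans wr (big1 _ y0).
have dK x y : y <= 0 -> exists l, cder K (mkC x y) l.
  move=> y0; have [m hm] := cder_disc_e rho (mkC x y); eexists.
  exact: (@cderV _ (fun v => disc_e rho v - w0) _ _ (nz x y y0) (cderB hm (cder_cst w0 _))).
have pK : periodic1 K by move=> z; rewrite /K disc_e_per.
apply/eqP; rewrite -cnorm_eq0 eq_le cnorm_ge0 andbT.
apply/ler_addgt0Pr => e e0; rewrite add0r.
have [Y [_ Y0] HY] := expR_small 0 (@ltr01 R) (divr_gt0 r0 (ltr_wpDl (cnorm_ge0 w0) (divr_gt0 (ltr0Sn R 1) e0))).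
have -> : line_int K 0 = line_int K (- Y).
  apply/esym/line_int_strip => //; first by rewrite oppr_le0 ltW.
  by move=> x y /andP[_ /dK].
have YN : - Y <= 0 by rewrite oppr_le0 ltW.
apply: le_trans (@line_int_bound _ _ _ (e / 2) _ _) _; last by rewrite mulrC divfK.
  by move=> x; have [l /cder_cont] := dK x _ YN.
move=> x _; rewrite /K cnormV.
have h := big x _ YN; rewrite opprK in h.
move: HY; rewrite mul1r expRN => HY.
have E0 := expR_gt0 (2 * pi * Y); set E := expR _ in HY h E0.
have den : 0 < cnorm w0 + 2 / e by rewrite ltr_wpDl ?cnorm_ge0// divr_gt0.
have {}HY : cnorm w0 + 2 / e < rho * E.
  by move: HY; rewrite -[E^-1]div1r ltr_pdivrMr// mulrAC ltr_pdivlMr// mul1r.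
have h2 : 2 / e <= cnorm (disc_e rho (mkC x (- Y)) - w0) by lra.
rewrite -[leRHS]invf_div lef_pV2// posrE; first by rewrite cnorm_gt0 nz.
by rewrite divr_gt0.
Qed.

(** Riemann's theorem on removable singularities, for a difference quotient. By Cauchy's
    formula the quotient is the integral of [f (u) / (u - w)] over a circle, which has an
    expansion to second order in [w]. *)
Lemma cder_dquot0 f r (l : CC R) : 0 < r -> (forall w, cnorm w < r -> exists m, cder f w m) ->
  f 0 = 0 -> cder f 0 l -> exists m, cder (dquot f 0 l) 0 m.
Proof.
move=> r0 df f0 fl; pose rho := r / 2.
have rho0 : 0 < rho by rewrite divr_gt0.
have rr : rho < r by rewrite /rho; lra.
pose phi := disc_e rho.
have phin x : cnorm (phi (mkC x 0)) = rho by rewrite cnorm_disc_e ?ltW// mulr0 oppr0 expR0 mulr1.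
have phi0 z : phi z != 0 by exact: disc_e_neq0.
have cphi z : ccont phi z by exact: ccont_disc_e.
have cf : cont_line (f \o phi) 0.
  move=> x; apply: ccont_comp => //; have [|m /cder_cont//] := df (phi (mkC x 0)).
  by rewrite phin.
have [M M0 HM] := line_bounded cf.
have nz w x : cnorm w < rho -> phi (mkC x 0) - w != 0.
  move=> wr; rewrite -cnorm_gt0; apply: lt_le_trans (ler_cnorm_sub _ _).
  by rewrite phin subr_gt0.
pose K w z : CC R := (phi z - w)^-1.
have cK w : cnorm w < rho -> cont_line (K w) 0.
  move=> wr x; apply: ccontV; first exact: nz.
  by apply: ccontB => //; exact: ccont_cst.
have cV : cont_line (fun z => (phi z)^-1) 0 by move=> x; apply: ccontV.
have int0 : line_int (f \o phi) 0 = 0.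
  rewrite -(@circle_int_eq0 (dquot f 0 l) r rho 0) ?cnorm0//.
  - apply: eq_line_int => x /=; rewrite /dquot (negPf (phi0 _)) f0 !subr0 divfK//.
  - by move=> w wr; apply: ccont_dquot_all => //; exact: df.
  - by move=> w wr w0; apply: cder_dquot => //; exact: df.
(* Cauchy's formula, by integrating the difference quotient at [w] over the circle. *)
have form w : cnorm w < rho -> w != 0 ->
    dquot f 0 l w = line_int (fun z => f (phi z) * K w z) 0.
  move=> wr w0; have [m fm] := df w (lt_trans wr rr).
  have C : line_int (fun z => dquot f w m (phi z) * phi z) 0 = 0.
    apply: (@circle_int_eq0 _ r rho w) => //.
      by move=> v vr; apply: ccont_dquot_all => //; exact: df.
    by move=> v vr vw; apply: cder_dquot => //; exact: df.
  have cfK : cont_line (fun z => f (phi z) * K w z) 0.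
    by move=> x; apply: ccontM; [exact: cf|exact: cK].
  have cc : cont_line (fun=> f w) 0 by move=> x; exact: ccont_cst.
  have cwK : cont_line (fun z => f w * w * K w z) 0.
    by move=> x; apply: ccontM; [exact: ccont_cst|exact: cK].
  have cwfK : cont_line (fun z => w * (f (phi z) * K w z)) 0.
    by move=> x; apply: ccontM; [exact: ccont_cst|exact: cfK].
  have E : line_int (fun z => dquot f w m (phi z) * phi z) 0 =
      line_int (fun z => ((f \o phi) z - f w) + (w * (f (phi z) * K w z) - f w * w * K w z)) 0.
    apply: eq_line_int => x; have nzx := nz w x wr.
    rewrite /dquot /K /=; case: eqVneq => [e|_]; first by move: nzx; rewrite e subrr eqxx.
    by field.
  rewrite E line_intD in C; last 2 first.
  - by move=> x; apply: ccontB; [exact: cf|exact: ccont_cst].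
  - by move=> x; apply: ccontB; [exact: cwfK|exact: cwK].
  rewrite !line_intB// int0 line_int_cst !line_intZ// in C; last exact: cK.
  rewrite circle_kernel_eq0// mulr0 subr0 sub0r in C.
  rewrite /dquot (negPf w0) f0 !subr0.
  move/eqP: C; rewrite addrC subr_eq0 => /eqP <-; by rewrite mulrC mulKf.
(* [1 / (u - w) = 1 / u + w / u ^ 2 + w ^ 2 / (u ^ 2 * (u - w))]. *)
pose A := line_int (fun z => f (phi z) * (phi z)^-1) 0.
pose B := line_int (fun z => f (phi z) * ((phi z)^-1 * (phi z)^-1)) 0.
pose D w := line_int (fun z => f (phi z) * ((phi z)^-1 * (phi z)^-1) * K w z) 0.
have cA : cont_line (fun z => f (phi z) * (phi z)^-1) 0.
  by move=> x; apply: ccontM; [exact: cf|exact: cV].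
have cB : cont_line (fun z => f (phi z) * ((phi z)^-1 * (phi z)^-1)) 0.
  by move=> x; apply: ccontM; [exact: cf|apply: ccontM; exact: cV].
have cD w : cnorm w < rho -> cont_line (fun z => f (phi z) * ((phi z)^-1 * (phi z)^-1) * K w z) 0.
  by move=> wr x; apply: ccontM; [exact: cB|exact: cK].
have expansion w : cnorm w < rho -> w != 0 -> dquot f 0 l w = A + B * w + w ^+ 2 * D w.
  move=> wr w0; rewrite form// /A /B /D mulrC -!line_intZ//; last exact: cD.
  rewrite -!line_intD//.
  - by apply: eq_line_int => x; rewrite /K; field; rewrite nz//=.
  - move=> x; apply: ccontD; first exact: cA.
    by apply: ccontM; [exact: ccont_cst | exact: cB].
  - by move=> x; apply: ccontM; [exact: ccont_cst | exact: cD].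
  - by move=> x; apply: ccontM; [exact: ccont_cst | exact: cB].
pose N := 2 * (M / rho ^+ 2 * (2 / rho)).
have N0 : 0 < N by rewrite /N mulr_gt0// mulr_gt0 ?divr_gt0// exprn_gt0.
have Dbound w : cnorm w < rho / 2 -> cnorm (D w) <= N.
  move=> wr; have wr' : cnorm w < rho by lra.
  apply: line_int_bound; first exact: cD.
  move=> x xP; rewrite !cnormM !cnormV phin.
  have rV : 0 <= rho^-1 by rewrite invr_ge0 ltW.
  apply: ler_pM.
  - by apply: mulr_ge0; [exact: cnorm_ge0 | exact: mulr_ge0].
  - by rewrite invr_ge0 cnorm_ge0.
  - have -> : M / rho ^+ 2 = M * (rho^-1 * rho^-1) by field; rewrite gt_eqF.
    by apply: ler_wpM2r; [exact: mulr_ge0 | exact: HM].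
  rewrite -[leRHS]invf_div lef_pV2 ?posrE ?divr_gt0 ?cnorm_gt0 ?nz//.
  apply: le_trans (ler_cnorm_sub _ _); rewrite phin; lra.
pose p w := A + B * w + w ^+ 2 * D w.
have dp : cder p 0 B.
  move=> e e0; exists (Num.min (rho / 2) (e / N)); first by rewrite lt_min !divr_gt0.
  move=> w; rewrite subr0 lt_min => /andP[wr we].
  rewrite /p mulr0 addr0 expr0n/= mul0r addr0 (_ : _ - _ - _ = w ^+ 2 * D w); last by ring.
  rewrite cnormM cnormX expr2 -mulrA mulrC ler_wpM2r ?cnorm_ge0//.
  move: we; rewrite ltr_pdivlMr// => /ltW; apply: le_trans.
  by rewrite ler_wpM2l ?cnorm_ge0// Dbound.
have Al : p 0 = l.
  have -> : l = dquot f 0 l 0 by rewrite /dquot eqxx.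
  apply: (ccont_punctured (cder_cont dp) (ccont_dquot fl)).
  by apply/nbhs_cnorm; exists rho => // w; rewrite subr0 => wr w0; rewrite expansion.
exists B; apply: cder_near dp; exists rho => // w; rewrite subr0 => wr.
have [->|w0] := eqVneq w 0; first by rewrite Al /dquot eqxx.
by rewrite expansion.
Qed.

(** The quotient is the difference quotient at [a], which is differentiable at [a] by
    Riemann's theorem. *)
Lemma holo_div f a r : 0 < r -> (forall w, cnorm (w - a) < r -> exists m, cder f w m) ->
  f a = 0 -> exists2 g : CC R -> CC R,
    (forall w, cnorm (w - a) < r -> exists m, cder g w m) &
    cder f a (g a) /\ forall w, f w = (w - a) * g w.
Proof.
move=> r0 df fa; have [l fl] : exists l, cder f a l by apply: df; rewrite subrr cnorm0.
have sh c w : cder (fun v => v + c) w 1.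
  by rewrite -[X in cder _ _ X]addr0; exact: cderD (cder_id _) (cder_cst _ _).
exists (dquot f a l); last first.
  split; first by rewrite /dquot eqxx.
  move=> w; rewrite /dquot; case: eqVneq => [->|wa]; first by rewrite subrr mul0r.
  by rewrite fa subr0 mulrC divfK// subr_eq0.
move=> w wr; have [->|wa] := eqVneq w a; last by apply: cder_dquot => //; exact: df.
pose f' v := f (v + a).
have df' v m : cder f (v + a) m -> cder f' v m.
  by move=> h; have := cder_comp (sh a v) h; rewrite mulr1.
have [] := @cder_dquot0 f' r l r0.
- move=> v vr; have [|m /df' hm] := df (v + a); first by rewrite addrK.
  by exists m.
- by rewrite /f' add0r.
- by apply: df'; rewrite add0r.
move=> m hm; have {hm} hm : cder (dquot f' 0 l) (a - a) m by rewrite subrr.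
exists (m * 1); apply: cder_near (cder_comp (sh (- a) a) hm); exists 1 => // v _.
by rewrite /= /dquot /f' subr_eq0 add0r subr0 subrK.
Qed.

End Removable.

(** * Orders of zeros and poles *)

Section Orders.
Context {R : realType}.
Implicit Types (f g U : CC R -> CC R) (w z a : CC R) (m n : int).

Definition analytic f a : Prop := \forall w \near a, exists l, cder f w l.

Lemma analytic_cder f a : analytic f a -> exists l, cder f a l.
Proof. exact: nbhs_singleton. Qed.

Lemma analytic_cont f a : analytic f a -> ccont f a.
Proof. by move=> /analytic_cder[l /cder_cont]. Qed.

Lemma ccont_near_neq0 f a : ccont f a -> f a != 0 -> \forall w \near a, f w != 0.
Proof.
move=> cf; rewrite -cnorm_gt0 => f0; have [d d0 Hd] := cf _ f0.
apply/nbhs_cnorm; exists d => // w /Hd h; rewrite -cnorm_gt0.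
by have := ler_cnorm_sub (f a) (f w); rewrite cnormB; lra.
Qed.

Lemma eq_near_cder f g a l : (\forall w \near a, f w = g w) -> cder f a l -> cder g a l.
Proof. by move=> /nbhs_cnorm; exact: cder_near. Qed.

Lemma near_all a (P : CC R -> Prop) : (forall w, P w) -> \forall w \near a, P w.
Proof. by move=> H; apply/nbhs_cnorm; exists 1. Qed.

Lemma near_near a (P : set (CC R)) : nbhs a P -> \forall w \near a, nbhs w P.
Proof.
move=> /nbhs_cnorm[d d0 H]; apply/nbhs_cnorm; exists d => // w wd.
apply/nbhs_cnorm; exists (d - cnorm (w - a)) => [|v vw]; first by rewrite subr_gt0.
by apply: H; apply: le_lt_trans (ler_cdistD w _ _) _; lra.
Qed.

Lemma near_neq a b : b != a -> \forall w \near a, w != b.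
Proof.
move=> ba; apply/nbhs_cnorm; exists (cnorm (b - a)); first by rewrite cnorm_gt0 subr_eq0.
by move=> w; case: eqVneq => // ->; rewrite ltxx.
Qed.

Lemma analytic_cst (c : CC R) a : analytic (fun=> c) a.
Proof. by apply: near_all => w; exists 0; exact: cder_cst. Qed.

Lemma analyticM f g a : analytic f a -> analytic g a -> analytic (fun w => f w * g w) a.
Proof.
apply: filterS2 => w [l fl] [m gm]; eexists; exact: cderM fl gm.
Qed.

Lemma analyticB f g a : analytic f a -> analytic g a -> analytic (fun w => f w - g w) a.
Proof.
apply: filterS2 => w [l fl] [m gm]; eexists; exact: cderB fl gm.
Qed.

Lemma analyticV f a : f a != 0 -> analytic f a -> analytic (fun w => (f w)^-1) a.
Proof.
move=> f0 af; have := ccont_near_neq0 (analytic_cont af) f0.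
move: af; apply: filterS2 => w [l fl] fw; eexists; exact: cderV fw fl.
Qed.

Lemma eq_near_analytic f g a : (\forall w \near a, f w = g w) -> analytic f a -> analytic g a.
Proof.
move=> /near_near; apply: filterS2 => w fg [l fl]; exists l; exact: eq_near_cder fg fl.
Qed.

Lemma analyticXn f a (n : nat) : analytic f a -> analytic (fun w => f w ^+ n) a.
Proof.
move=> af; elim: n => [|n IH]; first by apply: analytic_cst.
by have := analyticM af IH; apply: eq_near_analytic; apply: near_all => w; rewrite exprS.
Qed.

Lemma analyticXz f a n : f a != 0 -> analytic f a -> analytic (fun w => f w ^ n) a.
Proof.
move=> f0 af; case: n => n; first exact: analyticXn.
have := analyticV _ (analyticXn n.+1 af); apply.
exact: expf_neq0.
Qed.

(** Vanishing to order at least [n], or a pole of order at most [- n]; the value of [f] at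
    [a] is irrelevant. *)
Definition ord_ge f a n : Prop := exists2 U, analytic U a &
  \forall w \near a, w != a -> f w = (w - a) ^ n * U w.

Definition ord_eq f a n : Prop := exists2 U, analytic U a /\ U a != 0 &
  \forall w \near a, w != a -> f w = (w - a) ^ n * U w.

Lemma ord_eq_ge f a n : ord_eq f a n -> ord_ge f a n.
Proof. by case=> U [aU _] H; exists U. Qed.

Lemma eq_ord_ge f g a n : (\forall w \near a, w != a -> f w = g w) -> ord_ge f a n -> ord_ge g a n.
Proof.
move=> fg [U aU H]; exists U => //; move: fg H; apply: filterS2 => w fg H wa.
by rewrite -fg// H.
Qed.

Lemma eq_ord_eq f g a n : (\forall w \near a, w != a -> f w = g w) -> ord_eq f a n -> ord_eq g a n.
Proof.
move=> fg [U aU H]; exists U => //; move: fg H; apply: filterS2 => w fg H wa.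
by rewrite -fg// H.
Qed.

Lemma ord_geM f g a m n : ord_ge f a m -> ord_ge g a n -> ord_ge (fun w => f w * g w) a (m + n).
Proof.
move=> [U aU HU] [V aV HV]; exists (fun w => U w * V w); first exact: analyticM.
move: HU HV; apply: filterS2 => w HU HV wa; rewrite HU// HV//.
by rewrite expfzDr ?subr_eq0//; ring.
Qed.

Lemma ord_eqM f g a m n : ord_eq f a m -> ord_eq g a n -> ord_eq (fun w => f w * g w) a (m + n).
Proof.
move=> [U [aU U0] HU] [V [aV V0] HV]; exists (fun w => U w * V w).
  by split; [exact: analyticM | rewrite mulf_neq0].
move: HU HV; apply: filterS2 => w HU HV wa; rewrite HU// HV//.
by rewrite expfzDr ?subr_eq0//; ring.
Qed.

Lemma ord_eqXz f a m n : ord_eq f a m -> ord_eq (fun w => f w ^ n) a (m * n).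
Proof.
move=> [U [aU U0] HU]; exists (fun w => U w ^ n).
  by split; [exact: analyticXz | exact: expfz_neq0].
by move: HU; apply: filterS => w HU wa; rewrite HU// expfzMl exprz_exp.
Qed.

Lemma ord_eqV f a m : ord_eq f a m -> ord_eq (fun w => (f w)^-1) a (- m).
Proof.
move=> /(ord_eqXz (-1)); rewrite mulrN1; apply: eq_ord_eq.
by apply: near_all => w _; rewrite exprN1.
Qed.

Lemma ord_eq_cst (c : CC R) a : c != 0 -> ord_eq (fun=> c) a 0.
Proof.
move=> c0; exists (fun=> c); first by split => //; exact: analytic_cst.
by apply: near_all => w _; rewrite expr0z mul1r.
Qed.

Lemma ord_eq_prod (I : eqType) (s : seq I) (F : I -> CC R -> CC R) (n : I -> int) a :
  (forall i, i \in s -> ord_eq (F i) a (n i)) ->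
  ord_eq (fun w => \prod_(i <- s) F i w) a (\sum_(i <- s) n i).
Proof.
elim: s => [|i s IH] H.
  have := ord_eq_cst a (oner_neq0 (CC R)); rewrite big_nil; apply: eq_ord_eq.
  by apply: near_all => w _; rewrite big_nil.
have := ord_eqM (H i (mem_head _ _)) (IH (fun j js => H j (mem_behead (s := i :: s) js))).
by rewrite big_cons; apply: eq_ord_eq; apply: near_all => w _; rewrite big_cons.
Qed.

Lemma ord_eq_neq0 f a : analytic f a -> f a != 0 -> ord_eq f a 0.
Proof.
by move=> af f0; exists f => //; apply: near_all => w _; rewrite expr0z mul1r.
Qed.

Lemma analytic_div f a : analytic f a -> f a = 0 ->
  exists2 g, analytic g a & cder f a (g a) /\ forall w, f w = (w - a) * g w.
Proof.
move=> /nbhs_cnorm[d d0 df] fa; have [g dg [fg gE]] := holo_div d0 df fa.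
by exists g => //; apply/nbhs_cnorm; exists d.
Qed.

Lemma analytic_ord_ge0 f a : analytic f a -> ord_ge f a 0.
Proof. by move=> af; exists f => //; apply: near_all => w _; rewrite expr0z mul1r. Qed.

Lemma ord_eq1 f a l : analytic f a -> f a = 0 -> cder f a l -> l != 0 -> ord_eq f a 1.
Proof.
move=> af fa fl l0; have [g ag [fg gE]] := analytic_div af fa.
exists g; first by split => //; rewrite -(cder_unique fl fg).
by apply: near_all => w _; rewrite expr1z gE.
Qed.

Lemma ord_ge1 f a : analytic f a -> f a = 0 -> ord_ge f a 1.
Proof.
move=> af fa; have [g ag [fg gE]] := analytic_div af fa.
by exists g => //; apply: near_all => w _; rewrite expr1z gE.
Qed.

(** Removable singularities are all filled in at once, by one function that inherits the
    periods of [f]. *)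
Definition holofill f a : CC R :=
  xget 0 [set c | exists g, [/\ ccont g a, g a = c & \forall w \near a, w != a -> f w = g w]].

Lemma holofillE f g a : ccont g a -> (\forall w \near a, w != a -> f w = g w) -> holofill f a = g a.
Proof.
move=> cg fg; rewrite /holofill; apply: xget_unique; first by exists g.
move=> _ [h [ch <- fh]]; apply: ccont_punctured => //.
by move: fg fh; apply: filterS2 => w fg fh wa; rewrite -fg// fh.
Qed.

Lemma holofill_id f a : ccont f a -> holofill f a = f a.
Proof. by move=> cf; apply: holofillE => //; apply: near_all. Qed.

Lemma near_punctured a (P : set (CC R)) : (\forall w \near a, w != a -> P w) ->
  \forall w \near a, w != a -> \forall v \near w, P v.
Proof.
move=> /near_near; apply: filterS => w Pw wa.
have := near_neq (_ : a != w); rewrite eq_sym => /(_ wa); move: Pw.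
by apply: filterS2 => v Pv va; exact: Pv.
Qed.

Lemma holofill_near f U a : analytic U a -> (\forall w \near a, w != a -> f w = U w) ->
  \forall w \near a, holofill f w = U w.
Proof.
move=> aU fU; have := near_punctured fU; move: aU.
apply: filterS2 => w [l /cder_cont cU] H.
have [wa|wa] := eqVneq w a; first by rewrite wa in cU *; exact: holofillE.
by apply: holofillE => //; move: (H wa); apply: filterS => v ->.
Qed.

Lemma ord_ge0_holofill f a : ord_ge f a 0 -> analytic (holofill f) a.
Proof.
move=> [U aU fU]; have /(holofill_near aU) : \forall w \near a, w != a -> f w = U w.
  by move: fU; apply: filterS => w H wa; rewrite H// expr0z mul1r.
move=> H; apply: eq_near_analytic aU; move: H; apply: filterS => w -> //.
Qed.

(** Near [a] but off it, [f] is continuous, so that its value is the one to fill in. *)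
Lemma near_holofill f a n : ord_ge f a n -> \forall w \near a, w != a -> holofill f w = f w.
Proof.
move=> [U aU fU]; have := near_punctured fU; move: aU fU.
apply: filterS3 => w [l /cder_cont cU] fU H wa; rewrite fU//.
have wa0 : w - a != 0 by rewrite subr_eq0.
apply: (@holofillE f (fun v => (v - a) ^ n * U v)) => //.
  apply: ccontM => //; apply: analytic_cont; apply: analyticXz => //.
  apply: analyticB; last exact: analytic_cst.
  by apply: near_all => v; exists 1; exact: cder_id.
by move: (H wa); apply: filterS => v ->.
Qed.

Lemma holofill_ord_ge f a n : ord_ge f a n -> ord_ge (holofill f) a n.
Proof.
move=> fa; apply: (eq_ord_ge _ fa); move: (near_holofill fa); apply: filterS => w H wa.
by rewrite H.
Qed.

Lemma analytic_shift f a c : analytic f (a + c) -> analytic (fun w => f (w + c)) a.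
Proof.
move=> /nbhs_cnorm[d d0 H]; apply/nbhs_cnorm; exists d => // w wd.
have [|l fl] := H (w + c); first by rewrite opprD addrACA subrr addr0.
exists (l * (1 + 0)); apply: (@cder_comp _ (fun w => w + c)) => //.
exact: cderD (cder_id _) (cder_cst _ _).
Qed.

Lemma near_shift a c (P : set (CC R)) : (\forall w \near (a + c), P w) -> \forall w \near a, P (w + c).
Proof.
move=> /nbhs_cnorm[d d0 H]; apply/nbhs_cnorm; exists d => // w wd; apply: H.
by rewrite opprD addrACA subrr addr0.
Qed.

Lemma ccont_shift f a c : ccont f (a + c) -> ccont (fun w => f (w + c)) a.
Proof.
move=> cf e /cf[d d0 H]; exists d => // w wd; apply: H.
by rewrite opprD addrACA subrr addr0.
Qed.

Lemma ord_ge_shift f a c n : ord_ge f (a + c) n -> ord_ge (fun w => f (w + c)) a n.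
Proof.
move=> [U aU fU]; exists (fun w => U (w + c)); first exact: analytic_shift.
move: (near_shift fU); apply: filterS => w H wa; rewrite H; last by rewrite (inj_eq (addIr c)).
by rewrite opprD addrACA subrr addr0.
Qed.

Lemma holofill_per f c : (forall z, f (z + c) = f z) -> forall z, holofill f (z + c) = holofill f z.
Proof.
move=> pf z; rewrite /holofill; congr xget; apply/seteqP; split => v [g [cg gv fg]].
  exists (fun w => g (w + c)); split => //; first exact: ccont_shift.
  move: (near_shift fg); apply: filterS => w H wa.
  by rewrite -pf H// (inj_eq (addIr c)).
exists (fun w => g (w - c)); split => //; first by apply: ccont_shift; rewrite addrK.
  by rewrite addrK.
have fg' : \forall w \near ((z + c) + - c), w != z -> f w = g w by rewrite addrK.
move: (near_shift fg'); apply: filterS => w H wa.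
have E := pf (w - c); rewrite subrK in E; rewrite E H// subr_eq//.
Qed.

End Orders.

(** * Cauchy's formula in a strip *)

Section StripFormula.
Context {R : realType}.
Implicit Types (k : CC R -> CC R) (z w : CC R) (x y Y : R).

Lemma analytic_e1 z : analytic (@e1 R) z.
Proof. by apply: near_all => w; eexists; exact: cder_e1. Qed.

Lemma mkC_shift x Y : mkC x Y = mkC x 0 + mkC 0 Y :> CC R.
Proof. by rewrite -[RHS]/(mkC (x + 0) (0 + Y)) addr0 add0r. Qed.

Lemma e1_imag Y : e1 (mkC 0 Y) = mkC (expR (- (2 * pi * Y))) 0 :> CC R.
Proof.
have re : cRe (twopii * mkC 0 Y) = - (2 * pi * Y) :> R by rewrite cReM /cRe/cIm/=; ring.
have im : cIm (twopii * mkC 0 Y) = 0 :> R by rewrite cImM /cRe/cIm/=; ring.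
by rewrite /e1 /cexp re im cos0 sin0 mulr1 mulr0.
Qed.

Lemma e1_mkC x Y : e1 (mkC x Y) = disc_e (expR (- (2 * pi * Y))) (mkC x 0) :> CC R.
Proof. by rewrite mkC_shift e1D e1_imag mulrC. Qed.

Lemma pi20 : 0 < 2 * pi :> R.
Proof. by rewrite mulr_gt0// pi_gt0. Qed.

Lemma e1_neq1 x Y : Y != 0 -> 1 - e1 (mkC x Y) != 0 :> CC R.
Proof.
apply: contra; rewrite subr_eq0 eq_sym => /eqP E; have := cnorm_e1 (mkC x Y).
rewrite E cnorm1 => /(congr1 (@ln R)); rewrite expRK ln1 => /eqP.
by rewrite eq_sym oppr_eq0 mulf_eq0 (gt_eqF pi20).
Qed.

Lemma cont_line_kernel Y : Y != 0 -> cont_line (fun z : CC R => (1 - e1 z)^-1) Y.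
Proof.
move=> Y0 x; apply: ccontV; first exact: e1_neq1.
by apply: ccontB (ccont_e1 _); exact: ccont_cst.
Qed.

(** With [w = e1 z] the line is a circle inside the unit disc, where
    [1 / (1 - w) = 1 + w / (1 - w)] and the last term is holomorphic. *)
Lemma kernel_top Y : 0 < Y -> line_int (fun z : CC R => (1 - e1 z)^-1) Y = 1.
Proof.
move=> Y0; set s := expR (- (2 * pi * Y)).
have s0 : 0 < s by exact: expR_gt0.
have s1 : s < 1 by rewrite -expR0 ltr_expR oppr_lt0 mulr_gt0// pi20.
have nz w : cnorm w < 1 -> 1 - w != 0 :> CC R.
  by apply: contraTneq => /eqP; rewrite subr_eq0 => /eqP <-; rewrite cnorm1 ltxx.
have dg w : cnorm w < 1 -> exists l, cder (fun w : CC R => (1 - w)^-1) w l.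
  move=> w1; eexists; apply: (@cderV _ (fun w => 1 - w)); first exact: nz.
  exact: cderB (cder_cst _ _) (cder_id _).
have C : line_int (fun z : CC R => (1 - disc_e s z)^-1 * disc_e s z) 0 = 0.
  apply: (@circle_int_eq0 _ (fun w => (1 - w)^-1) 1 s 0) => //; first by rewrite cnorm0.
    by move=> w /dg[l /cder_cont].
  by move=> w /dg.
have sz x : 1 - disc_e s (mkC x 0) != 0 :> CC R.
  by rewrite -e1_mkC e1_neq1// gt_eqF.
have -> : line_int (fun z : CC R => (1 - e1 z)^-1) Y =
    line_int (fun z => 1 + (1 - disc_e s z)^-1 * disc_e s z) 0.
  apply: eq_cint => x _; rewrite e1_mkC -/s; field; exact: sz.
rewrite line_intD ?C ?line_int_cst ?addr0//; first by move=> x; exact: ccont_cst.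
move=> x; apply: ccontM; last exact: ccont_disc_e.
apply: ccontV => //; apply: ccontB; [exact: ccont_cst | exact: ccont_disc_e].
Qed.

(** The line is now a circle around the pole of [1 / (w - 1)]. *)
Lemma kernel_bot Y : Y < 0 -> line_int (fun z : CC R => (1 - e1 z)^-1) Y = 0.
Proof.
move=> Y0; set s := expR (- (2 * pi * Y)).
have s1 : 1 < s by rewrite -expR0 ltr_expR oppr_gt0 pmulr_rlt0// pi20.
have s0 : 0 < s by exact: expR_gt0.
have C : line_int (fun z : CC R => (disc_e s z - 1)^-1) 0 = 0.
  by apply: circle_kernel_eq0 => //; rewrite cnorm1.
have sz x : 1 - disc_e s (mkC x 0) != 0 :> CC R.
  by rewrite -e1_mkC e1_neq1// lt_eqF.
rewrite -[RHS](mulr0 (-1)) -C -line_intZ.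
  apply: eq_cint => x _; rewrite e1_mkC -/s -[in RHS]opprB invrN; ring.
move=> x; apply: ccontV; first by rewrite -opprB oppr_eq0.
apply: ccontB; [exact: ccont_disc_e | exact: ccont_cst].
Qed.

Lemma periodic1_int k z (n : int) : periodic1 k -> k (z + n%:~R) = k z.
Proof.
move=> pk; have pn (m : nat) v : k (v + m%:R) = k v.
  by elim: m => [|m IH]; [rewrite addr0 | rewrite -addn1 natrD addrA pk].
case: n => n; first exact: pn.
by rewrite -[in RHS](subrK n.+1%:R z) pn NegzE rmorphN.
Qed.

(** The kernel [1 / (1 - exp (2 pi i z))] has its poles at the integers, and its integrals
    over high and low lines are one and zero. As [k] has period one, [k z - k 0] cancels all
    these poles, and the integral of the product is the same over both lines. *)
Lemma strip_formula k Y : 0 < Y -> periodic1 k ->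
  (forall z, `|cIm z| <= Y -> analytic k z) ->
  k 0 = line_int (fun z => k z * (1 - e1 z)^-1) Y - line_int (fun z => k z * (1 - e1 z)^-1) (- Y).
Proof.
move=> Y0 pk ak.
pose h z := (k z - k 0) * (1 - e1 z)^-1.
have a1e z : analytic (fun z => 1 - e1 z : CC R) z.
  by apply: analyticB; [exact: analytic_cst | exact: analytic_e1].
have oh z : `|cIm z| <= Y -> ord_ge h z 0.
  move=> zY; have akz := ak z zY.
  have akk : analytic (fun w => k w - k 0) z by apply: analyticB => //; exact: analytic_cst.
  have [ez|ez] := eqVneq (1 - e1 z) 0; last first.
    by apply: analytic_ord_ge0; apply: analyticM => //; apply: analyticV.
  have [n zn] : exists n : int, z = n%:~R.
    by apply: e1_eq1; apply/esym/eqP; rewrite -subr_eq0 ez.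
  have kz : k z - k 0 = 0 by rewrite zn -[n%:~R]add0r periodic1_int// subrr.
  have d1 : cder (fun z => 1 - e1 z : CC R) z (0 - twopii * e1 z).
    exact: cderB (cder_cst _ _) (cder_e1 _).
  have n0 : 0 - twopii * e1 z != 0 :> CC R.
    by rewrite sub0r oppr_eq0 mulf_neq0 ?e1_neq0 ?twopii_neq0.
  exact: ord_geM (ord_ge1 akk kz) (ord_eq_ge (ord_eqV (ord_eq1 (a1e z) ez d1 n0))).
have ph : periodic1 h by move=> z; rewrite /h pk e1_per.
have YY : - Y <= Y by lra.
have E : line_int (holofill h) (- Y) = line_int (holofill h) Y.
  apply: line_int_strip => //; first exact: holofill_per.
  move=> x y yP; apply: analytic_cder; apply: ord_ge0_holofill; apply: oh.
  by rewrite ler_norml.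
have ck y : `|y| <= Y -> cont_line k y by move=> yY x; apply: analytic_cont; exact: ak.
have side y : y != 0 -> `|y| <= Y -> line_int (holofill h) y =
    line_int (fun z => k z * (1 - e1 z)^-1) y - k 0 * line_int (fun z => (1 - e1 z)^-1) y.
  move=> y0 yY; have cK := cont_line_kernel y0; have cky := ck y yY.
  have c1 : cont_line (fun z => k z * (1 - e1 z)^-1) y.
    by move=> x; exact: ccontM (cky x) (cK x).
  have c2 : cont_line (fun z => k 0 * (1 - e1 z)^-1) y.
    by move=> x; exact: ccontM (ccont_cst _ _) (cK x).
  rewrite -(line_intZ (k 0) cK) -(line_intB c1 c2); apply: eq_line_int => x.
  rewrite holofill_id /h; first by rewrite mulrBl.
  by apply: ccontM (cK x); apply: ccontB (cky x) (ccont_cst _ _).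
move: E; rewrite !side ?normrN ?(gtr0_norm Y0) ?oppr_eq0 ?(gt_eqF Y0)//.
rewrite (kernel_top Y0) (@kernel_bot (- Y)) ?oppr_lt0// mulr0 mulr1 subr0 => ->.
ring.
Qed.

End StripFormula.

(** * Truncated theta products *)

Section Within.
Context {R : realType}.
Implicit Types (K x y : R).

Definition within_factor K x y : Prop := x / K <= y <= K * x.

Lemma withinM K x y K' x' y' : 1 <= K -> 1 <= K' -> 0 < x -> 0 < x' ->
  within_factor K x y -> within_factor K' x' y' -> within_factor (K * K') (x * x') (y * y').
Proof.
move=> K1 K1' x0 x0' /andP[h1 h2] /andP[h1' h2'].
have K0 : 0 < K by lra. have K0' : 0 < K' by lra.
have a0 : 0 < x / K by rewrite divr_gt0. have a0' : 0 < x' / K' by rewrite divr_gt0.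
rewrite /within_factor (_ : x * x' / (K * K') = (x / K) * (x' / K')); last first.
  by field; rewrite !gt_eqF.
rewrite (_ : K * K' * (x * x') = (K * x) * (K' * x')); last by ring.
by apply/andP; split; apply: ler_pM => //; lra.
Qed.

Lemma withinM1l K y K' x' y' : 1 <= K -> 1 <= K' -> 0 < x' ->
  within_factor K 1 y -> within_factor K' x' y' -> within_factor (K * K') x' (y * y').
Proof. by move=> K1 K1' x0 h h'; have := withinM K1 K1' ltr01 x0 h h'; rewrite mul1r. Qed.

Lemma withinM1r K x y K' y' : 1 <= K -> 1 <= K' -> 0 < x ->
  within_factor K x y -> within_factor K' 1 y' -> within_factor (K * K') x (y * y').
Proof. by move=> K1 K1' x0 h h'; have := withinM K1 K1' x0 ltr01 h h'; rewrite mulr1. Qed.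

Lemma withinX K x y (n : nat) : 1 <= K -> 0 < x -> within_factor K x y -> within_factor (K ^+ n) (x ^+ n) (y ^+ n).
Proof.
move=> K1 x0 h; elim: n => [|n IH]; first by rewrite /within_factor !expr0 invr1 mul1r lexx.
by rewrite !exprS; apply: withinM => //; rewrite ?exprn_gt0// exprn_ege1.
Qed.

Lemma withinV K x y : 1 <= K -> 0 < x -> within_factor K x y -> within_factor K x^-1 y^-1.
Proof.
move=> K1 x0 /andP[h1 h2]; have K0 : 0 < K by lra.
have xK : 0 < x / K by rewrite divr_gt0.
have y0 : 0 < y by lra.
apply/andP; split.
  by rewrite -invfM lef_pV2 ?posrE ?mulr_gt0// mulrC.
by rewrite (_ : K * x^-1 = (x / K)^-1) ?lef_pV2// invf_div.
Qed.

Lemma withinXz K x y (n : int) : 1 <= K -> 0 < x -> within_factor K x y ->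
  within_factor (K ^+ `|n|%N) (x ^ n) (y ^ n).
Proof.
move=> K1 x0 h; case: n => n; first exact: withinX.
rewrite NegzE -!exprnN /= ; apply: withinV; [exact: exprn_ege1 | exact: exprn_gt0 | exact: withinX].
Qed.

Lemma within_prod (M : nat) K (x y : nat -> R) : 1 <= K -> (forall i, 0 < x i) ->
  (forall i, (i < M)%N -> within_factor K (x i) (y i)) ->
  within_factor (K ^+ M) (\prod_(i < M) x i) (\prod_(i < M) y i).
Proof.
move=> K1 x0; elim: M => [|M IH] h.
  by rewrite !big_ord0 /within_factor expr0 invr1 mul1r lexx.
rewrite !big_ord_recr /= exprSr; apply: withinM => //.
- exact: exprn_ege1.
- by apply: prodr_gt0.
- by apply: IH => i iM; apply: h; exact: ltnW.
- exact: h.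
Qed.

(** The factors tend to zero, so the products decay faster than any geometric sequence. *)
Lemma prod_geom_small (A p e : R) : 0 <= A -> 0 <= p < 1 -> 0 < e ->
  exists2 M : nat, (0 < M)%N & \prod_(m < M) (A * p ^+ m) < e.
Proof.
move=> A0 /andP[p0 p1] e0.
have pn0 n : 0 <= A * p ^+ n by rewrite mulr_ge0// exprn_ge0.
have [N HN] : exists N, A * p ^+ N < 2^-1.
  have : (fun n => p ^+ n) @ \oo --> 0 by apply: cvg_expr; rewrite ger0_norm.
  move=> /cvgrPdist_lt/(_ (2^-1 / (A + 1))) /(_ _)[|N _ HN].
    by rewrite divr_gt0//; lra.
  exists N; have := HN N (leqnn N); rewrite /= sub0r normrN ger0_norm ?exprn_ge0//.
  rewrite ltr_pdivlMr; last by lra.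
  by apply: le_lt_trans; rewrite mulrC mulrDr mulr1 lerDl exprn_ge0.
have HNn n : (N <= n)%N -> A * p ^+ n <= 2^-1.
  move=> Nn; apply: le_trans (ltW HN); apply: ler_wpM2l => //.
  by rewrite ler_wiXn2l// ltW.
pose P := \prod_(m < N) (A * p ^+ m).
have P0 : 0 <= P by apply: prodr_ge0.
have bound k : \prod_(m < N + k) (A * p ^+ m) <= P * 2^-1 ^+ k.
  elim: k => [|k IH]; first by rewrite addn0 expr0 mulr1.
  rewrite addnS big_ord_recr /= exprSr [leRHS]mulrA; apply: ler_pM => //.
    by apply: prodr_ge0.
  by apply: HNn; rewrite leq_addr.
have P1 : 0 < P + 1 by lra.
have [k Hk] : exists k, (P + 1) * 2^-1 ^+ k < e.
  have : (fun n => 2^-1 ^+ n) @ \oo --> (0 : R).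
    by apply: cvg_expr; rewrite ger0_norm ?invr_ge0// invf_lt1// ltr1n.
  move=> /cvgrPdist_lt/(_ (e / (P + 1))) /(_ _)[|k _ Hk].
    by rewrite divr_gt0.
  exists k; have := Hk k (leqnn k); rewrite /= sub0r normrN ger0_norm ?exprn_ge0 ?invr_ge0//.
  by rewrite ltr_pdivlMr// mulrC.
exists (N + k).+1 => //; rewrite -addnS; apply: le_lt_trans (bound k.+1) _; apply: le_lt_trans Hk.
have h0 : 0 <= 2^-1 ^+ k :> R by rewrite exprn_ge0// invr_ge0.
rewrite exprS; nra.
Qed.

End Within.

Section Theta.
Context {R : realType}.
Context (tau : CC R) (tau_gt0 : 0 < cIm tau).
Implicit Types (a z w : CC R) (m M : nat).

Let t := cIm tau.
Let q := expR (2 * pi * t).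

(** The factors of a theta function with zeros at [a + Z + tau Z]: those for the zeros at or
    below [a] tend to one upwards, those for the zeros above [a] tend to one downwards. *)
Definition low_factor a m z : CC R := 1 - e1 (z - (a - m%:R * tau)).
Definition up_factor a m z : CC R := 1 - e1 ((a + m.+1%:R * tau) - z).

Lemma intC (n : int) : n%:~R = mkC n%:~R 0 :> CC R.
Proof. by rewrite -[mkC _ _]/((n%:~R)%:C%C : R[i]) rmorph_int. Qed.

Lemma cIm_intM (n : int) z : cIm (n%:~R * z) = n%:~R * cIm z.
Proof. by rewrite intC cImM /cRe /cIm /= mul0r addr0. Qed.

Lemma cIm_natM m z : cIm (m%:R * z) = m%:R * cIm z.
Proof. exact: cIm_intM m z. Qed.

Lemma cIm_int (n : int) : cIm (n%:~R : CC R) = 0.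
Proof. by rewrite intC. Qed.

Lemma q_gt1 : 1 < q.
Proof. by rewrite -expR0 ltr_expR mulr_gt0// pi20. Qed.

Lemma qX m : q ^+ m = expR (2 * pi * (m%:R * t)).
Proof. by rewrite /q -expRM_natl; congr expR; ring. Qed.

(** The norm of [e1 w] is [exp (- 2 pi Im w)]. On the three lines it is either at most
    [1 - kappa], and then [1 - e1 w] is comparable to one, or large, and then [1 - e1 w] is
    comparable to [e1 w] itself. *)
Lemma theta_factor_bounds a : - t < cIm a -> cIm a < 0 -> exists2 K : R, 1 <= K &
  forall M m z, (m < M)%N ->
  [/\ cIm z = 0 -> within_factor K 1 (cnorm (low_factor a m z)) /\ within_factor K 1 (cnorm (up_factor a m z)),
      cIm z = M%:R * t -> within_factor K 1 (cnorm (low_factor a m z)) /\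
                          within_factor K (q ^+ (M.-1 - m)) (cnorm (up_factor a m z)) &
      cIm z = - (M%:R * t) -> within_factor K (q ^+ (M.-1 - m)) (cnorm (low_factor a m z)) /\
                              within_factor K 1 (cnorm (up_factor a m z))].
Proof.
move=> ta a0; pose v := expR (- (2 * pi * cIm a)).
have v1 : 1 < v by rewrite -expR0 ltr_expR oppr_gt0 nmulr_llt0// pi20.
have vq : v < q by rewrite ltr_expR -mulrN ltr_pM2l ?pi20// ltrNl.
have q1 := q_gt1.
(* [Im a] lies strictly between two of the lines; [kappa] measures its distance to them. *)
pose kappa := Num.min (1 - v^-1) (1 - v / q).
have v0 : 0 < v by lra. have q0 : 0 < q by lra.
have k0 : 0 < kappa.
  by rewrite lt_min !subr_gt0 invf_lt1// v1 ltr_pdivrMr// mul1r.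
have k1 : kappa <= 1 by rewrite ge_min lerBlDr lerDl invr_ge0 ltW.
have kv : v^-1 <= 1 - kappa by rewrite lerBrDl -lerBrDr ge_min lexx.
have kq : v / q <= 1 - kappa by rewrite lerBrDl -lerBrDr ge_min lexx orbT.
pose K := Num.max kappa^-1 (2 * q).
have Kk : kappa^-1 <= K by rewrite le_max lexx.
have K2q : 2 * q <= K by rewrite le_max lexx orbT.
have K0 : 0 < K by lra.
have kK : K^-1 <= kappa by rewrite -[kappa]invrK lef_pV2 ?posrE ?invr_gt0.
have small w : cnorm w <= 1 - kappa -> within_factor K 1 (cnorm (1 - w)).
  move=> wk; apply/andP; split.
    have := ler_cnorm_sub 1 w; rewrite cnorm1 mul1r; lra.
  have := ler_cnormB 1 w; rewrite cnorm1 mulr1; lra.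
have big w x : 0 < x -> x <= cnorm w <= q * x -> 1 <= (1 - kappa) * cnorm w ->
    within_factor K x (cnorm (1 - w)).
  move=> x0 /andP[xw wq] wk; have w0 : 0 < cnorm w by lra.
  have kw : 0 < kappa * cnorm w by exact: mulr_gt0.
  apply/andP; split.
    have h1 := ler_cnorm_sub w 1; rewrite cnorm1 cnormB in h1.
    have : x / K <= kappa * cnorm w.
      by rewrite mulrC; apply: ler_pM => //; [rewrite invr_ge0 ltW | exact: ltW].
    lra.
  have := ler_cnormB 1 w; rewrite cnorm1.
  have : 2 * q * x <= K * x by rewrite ler_wpM2r// ltW.
  lra.
pose ex (X : R) := expR (2 * pi * X).
have exle X X' : X <= X' -> ex X <= ex X' by move=> h; rewrite ler_expR ler_pM2l ?pi20.
have exM X X' : ex X * ex X' = ex (X + X') by rewrite /ex -expRD; congr expR; ring.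
have exv : v^-1 = ex (cIm a) by rewrite /v /ex expRN invrK.
have exq : v / q = ex (- cIm a - t) by rewrite /v /ex /q -expRN -expRD; congr expR; ring.
have exn w : cnorm (e1 w) = ex (- cIm w) by rewrite cnorm_e1 /ex mulrN.
have ex1 X : 0 <= X -> 1 <= ex X by move=> X0; rewrite -expR0 ler_expR mulr_ge0// ltW// pi20.
have imlow m z : cIm (z - (a - m%:R * tau)) = cIm z - cIm a + m%:R * t.
  by rewrite !cImB cIm_natM /t; ring.
have imup m z : cIm ((a + m.+1%:R * tau) - z) = cIm a + m.+1%:R * t - cIm z.
  by rewrite !cImB cImD cIm_natM.
have mt0 m : 0 <= m%:R * t by rewrite mulr_ge0// ltW.
exists K; first by lra.
move=> M m z mM.
have MmE : (M.-1 - m)%:R = M%:R - 1 - m%:R :> R.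
  by case: M mM => // M mM /=; rewrite natrB// -natr1; ring.
have d0 : 0 <= (M.-1 - m)%:R * t by rewrite mulr_ge0// ltW.
have qE : q ^+ (M.-1 - m) = ex ((M.-1 - m)%:R * t) by rewrite qX.
have x0 : 0 < q ^+ (M.-1 - m) by rewrite exprn_gt0.
have m1E : m.+1%:R = m%:R + 1 :> R by rewrite natr1.
have M0 := mt0 M; have m0 := mt0 m.
split=> zE.
- split; apply: small; rewrite exn ?imlow ?imup zE.
    by apply: le_trans kv; rewrite exv; apply: exle; lra.
  by apply: le_trans kq; rewrite exq; apply: exle; rewrite m1E; lra.
- split.
    apply: small; rewrite exn imlow zE.
    by apply: le_trans kv; rewrite exv; apply: exle; lra.
  apply: big => //; rewrite exn imup zE.
    rewrite qE [q](_ : _ = ex t)// exM; apply/andP; split; apply: exle; rewrite MmE m1E; lra.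
  apply: (@le_trans _ _ (v^-1 * ex (- (cIm a + m.+1%:R * t - M%:R * t)))).
    by rewrite exv exM; apply: ex1; move: d0; rewrite MmE m1E; lra.
  by rewrite ler_wpM2r// /ex expR_ge0.
- split.
    apply: big => //; rewrite exn imlow zE.
      rewrite qE [q](_ : _ = ex t)// exM; apply/andP; split; apply: exle; rewrite MmE; lra.
    apply: (@le_trans _ _ (v / q * ex (- (- (M%:R * t) - cIm a + m%:R * t)))).
      by rewrite exq exM; apply: ex1; move: d0; rewrite MmE; lra.
    by rewrite ler_wpM2r// /ex expR_ge0.
  apply: small; rewrite exn imup zE.
  by apply: le_trans kq; rewrite exq; apply: exle; rewrite m1E; lra.
Qed.

Lemma cnorm_block (x y b : CC R) (k : int) :
  cnorm (x ^ k * y ^ k * b) = cnorm x ^ k * cnorm y ^ k * cnorm b.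
Proof. by rewrite 2!cnormM 2!cnormXz. Qed.

Context (n : CC R -> int).

Definition theta_block (s : seq (CC R)) m z : CC R :=
  \prod_(a <- s) (low_factor a m z ^ n a * up_factor a m z ^ n a).

(** Only the total exponent remains in the size of a product over [s]. *)
Lemma theta_block_bounds (s : seq (CC R)) : (forall a, a \in s -> - t < cIm a < 0) ->
  exists2 A : R, 1 <= A & forall M m z, (m < M)%N ->
  (cIm z = 0 -> within_factor A 1 (cnorm (theta_block s m z))) /\
  (cIm z = M%:R * t \/ cIm z = - (M%:R * t) ->
     within_factor A ((q ^+ (M.-1 - m)) ^ (\sum_(a <- s) n a)) (cnorm (theta_block s m z))).
Proof.
have q0 : 0 < q by exact: expR_gt0.
elim: s => [|a s IH] sP.
  exists 1 => // M m z mM; rewrite /theta_block !big_nil cnorm1 expr0z.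
  by rewrite /within_factor invr1 mulr1 lexx.
have [|A A1 HA] := IH; first by move=> b bs; apply: sP; rewrite inE bs orbT.
have /andP[a1 a2] := sP a (mem_head _ _).
have [K K1 HK] := theta_factor_bounds a1 a2.
have K'1 : 1 <= K ^+ `|n a|%N by exact: exprn_ege1.
have KK1 : 1 <= K ^+ `|n a|%N * K ^+ `|n a|%N by exact: mulr_ege1.
exists (K ^+ `|n a|%N * K ^+ `|n a|%N * A); first exact: mulr_ege1.
move=> M m z mM; have [HA1 HA2] := HA M m z mM; have [c1 c2 c3] := HK M m z mM.
have x0 : 0 < q ^+ (M.-1 - m) by rewrite exprn_gt0.
have one y : within_factor K 1 y -> within_factor (K ^+ `|n a|%N) 1 (y ^ n a).
  by move=> h; have := withinXz (n a) K1 ltr01 h; rewrite exp1rz.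
have -> : cnorm (theta_block (a :: s) m z) = cnorm (low_factor a m z) ^ n a *
    cnorm (up_factor a m z) ^ n a * cnorm (theta_block s m z).
  by rewrite {1}/theta_block big_cons -/(theta_block s m z) cnorm_block.
rewrite big_cons; split=> [z0|zM].
  have [l u] := c1 z0; apply: withinM1l => //; last exact: HA1.
  by apply: withinM1l => //; exact: one.
rewrite expfzDr ?gt_eqF//; apply: withinM => //; try exact: exprz_gt0; last exact: HA2.
case: zM => zM.
  have [l u] := c2 zM; apply: withinM1l => //.
  - exact: exprz_gt0.
  - exact: one.
  - exact: withinXz.
have [l u] := c3 zM; apply: withinM1r => //.
- exact: exprz_gt0.
- exact: withinXz.
- exact: one.
Qed.

End Theta.

(** * Elliptic functions with more zeros than poles *)

Section ThetaOrder.
Context {R : realType}.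
Context (tau : CC R) (tau_gt0 : 0 < cIm tau).
Context (n : CC R -> int) (s : seq (CC R)).
Implicit Types (a b c z w : CC R) (m M : nat) (j k : int).

Let t := cIm tau.

Lemma ord_eq_1Be1 c z : ord_eq (fun w => 1 - e1 (w - c)) z (e1 (z - c) == 1).
Proof.
have ae : analytic (fun w => e1 (w - c)) z by apply: analytic_shift; exact: analytic_e1.
have af : analytic (fun w => 1 - e1 (w - c)) z by apply: analyticB => //; exact: analytic_cst.
case: eqP => ez; last by apply: ord_eq_neq0 => //; rewrite subr_eq0 eq_sym; exact/eqP.
have sh : cder (fun w => w - c) z (1 - 0) by exact: cderB (cder_id _) (cder_cst _ _).
have fl : cder (fun w => 1 - e1 (w - c)) z (0 - twopii * e1 (z - c) * (1 - 0)).
  exact: cderB (cder_cst _ _) (cder_comp sh (cder_e1 _)).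
apply: (ord_eq1 af _ fl); first by rewrite ez subrr.
by rewrite sub0r subr0 ez !mulr1 oppr_eq0 twopii_neq0.
Qed.

Lemma ord_eq_1Be1' c z : ord_eq (fun w => 1 - e1 (c - w)) z (e1 (z - c) == 1).
Proof.
have au : ord_eq (fun w => - (e1 (w - c))^-1) z 0.
  apply: ord_eq_neq0; last by rewrite oppr_eq0 invr_eq0 e1_neq0.
  have -> : (fun w => - (e1 (w - c))^-1) = (fun w => 0 - (e1 (w - c))^-1).
    by apply/funext => w; rewrite sub0r.
  apply: analyticB; first exact: analytic_cst.
  apply: analyticV; first exact: e1_neq0.
  by apply: analytic_shift; exact: analytic_e1.
have := ord_eqM au (ord_eq_1Be1 c z); rewrite add0r; apply: eq_ord_eq.
apply: near_all => w _; rewrite -(opprB w c) e1N; field; exact: e1_neq0.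
Qed.

Lemma analytic_prod_neq0 (I : eqType) (r : seq I) (G : I -> CC R -> CC R) z :
  (forall i, i \in r -> analytic (G i) z /\ G i z != 0) ->
  analytic (fun w => \prod_(i <- r) G i w) z /\ \prod_(i <- r) G i z != 0.
Proof.
elim: r => [|i r IH] HG.
  split; last by rewrite big_nil oner_neq0.
  have := analytic_cst 1 z; apply: eq_near_analytic; apply: near_all => w.
  by rewrite big_nil.
have [|h1 h2] := IH; first by move=> j jr; apply: HG; rewrite inE jr orbT.
have [g1 g2] := HG i (mem_head _ _); split; last by rewrite big_cons mulf_neq0.
have := analyticM g1 h1; apply: eq_near_analytic; apply: near_all => w.
by rewrite big_cons.
Qed.

(** The zeros and poles prescribed by [n], truncated to the strip [|Im z| <= M * Im tau]. *)
Definition theta M z : CC R := \prod_(m < M) theta_block tau n s m z.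

Lemma ord_eq_theta M z : ord_eq (theta M) z
  (\sum_(m < M) \sum_(a <- s) (((e1 (z - (a - m%:R * tau)) == 1) : int) * n a +
                               ((e1 (z - (a + m.+1%:R * tau)) == 1) : int) * n a)).
Proof.
apply: ord_eq_prod => m _; apply: ord_eq_prod => a _.
by apply: ord_eqM; apply: ord_eqXz; [exact: ord_eq_1Be1 | exact: ord_eq_1Be1'].
Qed.

Context (n_per : forall z j k, n (z + j%:~R * tau + k%:~R) = n z).
Context (s_cover : forall z, n z != 0 -> exists2 a, a \in s &
  exists j k, z = a + j%:~R * tau + k%:~R).
Context (s_uniq : uniq s).
Context (s_sep : forall a b j k, a \in s -> b \in s -> a = b + j%:~R * tau + k%:~R -> a = b).
Context (s_strip : forall a, a \in s -> - t < cIm a < 0).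

Lemma cIm_lattice a j k : cIm (a + j%:~R * tau + k%:~R) = cIm a + j%:~R * t.
Proof. by rewrite !cImD cIm_int cIm_intM addr0. Qed.

Lemma tau_int_neq0 j : j%:~R * t = 0 -> j = 0.
Proof.
by move=> /eqP; rewrite mulf_eq0 (gt_eqF tau_gt0) orbF intr_eq0 => /eqP.
Qed.

(** A point of the strip in the coset of [a0] is a zero of exactly one factor, that of index
    [m0], since the translates by multiples of [tau] that occur in the product are all
    distinct. *)
Lemma theta_order M z : `|cIm z| <= M%:R * t ->
  \sum_(m < M) \sum_(a <- s) (((e1 (z - (a - m%:R * tau)) == 1) : int) * n a +
                              ((e1 (z - (a + m.+1%:R * tau)) == 1) : int) * n a) = n z.
Proof.
move=> zM.
have lowE a m : a - m%:R * tau = a + (- (m : int))%:~R * tau by rewrite rmorphN /= mulNr.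
have upE a m : a + m.+1%:R * tau = a + (m.+1 : int)%:~R * tau by [].
have [nz0|nz0] := eqVneq (n z) 0.
  rewrite nz0 big1// => m _; rewrite big1// => a _.
  have na j : ((e1 (z - (a + j%:~R * tau)) == 1) : int) * n a = 0.
    case: eqP => [/e1_eq1[k zk]|_]; last by rewrite mul0r.
    by rewrite -(n_per a j k) -zk addrC subrK nz0 mulr0.
  by rewrite lowE upE !na.
have [a0 a0s [j0 [k0 zE]]] := s_cover nz0.
have nza : n z = n a0 by rewrite zE n_per.
have delta a j : a \in s -> (e1 (z - (a + j%:~R * tau)) == 1) = (a == a0) && (j == j0).
  move=> as_; apply/eqP/andP => [/e1_eq1[k zk]|[/eqP-> /eqP->]]; last first.
    rewrite zE addrAC subrr add0r -[k0%:~R]add0r periodic1_int ?e1_0//.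
    exact: e1_per.
  have zE' : z = a + j%:~R * tau + k%:~R by rewrite -zk addrC subrK.
  have aE : a = a0 + (j0 - j)%:~R * tau + (k0 - k)%:~R.
    move: zE'; rewrite zE !rmorphB /= => h.
    have -> : a = (a + j%:~R * tau + k%:~R) - j%:~R * tau - k%:~R by ring.
    by rewrite -h; ring.
  have aa := s_sep as_ a0s aE; split; first exact/eqP.
  move: aE; rewrite aa => /(congr1 (@cIm R)); rewrite cIm_lattice => /eqP.
  rewrite -subr_eq0 opprD addrA subrr sub0r oppr_eq0 => /eqP/tau_int_neq0/eqP.
  by rewrite subr_eq0 eq_sym.
have /andP[a01 a02] := s_strip a0s.
have imz : cIm z = cIm a0 + j0%:~R * t by rewrite zE cIm_lattice.
(* [m0] is [- j0] if [j0 <= 0], and [j0 - 1] otherwise. *)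
have [m0 m0M hm0] : exists2 m0, (m0 < M)%N &
    forall m, ((- (m : int) == j0) : int) + ((m.+1 : int) == j0) = (m == m0) :> int.
  move: zM; rewrite imz ler_norml => /andP[h1 h2].
  case: j0 {zE delta imz} h1 h2 => [[|j]|j] h1 h2.
  - exists 0%N; last by case.
    by rewrite lt0n; apply/eqP => M0; move: h1; rewrite M0 !mul0r; lra.
  - exists j; last by move=> m; case: m.
    have : j%:R * t < M%:R * t by move: h2; rewrite -[(Posz j.+1)%:~R]/(j.+1%:R) -natr1 mulrDl; lra.
    by rewrite ltr_pM2r// ltr_nat.
  exists j.+1; last first.
    move=> m; rewrite NegzE eqr_opp eqz_nat.
    by have -> : (Posz m.+1 == - Posz j.+1) = false by []; rewrite addr0.
  have : j.+1%:R * t < M%:R * t by move: h1; rewrite NegzE rmorphN /= -[(Posz j.+1)%:~R]/(j.+1%:R) mulNr; lra.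
  by rewrite ltr_pM2r// ltr_nat.
rewrite nza (bigD1 (Ordinal m0M))//= [X in _ + X]big1 ?addr0.
  rewrite (bigD1_seq a0)//= [X in _ + X]big_seq_cond [X in _ + X]big1 ?addr0.
    by rewrite -mulrDl lowE upE !delta// eqxx /= hm0 eqxx mul1r.
  move=> a /andP[as_ /negPf aa0].
  by rewrite lowE upE !delta// aa0 /= !mul0r.
move=> m mm0; rewrite big_seq big1// => a as_.
rewrite -mulrDl lowE upE !delta//; case: eqVneq => [_|_] /=; last by rewrite mul0r.
by rewrite hm0 (negPf (_ : (m : nat) != m0)) ?mul0r.
Qed.

(** The representatives lie strictly between two consecutive such lines. *)
Lemma lattice_line l a j k z : a \in s -> cIm z = l%:~R * t -> z <> a + j%:~R * tau + k%:~R.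
Proof.
move=> /s_strip/andP[a1 a2] zl zE; move: zl; rewrite zE cIm_lattice => h.
have : cIm a = (l - j)%:~R * t by rewrite rmorphB /= mulrBl; lra.
move=> ca; move: a1 a2; rewrite ca -mulN1r ltr_pM2r// pmulr_llt0//.
by rewrite -[-1]/((-1)%:~R) ltr_int ltrz0; lia.
Qed.

Lemma n_line l z : cIm z = l%:~R * t -> n z = 0.
Proof.
move=> zl; apply/eqP/negP => /negP/s_cover[a as_ [j [k]]].
exact: lattice_line as_ zl.
Qed.

Lemma theta_analytic l M z : cIm z = l%:~R * t -> analytic (theta M) z /\ theta M z != 0.
Proof.
move=> zl.
have fac a m : a \in s -> low_factor tau a m z != 0 /\ up_factor tau a m z != 0.
  move=> as_; split; rewrite subr_eq0 eq_sym; apply/eqP => /e1_eq1[k].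
    move=> /eqP; rewrite subr_eq => /eqP zE.
    apply: (@lattice_line l a (- (m : int)) k z as_ zl).
    by rewrite zE rmorphN /= mulNr addrC.
  move=> /eqP; rewrite subr_eq addrC => /eqP zE.
  apply: (@lattice_line l a m.+1 (- k) z as_ zl).
  have -> : z = m.+1%:R * tau + a - k%:~R by rewrite zE [k%:~R + z]addrC addrK.
  by rewrite rmorphN /= [m.+1%:R * tau + a]addrC.
apply: analytic_prod_neq0 => m _; apply: analytic_prod_neq0 => a as_; have [l0 u0] := fac a m as_.
have al : analytic (low_factor tau a m) z.
  apply: analyticB; first exact: analytic_cst.
  by apply: analytic_shift; exact: analytic_e1.
have au : analytic (up_factor tau a m) z.
  have := @analyticV _ (fun w => e1 (w - (a + m.+1%:R * tau))) z (e1_neq0 _) (analytic_shift (analytic_e1 _)).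
  move=> /(analyticB (analytic_cst 1 z)); apply: eq_near_analytic; apply: near_all => w.
  by rewrite -e1N opprB.
split; last by rewrite mulf_neq0// expfz_neq0.
by apply: analyticM; apply: analyticXz.
Qed.

Context (F : CC R -> CC R).
Context (F_ord : forall z, ord_ge F z (n z)) (F_reg : forall z, n z = 0 -> analytic F z).
Context (F_per1 : periodic1 F) (F_per : forall z, F (z + tau) = F z).
Context (n_pos : 0 < \sum_(a <- s) n a).

Lemma F_perz j z : F (z + j%:~R * tau) = F z.
Proof.
have pn m v : F (v + m%:R * tau) = F v.
  by elim: m => [|m IH]; [rewrite mul0r addr0 | rewrite -natr1 mulrDl mul1r addrA F_per].
case: j => m; first exact: pn.
by rewrite -[in RHS](subrK (m.+1%:R * tau) z) pn NegzE rmorphN /= mulNr.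
Qed.

Lemma F_line_bounded : exists2 B : R, 0 < B &
  forall l z, cIm z = l%:~R * t -> cnorm (F z) <= B.
Proof.
have [|B B0 HB] := @line_bounded _ F 0.
  by move=> x; apply: analytic_cont; apply: F_reg; apply: (@n_line 0); rewrite mul0r.
exists B => // l z zl.
rewrite -(subrK (l%:~R * tau) z) F_perz; set w := z - _.
have w0 : cIm w = 0 by rewrite /w cImB cIm_intM zl subrr.
have -> : w = mkC (cRe w - (Num.floor (cRe w))%:~R) 0 + (Num.floor (cRe w))%:~R.
  by rewrite intC {1}(mkCE w) w0 -[RHS]/(mkC _ _) addr0 subrK.
rewrite periodic1_int//; apply: HB.
by have /andP[h1 h2] := floor_itv (cRe w); move: h2; rewrite intrD; lra.
Qed.

(** [F / theta M] is holomorphic in the strip [|Im z| <= M * Im tau] and has period one.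
    By Cauchy's formula in the strip, its value at the origin is bounded by its values on the
    two boundary lines. There [F] is bounded, by periodicity, and [theta M] has the size of
    the product of the [q ^ (d * m)] for [m < M], where [q > 1] and [d > 0] is the sum of the
    [n a], up to a factor [A ^ M]; at the origin [theta M] is at most [A ^ M]. Thus [F 0] is
    at most [C * A ^ (2 * M) / q ^ (d * M * (M - 1) / 2)], which tends to zero. *)
Lemma elliptic_core : F 0 = 0.
Proof.
have t0 : 0 < t := tau_gt0.
have z0E : cIm (0 : CC R) = 0%:~R * t by rewrite mul0r.
have [B B0 HB] := F_line_bounded.
have [A A1 HA] := theta_block_bounds tau_gt0 n s_strip.
have A0 : 0 < A by lra.
pose q := expR (2 * pi * t); have q1 : 1 < q := q_gt1 tau_gt0.
have q0 : 0 < q by lra.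
have [d' dE] : exists d' : nat, \sum_(a <- s) n a = d'.+1.
  by move: n_pos; case: (\sum_(a <- s) n a) => // [[|d']] // _; exists d'.
pose d := \sum_(a <- s) n a.
pose C0 := (1 - q^-1)^-1.
have qV : q^-1 < 1 by rewrite invf_lt1.
have C00 : 0 < C0 by rewrite invr_gt0 subr_gt0.
pose p := (q ^ d)^-1.
have p0 : 0 < p by rewrite invr_gt0 exprz_gt0.
have p1 : p < 1.
  by rewrite /p /d dE invf_lt1 ?exprn_gt0// exprn_egt1.
(* As [p = q ^ (- d)], the product is [A ^ (2 * M) / q ^ (d * M * (M - 1) / 2)]. *)
suff main M : (0 < M)%N -> cnorm (F 0) <= 4 * C0 * B * \prod_(m < M) (A ^+ 2 * p ^+ m).
  apply/eqP; rewrite -cnorm_eq0 eq_le cnorm_ge0 andbT leNgt; apply/negP => F0.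
  have c0 : 0 < 4 * C0 * B by rewrite !mulr_gt0.
  have [M M0 HM] := @prod_geom_small R (A ^+ 2) p (cnorm (F 0) / (4 * C0 * B))
    (exprn_ge0 _ (ltW A0)) (introT andP (conj (ltW p0) p1)) (divr_gt0 F0 c0).
  have := main M M0; rewrite leNgt => /negP; apply.
  by rewrite mulrC -ltr_pdivlMr.
move=> M0; pose Y := M%:R * t.
have Y0 : 0 < Y by rewrite mulr_gt0// ltr0n.
pose k z := F z * (theta M z)^-1.
have kord z : `|cIm z| <= Y -> ord_ge k z 0.
  move=> zY; have := ord_eq_theta M z; rewrite theta_order// => /ord_eqV/ord_eq_ge.
  by move=> /(ord_geM (F_ord z)); rewrite subrr.
have thper : periodic1 (theta M).
  move=> z; apply: eq_bigr => m _; apply: eq_bigr => a _; rewrite /low_factor /up_factor.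
  have l1 : e1 (z + 1 - (a - m%:R * tau)) = e1 (z - (a - m%:R * tau)).
    by rewrite addrAC e1_per.
  have u1 : e1 (a + m.+1%:R * tau - (z + 1)) = e1 (a + m.+1%:R * tau - z).
    by rewrite -(e1_per (_ - (z + 1))); congr e1; ring.
  by rewrite l1 u1.
have kper : periodic1 k by move=> z; rewrite /k F_per1 thper.
have lineE l z : cIm z = l%:~R * t -> holofill k z = F z * (theta M z)^-1.
  move=> zl; have [ath th0] := theta_analytic M zl.
  apply: holofill_id; apply: ccontM; first by apply/analytic_cont/F_reg/(n_line zl).
  exact: ccontV th0 (analytic_cont ath).
pose x m : R := (q ^+ (M.-1 - m)) ^ d.
have x0 m : 0 < x m by rewrite exprz_gt0// exprn_gt0.
pose X := \prod_(m < M) x m.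
have X0 : 0 < X by apply: prodr_gt0.
have thbound z : cIm z = Y \/ cIm z = - Y -> X / A ^+ M <= cnorm (theta M z).
  move=> zY; rewrite /theta cnorm_prod.
  have h m : (m < M)%N -> within_factor A (x m) (cnorm (theta_block tau n s m z)).
    by move=> mM; have [_ h] := HA M m z mM; exact: h.
  by have /andP[] := within_prod A1 x0 h.
have th0 : cnorm (theta M 0) <= A ^+ M.
  rewrite /theta cnorm_prod.
  have h m : (m < M)%N -> within_factor A 1 (cnorm (theta_block tau n s m 0)).
    by move=> mM; have [h _] := HA M m 0 mM; exact: h.
  by have /andP[_] := within_prod A1 (fun=> ltr01) h; rewrite [X in _ <= _ * X -> _]big1// mulr1.
have side l : (l = M :> int) \/ (l = - (M : int)) ->
    cnorm (line_int (fun z => holofill k z * (1 - e1 z)^-1) (l%:~R * t)) <= 2 * (B * (A ^+ M / X) * C0).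
  move=> lM; set y := l%:~R * t.
  have yY : y = Y \/ y = - Y.
    by rewrite /y; case: lM => ->; [left | right; rewrite rmorphN /= mulNr].
  have y0 : y != 0 by case: yY => ->; rewrite ?oppr_eq0 gt_eqF.
  have cim v : cIm (mkC v y) = l%:~R * t by [].
  apply: line_int_bound => [v|v _].
    apply: ccontM (cont_line_kernel y0 v).
    apply/analytic_cont/ord_ge0_holofill/kord; rewrite cim -/y.
    by case: yY => ->; rewrite ?normrN gtr0_norm.
  rewrite (lineE l _ (cim v)) cnormM cnormM !cnormV.
  have thv : X / A ^+ M <= cnorm (theta M (mkC v y)) by apply: thbound.
  have XA : 0 < X / A ^+ M by rewrite divr_gt0// exprn_gt0.
  have e1b : 1 - q^-1 <= cnorm (1 - e1 (mkC v y)).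
    have cy := cnorm_e1 (mkC v y); rewrite [cIm (mkC v y)]/= in cy.
    have qM : q <= q ^+ M by rewrite -{1}(expr1 q) ler_eXn2l.
    have qME : q ^+ M = expR (2 * pi * Y) by exact: qX.
    case: yY => yE; rewrite yE in cy *.
      rewrite expRN -qME in cy; have h := ler_cnorm_sub 1 (e1 (mkC v Y)).
      rewrite cnorm1 cy in h; apply: le_trans h.
      by rewrite lerB// lef_pV2 ?posrE ?exprn_gt0.
    rewrite mulrN opprK -qME in cy; have h := ler_cnorm_sub (e1 (mkC v (- Y))) 1.
    rewrite cnorm1 cnormB cy in h; apply: le_trans h.
    apply: (le_trans _ (lerB qM (lexx 1))).
    rewrite -subr_ge0 (_ : _ - _ = (q - 1) ^+ 2 / q); last by field; rewrite gt_eqF.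
    by rewrite divr_ge0 ?sqr_ge0// ltW.
  apply: ler_pM.
  - by rewrite mulr_ge0 ?cnorm_ge0// invr_ge0 cnorm_ge0.
  - by rewrite invr_ge0 cnorm_ge0.
  - apply: ler_pM; rewrite ?invr_ge0 ?cnorm_ge0//; first exact: (HB l _ (cim v)).
    by rewrite -invf_div lef_pV2 ?posrE//; exact: lt_le_trans thv.
  - by rewrite lef_pV2 ?posrE ?subr_gt0//; apply: lt_le_trans e1b; rewrite subr_gt0.
have ak z : `|cIm z| <= Y -> analytic (holofill k) z by move=> zY; apply/ord_ge0_holofill/kord.
have formula := strip_formula Y0 (holofill_per kper) ak.
pose Z := B * (A ^+ M / X) * C0.
have b1 : cnorm (line_int (fun z => holofill k z * (1 - e1 z)^-1) Y) <= 2 * Z.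
  exact: side (M : int) (or_introl erefl).
have b2 : cnorm (line_int (fun z => holofill k z * (1 - e1 z)^-1) (- Y)) <= 2 * Z.
  by have := side (- (M : int)) (or_intror erefl); rewrite mulrNz mulNr.
have [_ th0n] := theta_analytic M z0E.
have F0E : F 0 = theta M 0 * holofill k 0 by rewrite (lineE 0 0 z0E) mulrC divfK.
have k0b : cnorm (holofill k 0) <= 2 * Z + 2 * Z.
  by rewrite formula; apply: le_trans (ler_cnormB _ _) (lerD b1 b2).
rewrite F0E cnormM; apply: le_trans (ler_pM (cnorm_ge0 _) (cnorm_ge0 _) th0 k0b) _.
suff -> : \prod_(m < M) (A ^+ 2 * p ^+ m) = A ^+ M * A ^+ M / X.
  by rewrite le_eqVlt; apply/orP; left; apply/eqP; rewrite /Z; ring.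
rewrite big_split /= prodr_const card_ord -exprM mul2n -addnn exprD; congr (_ * _).
rewrite /X -prodfV (reindex_inj rev_ord_inj) /=; apply: eq_bigr => m _.
rewrite /x /p exprVn; congr (_^-1).
rewrite (_ : (M - m.+1 = M.-1 - m)%N); last by rewrite subnS -!subn1 subnAC.
by rewrite !exprnP !exprz_exp mulrC.
Qed.

End ThetaOrder.

Section EllipticVanish.
Context {R : realType}.
Implicit Types (a b c z w tau : CC R) (j k : int).

(** The points to avoid are countably many. *)
Lemma avoid_cosets (L : seq R) (t u v : R) : u < v ->
  exists2 y, u < y < v & forall x, x \in L -> forall j, y <> x + j%:~R * t.
Proof.
move=> uv; apply: contrapT => none.
have sub : `]u, v[%classic `<=` \bigcup_(x in [set` L]) range (fun j : int => x + j%:~R * t).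
  move=> y /=; rewrite in_itv /= => yP; apply: contrapT => ny; apply: none; exists y => // x xL j yE.
  by apply: ny; exists x => //; exists j.
have cU : countable `]u, v[%classic.
  apply: sub_countable (subset_card_le sub) _; apply: bigcup_countable => [|x _].
    exact/finite_set_countable/finite_seq.
  apply: sub_countable (card_image_le _ _) _; exact: countableP.
have := countable_lebesgue_measure0 cU; rewrite lebesgue_measure_itv /= lte_fin uv => -[/eqP].
by rewrite subr_eq0 gt_eqF.
Qed.

Context (tau : CC R) (tau_gt0 : 0 < cIm tau).
Context (n : CC R -> int) (s : seq (CC R)).
Context (n_per : forall z j k, n (z + j%:~R * tau + k%:~R) = n z).
Context (s_cover : forall z, n z != 0 -> exists2 a, a \in s &
  exists j k, z = a + j%:~R * tau + k%:~R).
Context (s_uniq : uniq s).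
Context (s_sep : forall a b j k, a \in s -> b \in s -> a = b + j%:~R * tau + k%:~R -> a = b).
Context (n_pos : 0 < \sum_(a <- s) n a).
Let t := cIm tau.

(** Translation brings [z0] to the origin; the representatives of the zeros and poles are
    then moved into the open strip [- Im tau < Im z < 0] by multiples of [tau]. *)
Lemma elliptic_line (F : CC R -> CC R) z0 :
  (forall z, ord_ge F z (n z)) -> (forall z, n z = 0 -> analytic F z) ->
  periodic1 F -> (forall z, F (z + tau) = F z) ->
  (forall a, a \in s -> forall j, cIm z0 <> cIm a + j%:~R * t) -> F z0 = 0.
Proof.
move=> F_ord F_reg F1 Ft z0P; have t0 : 0 < t := tau_gt0.
have [sh shP] : exists sh : CC R -> int, forall a, a \in s ->
    - t < cIm (a - z0 + (sh a)%:~R * tau) < 0.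
  exists (fun a => - Num.floor (cIm (a - z0) / t) - 1) => a as_.
  rewrite cImD cIm_intM -/t.
  have /andP[j1 j2] := floor_itv (cIm (a - z0) / t).
  set f := Num.floor _ in j1 j2 *; rewrite rmorphB rmorphN /= mulrBl mul1r mulNr.
  move: j1 j2; rewrite ler_pdivlMr// ltr_pdivrMr// intrD mulrDl mul1r => j1 j2.
  have ne : cIm (a - z0) <> f%:~R * t.
    by rewrite cImB => h; apply: (z0P a as_ (- f)); rewrite rmorphN /= mulNr -h; lra.
  have lt1 : f%:~R * t < cIm (a - z0) by rewrite lt_neqAle j1 andbT eq_sym; exact/eqP.
  by apply/andP; split; lra.
pose rep a := a - z0 + (sh a)%:~R * tau.
rewrite -[z0]add0r.
apply: (@elliptic_core R tau tau_gt0 (fun z => n (z + z0)) (map rep s) _ _ _ _ _ (fun z => F (z + z0))) => //.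
- move=> z j k /=; rewrite -(n_per (z + z0) j k); congr n; ring.
- move=> z /= /s_cover[a as_ [j [k zE]]]; exists (rep a); first exact: map_f.
  exists (j - sh a), k; rewrite /rep rmorphB /=.
  by rewrite -[z](addrK z0) zE; ring.
- rewrite map_inj_in_uniq// => a b as_ bs ab; apply: (s_sep (j := sh b - sh a) (k := 0)) => //.
  move: ab; rewrite /rep; move: (sh a) (sh b) => ja jb ab; rewrite rmorphB /= addr0.
  have -> : a = (a - z0 + ja%:~R * tau) + z0 - ja%:~R * tau by ring.
  by rewrite ab; ring.
- move=> _ _ j k /mapP[a as_ ->] /mapP[b bs ->] ab; congr rep.
  apply: (s_sep (j := sh b - sh a + j) (k := k)) => //.
  move: ab; rewrite /rep; move: (sh a) (sh b) => ja jb ab; rewrite rmorphD rmorphB /=.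
  have -> : a = (a - z0 + ja%:~R * tau) + z0 - ja%:~R * tau by ring.
  by rewrite ab; ring.
- by move=> _ /mapP[a as_ ->]; exact: shP.
- by move=> z; exact: ord_ge_shift.
- by move=> z /F_reg; exact: analytic_shift.
- by move=> z; rewrite addrAC F1.
- by move=> z; rewrite addrAC Ft.
rewrite big_map (eq_bigr n)// => a _; rewrite -[RHS](n_per _ (sh a) 0); congr n.
by rewrite /rep addr0; ring.
Qed.

(** [F] vanishes on every horizontal line that avoids the cosets of the zeros and poles, and
    almost every line does. By its local form [F] is nonzero on an open set if it is nonzero
    at all, which such a line would meet. *)
Lemma elliptic_vanish (F : CC R -> CC R) :
  (forall z, ord_ge F z (n z)) -> periodic1 F -> (forall z, F (z + tau) = F z) ->
  forall z, \forall w \near z, w != z -> F w = 0.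
Proof.
move=> F_ord F1 Ft z; have t0 : 0 < t := tau_gt0.
have lineE w : (forall a, a \in s -> forall j, cIm w <> cIm a + j%:~R * t) -> holofill F w = 0.
  apply: (@elliptic_line (holofill F)).
  - by move=> v; apply: holofill_ord_ge.
  - by move=> v nv; apply: ord_ge0_holofill; have := F_ord v; rewrite nv.
  - exact: holofill_per.
  - exact: holofill_per.
have near1 := near_holofill (F_ord z).
have [U aU FU] := F_ord z.
suff : \forall w \near z, U w = 0.
  by move: FU; apply: filterS2 => w FU U0 wz; rewrite FU// U0 mulr0.
have := near_near near1; have := near_near FU; move: aU.
apply: filterS3 => w [l /cder_cont cU] FUw Hw.
apply/eqP/negP => /negP U0.
have Un := ccont_near_neq0 cU U0.
have /nbhs_cnorm[d d0 Hd] : \forall v \near w,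
    [/\ v != z -> F v = (v - z) ^ n z * U v, v != z -> holofill F v = F v & U v != 0].
  by move: FUw Hw Un; apply: filterS3.
have [y /andP[y1 y2] H] := @avoid_cosets (cIm z :: map (@cIm R) s) t (cIm w) (cIm w + d)
  (ltr_pwDr d0 (lexx _)).
pose v := mkC (cRe w) y.
have vw : cnorm (v - w) < d.
  by rewrite (mkCE w) /v mkCB subrr cnorm_imag ger0_norm; lra.
have vz : v != z.
  apply/eqP => vz; apply: (H (cIm z) (mem_head _ _) 0).
  by rewrite mul0r addr0 -vz.
have [e1' e2 e3] := Hd v vw; have := lineE v; rewrite e2// e1'// => e0.
have /eqP : (v - z) ^ n z * U v = 0.
  apply: e0 => a as_ j; apply: (H (cIm a)).
  by rewrite inE map_f ?orbT.
by rewrite mulf_eq0 (negPf e3) orbF expfz_eq0 subr_eq0 (negPf vz) andbF.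
Qed.

End EllipticVanish.

(** * Holomorphic functions on a curve *)

Section HoloCurve.
Context {R : realType} {X : curve R}.
Implicit Types (x y p : X) (U V : set X) (f g h z : X -> CC R) (i j : chart_idx X).

Definition holo_at f x : Prop :=
  forall i, chart_dom i x -> exists l, cder (f \o @chart_inv R X i) (chart i x) l.

Lemma holo_onP U f : holo_on U f <-> (forall x, U x -> holo_at f x).
Proof.
split=> [hf x Ux i ix|hf i x Ux ix]; first by apply/cderP; exact: hf.
by apply/cderP; exact: hf.
Qed.

Lemma nbhs_chart i x (P : set X) : chart_dom i x ->
  nbhs x P -> \forall w \near chart i x, P (@chart_inv R X i w).
Proof. by move=> ix xP; apply: (chart_inv_continuous ix); rewrite chartK. Qed.

Lemma nbhs_chart_inv i x (P : set (CC R)) : chart_dom i x ->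
  nbhs (chart i x) P -> \forall y \near x, P (chart i y).
Proof. by move=> ix; exact: (chart_continuous ix). Qed.

Lemma near_chart_dom i x : chart_dom i x -> \forall y \near x, chart_dom i y.
Proof. by move=> ix; apply: open_nbhs_nbhs; split => //; exact: chart_dom_open. Qed.

Lemma near_chart_im i x : chart_dom i x -> \forall w \near chart i x,
  chart_dom i (@chart_inv R X i w) /\ chart i (@chart_inv R X i w) = w.
Proof.
move=> ix; have : nbhs (chart i x) (chart i @` chart_dom i).
  by apply: open_nbhs_nbhs; split; [exact: chart_im_open | exists x].
by apply: filterS => w [y iy <-]; rewrite chartK.
Qed.

Lemma cder_transition i j x : chart_dom i x -> chart_dom j x ->
  exists l, cder (chart j \o @chart_inv R X i) (chart i x) l.
Proof. by move=> ix jx; apply/cderP; exact: chart_transition. Qed.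

(** One chart suffices, as transitions are holomorphic. *)
Lemma holo_at_chart f i x : chart_dom i x ->
  (exists l, cder (f \o @chart_inv R X i) (chart i x) l) -> holo_at f x.
Proof.
move=> ix [l fl] j jx; have [m hm] := cder_transition jx ix.
exists (l * m); have fl' : cder (f \o @chart_inv R X i) ((chart i \o @chart_inv R X j) (chart j x)) l.
  by rewrite /= chartK.
apply: eq_near_cder (cder_comp hm fl').
have := nbhs_chart jx (near_chart_dom ix); apply: filterS => w iw /=.
by rewrite chartK.
Qed.

Lemma holo_atM f g x : holo_at f x -> holo_at g x -> holo_at (fun y => f y * g y) x.
Proof.
by move=> hf hg i ix; have [l fl] := hf i ix; have [m gm] := hg i ix; eexists; exact: cderM fl gm.
Qed.

Lemma holo_atD f g x : holo_at f x -> holo_at g x -> holo_at (fun y => f y + g y) x.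
Proof.
by move=> hf hg i ix; have [l fl] := hf i ix; have [m gm] := hg i ix; eexists; exact: cderD fl gm.
Qed.

Lemma holo_at_cst (c : CC R) x : holo_at (fun=> c) x.
Proof. by move=> i ix; exists 0; exact: cder_cst. Qed.

Lemma holo_atV f x : f x != 0 -> holo_at f x -> holo_at (fun y => (f y)^-1) x.
Proof.
move=> fx hf i ix; have [l fl] := hf i ix; eexists.
by apply: (@cderV _ (f \o @chart_inv R X i)); [rewrite /= chartK | exact: fl].
Qed.

Lemma eq_near_holo_at f g x : (\forall y \near x, f y = g y) -> holo_at f x -> holo_at g x.
Proof.
move=> fg hf i ix; have [l fl] := hf i ix; exists l; apply: eq_near_cder fl.
exact: nbhs_chart ix fg.
Qed.

Lemma holo_at_cont f x i : chart_dom i x -> holo_at f x ->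
  forall P : set (CC R), nbhs (f x) P -> \forall y \near x, P (f y).
Proof.
move=> ix hf P fP; have [l /cder_cont/ccontP cf] := hf i ix.
have fP' : nbhs ((f \o @chart_inv R X i) (chart i x)) P by rewrite /= chartK.
have := nbhs_chart_inv ix (cf P fP'); move: (near_chart_dom ix).
by apply: filterS2 => y iy; rewrite /= chartK.
Qed.

Lemma holo_at_neq0 f x : holo_at f x -> f x != 0 -> \forall y \near x, f y != 0.
Proof.
have [i ix] := chart_cover x; move=> hf fx; apply: (holo_at_cont ix hf (P := [set w | w != 0])).
by apply: (@ccont_near_neq0 _ id) fx; exact: ccont_id.
Qed.

Lemma analytic_chart f U i x : open U -> holo_on U f -> U x -> chart_dom i x ->
  analytic (f \o @chart_inv R X i) (chart i x).
Proof.
move=> oU /holo_onP hf Ux ix.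
have nU := nbhs_chart ix (open_nbhs_nbhs (conj oU Ux)).
move: nU (near_chart_im ix); apply: filterS2 => w Uw [iw wE].
by have := hf _ Uw i iw; rewrite wE.
Qed.

Lemma not_isolated x (P : set X) : nbhs x P -> exists2 y, P y & y != x.
Proof.
have [i ix] := chart_cover x => xP.
have /nbhs_cnorm[d d0 H] : \forall w \near chart i x,
    P (@chart_inv R X i w) /\ chart i (@chart_inv R X i w) = w.
  by move: (nbhs_chart ix xP) (near_chart_im ix); apply: filterS2 => w ? [].
pose w := mkC (d / 2) 0 + chart i x.
have wn : cnorm (w - chart i x) = d / 2 by rewrite addrK cnorm_real gtr0_norm// divr_gt0.
have [Pw wE] : P (@chart_inv R X i w) /\ chart i (@chart_inv R X i w) = w.
  by apply: H; rewrite wn; lra.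
exists (@chart_inv R X i w) => //; apply/eqP => E.
have : w - chart i x = 0 by rewrite -wE E subrr.
by move/eqP; rewrite -cnorm_eq0 wn; apply/negP; rewrite gt_eqF// divr_gt0.
Qed.

Lemma local_coord_ord U z p i : local_coord p U z -> chart_dom i p ->
  ord_eq (z \o @chart_inv R X i) (chart i p) 1.
Proof.
move=> [oU [Up zp] hz dz _] ip.
have az := analytic_chart oU hz Up ip.
have [l hl] := analytic_cder az.
apply: (ord_eq1 az _ hl); first by rewrite /= chartK.
by have [_ <-] := iffLR (cder_is_derive _ _ _) hl; exact: dz.
Qed.

Lemma local_coord_neq0 U z p x : local_coord p U z -> U x -> x != p -> z x != 0.
Proof.
move=> [_ [Up zp] _ _ zinj] Ux; apply: contra => /eqP zx.
by apply/eqP/zinj => //; rewrite zx zp.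
Qed.

Lemma open_neq p : open [set y : X | y != p].
Proof.
have -> : [set y | y != p] = ~` [set p] by apply/seteqP; split=> y /= /eqP.
apply: closed_openC; apply: accessible_closed_set1.
exact: hausdorff_accessible (@curve_hausdorff R X).
Qed.

(** In a chart both functions vanish at [p], the coordinate to order exactly one. *)
Lemma holo_on_div U f z p : local_coord p U z -> holo_on U f -> f p = 0 ->
  exists2 g, holo_on U g & forall x, U x -> f x = z x * g x.
Proof.
move=> zP hf fp; have [oU [Up zp] hz dz zinj] := zP.
have [i ip] := chart_cover p; set c := chart i p.
have af : analytic (f \o @chart_inv R X i) c by exact: (analytic_chart oU hf Up ip).
have fc : (f \o @chart_inv R X i) c = 0 by rewrite /= chartK.
have [A aA [_ fA]] := analytic_div af fc.
have [B [aB B0] zB] := local_coord_ord zP ip.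
exists (fun x => if x == p then A c / B c else f x / z x); last first.
  move=> x Ux; case: eqVneq => [->|xp]; first by rewrite fp zp mul0r.
  by rewrite mulrC divfK// (local_coord_neq0 zP).
apply/holo_onP => x Ux; have [->|xp] := eqVneq x p; last first.
  apply: (@eq_near_holo_at (fun x => f x * (z x)^-1)).
    move: (open_nbhs_nbhs (conj (open_neq p) xp)).
    by apply: filterS => y /negPf yp; rewrite yp.
  apply: holo_atM; first exact: (iffLR (holo_onP _ _) hf).
  apply: holo_atV; first exact: (local_coord_neq0 zP).
  exact: (iffLR (holo_onP _ _) hz).
apply: (holo_at_chart ip); have [l hl] := analytic_cder (analyticM aA (analyticV B0 aB)).
exists l; apply: eq_near_cder hl.
have nB := ccont_near_neq0 (analytic_cont aB) B0.
move: zB (near_chart_im ip) nB; apply: filterS3 => w zB [iw wE] Bw /=.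
case: eqVneq => [wp|wp]; first by rewrite -wE wp.
have wc : w != c by apply: contra wp => /eqP ->; rewrite /c chartK.
have := zB wc; rewrite /= expr1z => ->; rewrite (fA w : f _ = _).
by rewrite -/c -mulf_div divff ?subr_eq0// mul1r.
Qed.

End HoloCurve.

(** * Functions on an elliptic curve *)

Section EllipticCurve.
Context {R : realType} {X : curve R} (hX : elliptic_curve X).

(** The plane is rescaled so that one period is one, and the sign of the other is chosen so
    that it lies in the upper half plane. Charts enter through the chain rule only. *)
Lemma normalized_uniformization : exists (tau : CC R) (phi : CC R -> X),
  [/\ 0 < cIm tau,
      (forall a i, chart_dom i (phi a) -> exists2 c : CC R, c != 0 &
         forall (g : X -> CC R) m, cder (g \o @chart_inv R X i) (chart i (phi a)) m ->
         cder (g \o phi) a (m * c)),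
      (forall a (P : set X), nbhs (phi a) P -> \forall w \near a, P (phi w)),
      (forall x, exists a, phi a = x) &
      (forall a b, phi a = phi b <-> exists j k : int, a = b + j%:~R * tau + k%:~R)].
Proof.
have [w1 [w2 [u [indep cu du su pu]]]] := hX.
have w10 : w1 != 0.
  apply/eqP => w0; have [|/eqP] := indep 1 0; last by rewrite oner_eq0.
  by rewrite w0 mulr0 add0r -[(0%:C)%C]/(0 : CC R) mul0r.
pose tau0 := w2 / w1.
have tau0E : w2 = tau0 * w1 by rewrite divfK.
have im0 : cIm tau0 != 0.
  apply/eqP => t0; have [|_ /eqP] := indep (cRe tau0) (- 1).
    have e1 : (- 1)%:C%C = - 1 :> CC R by rewrite -[RHS]/(Complex (- 1) (- 0)) oppr0.
    have tE : tau0 = (cRe tau0)%:C%C by rewrite {1}(mkCE tau0) t0.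
    by rewrite e1 -tE tau0E mulN1r subrr.
  by rewrite oppr_eq0 oner_eq0.
pose phi z := u (w1 * z).
have lin a : cder (fun w => w1 * w) a w1.
  by have := cderM (cder_cst w1 a) (cder_id a); rewrite /= mulr1 mulr0 addr0.
have cphi a (P : set X) : nbhs (phi a) P -> \forall w \near a, P (phi w).
  move=> aP; have := cu _ _ aP; have /ccontP := cder_cont (lin a); exact.
have phiE a b : phi a = phi b <-> exists m n : int, a - b = m%:~R + n%:~R * tau0.
  rewrite /phi pu; split=> -[m [n E]]; exists m, n.
    apply: (mulfI w10); rewrite mulrBr E tau0E; ring.
  by rewrite -mulrBr E tau0E; ring.
pose tau := if 0 < cIm tau0 then tau0 else - tau0.
exists tau, phi; split=> //.
- rewrite /tau; case: ifPn => // h.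
  have -> : cIm (- tau0) = - cIm tau0 by case: (tau0).
  by rewrite oppr_gt0 lt_neqAle im0 leNgt.
- move=> a i ia; have [/cderP[c hc] d0] := du _ _ ia.
  have c0 : c != 0 by move: d0; have [_ ->] := iffLR (cder_is_derive _ _ _) hc.
  exists (c * w1); first by rewrite mulf_neq0.
  move=> g m gm; have hcw := cder_comp (lin a) hc.
  apply: eq_near_cder (cder_comp hcw gm).
  have := cphi a _ (near_chart_dom ia); apply: filterS => w iw /=.
  by rewrite chartK.
- by move=> x; have [z zx] := su x; exists (z / w1); rewrite /phi mulrC divfK.
move=> a b; rewrite phiE /tau; case: ifP => _; split=> -[m [n E]].
- by exists n, m; rewrite -[a](subrK b) E; ring.
- by exists n, m; rewrite E; ring.
- by exists (- n), m; rewrite -[a](subrK b) E rmorphN /=; ring.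
- by exists n, (- m); rewrite E rmorphN /=; ring.
Qed.

Lemma degE (D : {freeg X / int}) : freeg.deg D = \sum_(x <- freeg.dom D) coeff x D.
Proof.
rewrite -[in LHS](freeg_sumE D) raddf_sum; apply: eq_bigr => x _; exact: degU.
Qed.

(** Pulled back by the uniformization, which is locally biholomorphic, [f] becomes an elliptic
    function with prescribed orders of positive sum. The conclusion avoids [x], since the
    value of [f] at a zero or pole is arbitrary. *)
Lemma elliptic_zero (D : {freeg X / int}) (f : X -> CC R) :
  (forall x, exists (U : set X) (z h : X -> CC R),
    [/\ local_coord x U z, holo_on U h &
        forall y, U y -> y != x -> f y = z y ^ (coeff x D) * h y]) ->
  0 < freeg.deg D ->
  forall x (V : set X), nbhs x V -> exists y, [/\ V y, y != x & f y = 0].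
Proof.
move=> Hf D0; have [tau [phi [tau0 dphi cphi sphi pphi]]] := normalized_uniformization.
have aphi g U a : open U -> U (phi a) -> holo_on U g -> analytic (g \o phi) a.
  move=> oU Ua /holo_onP hg; have := cphi a _ (open_nbhs_nbhs (conj oU Ua)).
  apply: filterS => w Uw; have [i iw] := chart_cover (phi w).
  have [c _ Hc] := dphi _ _ iw; have [m hm] := hg _ Uw i iw.
  by exists (m * c); exact: Hc.
have coord a U z : local_coord (phi a) U z -> ord_eq (z \o phi) a 1.
  move=> zP; have [oU [Ua za] hz dz _] := zP.
  have [i ia] := chart_cover (phi a).
  have [c c0 Hc] := dphi _ _ ia; have [m hm] := iffLR (holo_onP _ _) hz _ Ua i ia.
  apply: (ord_eq1 (aphi z U a oU Ua hz) za (Hc _ _ hm)).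
  rewrite mulf_neq0//; have [_ <-] := iffLR (cder_is_derive _ _ _) hm; exact: dz.
have notin a U z : local_coord (phi a) U z -> \forall w \near a, w != a -> phi w != phi a.
  move=> zP; have [oU [Ua za] _ _ _] := zP; have [G [aG G0] zG] := coord _ _ _ zP.
  move: zG (ccont_near_neq0 (analytic_cont aG) G0); apply: filterS2 => w zG Gw wa.
  apply/eqP => E; have := zG wa; rewrite /= E za expr1z => /esym/eqP.
  by rewrite mulf_eq0 (negPf Gw) subr_eq0 (negPf wa).
pose n a := coeff (phi a) D.
pose s := map (fun x => projT1 (cid (sphi x))) (freeg.dom D).
have pickK x : phi (projT1 (cid (sphi x))) = x by exact: (projT2 (cid (sphi x))).
have F_ord a : ord_ge (f \o phi) a (n a).
  have [U [z [h [zP hh fE]]]] := Hf (phi a); have [oU [Ua _] _ _ _] := zP.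
  have := ord_geM (ord_eq_ge (ord_eqXz (n a) (coord _ _ _ zP)))
                  (analytic_ord_ge0 (aphi h U a oU Ua hh)).
  rewrite mul1r addr0; apply: eq_ord_ge.
  move: (notin _ _ _ zP) (cphi a _ (open_nbhs_nbhs (conj oU Ua))).
  by apply: filterS2 => w ne Uw wa; rewrite /= fE// ne.
have per1 a : phi (a + 1) = phi a by apply/pphi; exists 0, 1; rewrite mul0r addr0.
have pert a : phi (a + tau) = phi a by apply/pphi; exists 1, 0; rewrite mul1r addr0.
have van : forall a, \forall w \near a, w != a -> (f \o phi) w = 0.
  apply: (@elliptic_vanish R tau tau0 n s) => //.
  - by move=> z j k; rewrite /n; congr coeff; apply/pphi; exists j, k.
  - move=> z nz; exists (projT1 (cid (sphi (phi z)))).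
      by apply: map_f; rewrite mem_dom.
    by apply/pphi; rewrite pickK.
  - rewrite map_inj_uniq ?uniq_dom// => x y E.
    by rewrite -(pickK x) E pickK.
  - move=> a b j k /mapP[x _ ->] /mapP[y _ ->] E; congr (projT1 (cid (sphi _))).
    by rewrite -(pickK x) -(pickK y); apply/pphi; exists j, k.
  - by rewrite big_map; under eq_bigr do rewrite /n pickK; rewrite -degE.
  - by move=> z /=; rewrite per1.
  - by move=> z /=; rewrite pert.
move=> x V xV; have [a ax] := sphi x.
have [U [z [h [zP _ _]]]] := Hf (phi a).
have aV : nbhs (phi a) V by rewrite ax.
have /nbhs_cnorm[d d0 Hd] : \forall w \near a,
    [/\ w != a -> phi w != phi a, w != a -> (f \o phi) w = 0 & V (phi w)].
  by move: (notin _ _ _ zP) (van a) (cphi a V aV); apply: filterS3.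
pose w := mkC (d / 2) 0 + a.
have wn : cnorm (w - a) = d / 2 by rewrite addrK cnorm_real gtr0_norm// divr_gt0.
have wa : w != a by rewrite -subr_eq0 -cnorm_gt0 wn divr_gt0.
have [|h1 h2 h3] := Hd w; first by rewrite wn; lra.
by exists (phi w); split => //; [rewrite -ax; exact: h1 | exact: h2].
Qed.

End EllipticCurve.

(** * Holomorphic matrices and bundle maps *)

Section HoloMatrices.
Context {R : realType} {X : curve R}.
Implicit Types (U V : set X) (x y : X).

Lemma holo_on_local U (f : X -> CC R) :
  (forall x, U x -> exists2 V, nbhs x V & exists2 g, holo_at g x & forall y, V y -> f y = g y) ->
  holo_on U f.
Proof.
move=> H; apply/holo_onP => x Ux; have [V xV [g hg fg]] := H x Ux.
by apply: eq_near_holo_at hg; move: xV; apply: filterS => y /fg.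
Qed.

Lemma holo_onD U (f g : X -> CC R) : holo_on U f -> holo_on U g -> holo_on U (fun x => f x + g x).
Proof. by move=> hf hg i x Ux ix; apply: derivableD; [exact: hf | exact: hg]. Qed.

Lemma holo_on_big (op : CC R -> CC R -> CC R) (idx : CC R) I (s : seq I) (P : pred I)
    U (F : I -> X -> CC R) :
  (forall f g : X -> CC R, holo_on U f -> holo_on U g -> holo_on U (fun x => op (f x) (g x))) ->
  (forall i, holo_on U (F i)) -> holo_on U (fun x => \big[op/idx]_(i <- s | P i) F i x).
Proof.
move=> hop H; elim: s => [|i s IH].
  by under [X in holo_on _ X]funext do rewrite big_nil; exact: holo_on_cst.
under [X in holo_on _ X]funext do rewrite big_cons.
by case: (P i); [exact: (hop _ _ (H i) IH) | exact: IH].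
Qed.

Lemma holo_on_sum I (s : seq I) (P : pred I) U (F : I -> X -> CC R) :
  (forall i, holo_on U (F i)) -> holo_on U (fun x => \sum_(i <- s | P i) F i x).
Proof. by apply: holo_on_big; exact: holo_onD. Qed.

Lemma holo_on_prod I (s : seq I) (P : pred I) U (F : I -> X -> CC R) :
  (forall i, holo_on U (F i)) -> holo_on U (fun x => \prod_(i <- s | P i) F i x).
Proof. by apply: holo_on_big; exact: holo_onM. Qed.

Lemma holo_det U n (g : X -> 'M[CC R]_n) : holo_mx U g -> holo_on U (fun x => \det (g x)).
Proof.
move=> hg; apply: holo_on_sum => s; apply: holo_onM; first exact: holo_on_cst.
by apply: holo_on_prod => i; exact: hg.
Qed.

Lemma holo_mxM U m n p (g : X -> 'M[CC R]_(m, n)) (h : X -> 'M[CC R]_(n, p)) :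
  holo_mx U g -> holo_mx U h -> holo_mx U (fun x => g x *m h x).
Proof.
move=> hg hh i j; under [X in holo_on _ X]funext do rewrite mxE.
by apply: holo_on_sum => k; exact: holo_onM.
Qed.

Lemma holo_mxS U V m n (g : X -> 'M[CC R]_(m, n)) : U `<=` V -> holo_mx V g -> holo_mx U g.
Proof. by move=> UV hg i j; exact: holo_onS (hg i j). Qed.

Lemma holo_mxV U n (g : X -> 'M[CC R]_n) : (forall x, U x -> g x \in unitmx) ->
  holo_mx U g -> open U -> holo_mx U (fun x => invmx (g x)).
Proof.
move=> ug hg oU i j.
apply: (@holo_on_eq R X U (fun x => (\det (g x))^-1 * ((-1) ^+ (j + i) *
    \det (row' j (col' i (g x)))))) => //.
  by move=> x /ug gx; rewrite /invmx gx !mxE.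
apply: holo_onM; first by apply: holo_onV; [move=> x /ug; rewrite unitmxE unitfE | exact: holo_det].
apply: holo_onM; first exact: holo_on_cst.
apply: holo_det => k l; under [X in holo_on _ X]funext do rewrite !mxE.
exact: hg.
Qed.

Lemma mulmx_inj (K : fieldType) m n (A B : 'M[K]_(m, n)) :
  (forall w : 'rV[K]_m, w *m A = w *m B) -> A = B.
Proof. by move=> H; apply/row_matrixP => i; rewrite !rowE. Qed.

End HoloMatrices.

Section LinearInverse.
Context {K : nzRingType}.

Definition mk_linear (U V : lmodType K) (f : U -> V) (lf : linear f) : {linear U -> V} :=
  HB.pack f (GRing.isLinear.Build K U V _ f lf).

Lemma mk_linearE (U V : lmodType K) (f : U -> V) (lf : linear f) u : mk_linear lf u = f u.
Proof. by []. Qed.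

(** Unlike the inverse that can be extracted from [bijective], a function of [f] alone. *)
Definition linv (U V : lmodType K) (f : {linear U -> V}) (w : V) : U := xget 0 [set v | f v = w].

Lemma linvK (U V : lmodType K) (f : {linear U -> V}) : bijective f -> cancel f (linv f).
Proof.
move=> bf v; apply: xget_unique => // w /= fw; exact: (bij_inj bf).
Qed.

Lemma linvKV (U V : lmodType K) (f : {linear U -> V}) : bijective f -> cancel (linv f) f.
Proof. by move=> bf w; have [g _ gK] := bf; rewrite -[w]gK linvK. Qed.

Lemma linv_linear (U V : lmodType K) (f : {linear U -> V}) : bijective f -> linear (linv f).
Proof.
by move=> bf c v w; apply: (bij_inj bf); rewrite linearP !linvKV.
Qed.

End LinearInverse.

Section LocalTriv.
Context {R : realType} {X : curve R}.
Implicit Types (U V : set X) (x y : X).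

(** The matrix of [phi] in the frames [t] and [t']. *)
Definition frame_mx r s (E F : X -> lmodType (CC R)) (t : forall x, {linear E x -> 'rV[CC R]_r})
    (t' : forall x, {linear F x -> 'rV[CC R]_s}) (phi : forall x, {linear E x -> F x}) x :
    'M[CC R]_(r, s) :=
  \matrix_(k, l) t' x (phi x (linv (t x) (delta_mx 0 k))) 0 l.

Lemma frame_mxP r s (E F : X -> lmodType (CC R)) (t : forall x, {linear E x -> 'rV[CC R]_r})
    (t' : forall x, {linear F x -> 'rV[CC R]_s}) (phi : forall x, {linear E x -> F x}) x :
  bijective (t x) -> forall v, t' x (phi x v) = t x v *m frame_mx t t' phi x.
Proof.
move=> bt v; rewrite -{1}[v](linvK bt) {1}(row_sum_delta (t x v)).
pose T := mk_linear (linv_linear bt).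
rewrite -[linv (t x) _]/(T _) !linear_sum /=.
apply/rowP => l; rewrite mxE summxE; apply: eq_bigr => k _.
by rewrite -[linv (t x) (_ *: _)]/(T (_ *: _)) !linearZ /= !mxE.
Qed.

Lemma frame_mx_unique r s (E F : X -> lmodType (CC R)) (t : forall x, {linear E x -> 'rV[CC R]_r})
    (t' : forall x, {linear F x -> 'rV[CC R]_s}) (phi : forall x, {linear E x -> F x}) x G :
  bijective (t x) -> (forall v, t' x (phi x v) = t x v *m G) -> G = frame_mx t t' phi x.
Proof.
move=> bt H; apply: mulmx_inj => w.
by rewrite -[w](linvKV bt) -H; exact: (frame_mxP t' phi bt).
Qed.

Lemma local_triv_open r (E : vbundle X r) U t : local_triv (E := E) U t -> open U.
Proof. by case. Qed.

Lemma triv_local_triv r (E : vbundle X r) i : local_triv (E := E) (triv_dom i) (triv i).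
Proof.
split; [exact: triv_dom_open | by move=> x; exact: triv_bij | move=> j].
by have [g [hg gE]] := triv_transition j i; exists g; split=> // x jx ix v; exact: gE.
Qed.

Lemma local_trivS r (E : vbundle X r) U V t : open V -> V `<=` U ->
  local_triv (E := E) U t -> local_triv (E := E) V t.
Proof.
move=> oV VU [oU bt tt]; split=> // [x /VU|i]; first exact: bt.
have [g [hg gE]] := tt i; exists g; split; last by move=> x ix /VU; exact: gE.
by apply: holo_mxS hg => x [ix /VU].
Qed.

Lemma frame_unit r (E : X -> lmodType (CC R)) (t t' : forall x, {linear E x -> 'rV[CC R]_r}) x g :
  bijective (t x) -> bijective (t' x) -> (forall v, t' x v = t x v *m g) -> g \in unitmx.
Proof.
move=> bt bt' gE; pose idl y : {linear E y -> E y} := idfun.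
have h := @frame_mxP _ _ _ _ t' t idl x bt'.
have : g *m frame_mx t' t idl x = 1%:M.
  apply: mulmx_inj => w; rewrite -[w](linvKV bt) mulmxA -gE mulmx1.
  exact/esym/h.
by case/mulmx1_unit.
Qed.

(** [local_triv] compares both [t] and [t'] with the trivializations of the atlas; the change
    is the quotient of the two comparisons. *)
Lemma local_triv_change r (E : vbundle X r) U t U' t' :
  local_triv (E := E) U t -> local_triv (E := E) U' t' ->
  exists g : X -> 'M[CC R]_r, [/\ holo_mx (U `&` U') g,
    (forall x, U x -> U' x -> g x \in unitmx) &
    (forall x, U x -> U' x -> forall v, t' x v = t x v *m g x)].
Proof.
move=> [oU bt tt] [oU' bt' tt']; pose idl y : {linear E y -> E y} := idfun.
pose g := frame_mx t t' idl; exists g.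
have gE x : U x -> U' x -> forall v, t' x v = t x v *m g x.
  by move=> Ux _ v; rewrite -frame_mxP//; exact: bt.
split=> // [k l|x Ux U'x]; last exact: frame_unit (bt _ Ux) (bt' _ U'x) (gE _ Ux U'x).
apply: holo_on_local => x [Ux U'x].
have [i ix] := triv_cover E x.
have [a [ha aE]] := tt i; have [b [hb bE]] := tt' i.
have oV : open (triv_dom i `&` U `&` U') by apply: openI => //; apply: openI => //; exact: triv_dom_open.
exists (triv_dom i `&` U `&` U'); first exact: open_nbhs_nbhs.
have ua y : (triv_dom i `&` U `&` U') y -> a y \in unitmx.
  move=> [[iy Uy] _]; apply: (frame_unit (triv_bij iy) (bt _ Uy)).
  exact: aE.
exists (fun y => (invmx (a y) *m b y) k l); last first.
  move=> y Vy; have [[iy Uy] U'y] := Vy; suff -> : g y = invmx (a y) *m b y by [].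
  apply/esym/frame_mx_unique; first exact: bt.
  move=> v; rewrite [idl y v]/= (aE y iy Uy) (bE y iy U'y) mulmxA mulmxK//.
  exact: ua.
have h : holo_mx (triv_dom i `&` U `&` U') (fun y => invmx (a y) *m b y).
  apply: holo_mxM.
    by apply: holo_mxV => //; apply: holo_mxS ha => y [].
  by apply: holo_mxS hb => y [[? ?] ?].
by apply: (iffLR (holo_onP _ _) (h k l)); split.
Qed.

Lemma local_triv_mul r (E : vbundle X r) U t g (t' : forall x, {linear E x -> 'rV[CC R]_r}) :
  local_triv (E := E) U t -> holo_mx U g -> (forall x, U x -> g x \in unitmx) ->
  (forall x v, U x -> t' x v = t x v *m g x) -> local_triv (E := E) U t'.
Proof.
move=> [oU bt tt] hg ug t'E; split=> // [x Ux|i].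
  have [f fK Kf] := bt x Ux.
  exists (fun w => f (w *m invmx (g x))) => [v|w]; first by rewrite t'E// mulmxK ?ug// fK.
  by rewrite t'E// Kf mulmxKV// ug.
have [a [ha aE]] := tt i; exists (fun x => a x *m g x); split.
  by apply: holo_mxM; [exact: ha | apply: holo_mxS hg => x []].
by move=> x ix Ux v; rewrite t'E// (aE x ix Ux) mulmxA.
Qed.

Lemma bundle_map_local r s (E : vbundle X r) (F : vbundle X s) (f : bundle_map E F) U t U' t' :
  local_triv (E := E) U t -> local_triv (E := F) U' t' ->
  exists g : X -> 'M[CC R]_(r, s), holo_mx (U `&` U') g /\
    (forall x, U x -> U' x -> forall v, t' x (f x v) = t x v *m g x).
Proof.
move=> tP t'P; have [oU bt tt] := tP; have [oU' bt' tt'] := t'P.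
pose g := frame_mx t t' f; exists g; split; last first.
  by move=> x Ux U'x v; rewrite -frame_mxP//; exact: bt.
move=> k l; apply: holo_on_local => x [Ux U'x].
have [i ix] := triv_cover E x; have [j jx] := triv_cover F x.
have [a [ha ua aE]] := local_triv_change tP (triv_local_triv i).
have [b [hb ub bE]] := local_triv_change (triv_local_triv j) t'P.
have [c [hc cE]] := bundle_fun_holo f i j.
pose V := (U `&` triv_dom i) `&` (triv_dom j `&` U').
have oV : open V by apply: openI; apply: openI => //; exact: triv_dom_open.
have Vx : V x by [].
exists V; first exact: open_nbhs_nbhs.
exists (fun y => (a y *m c y *m b y) k l); last first.
  move=> y [[Uy iy] [jy U'y]]; suff -> : g y = a y *m c y *m b y by [].
  apply/esym/frame_mx_unique; first exact: bt.
  by move=> v; rewrite bE// cE// aE// !mulmxA.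
have h : holo_mx V (fun y => a y *m c y *m b y).
  apply: holo_mxM; first apply: holo_mxM.
  - by apply: holo_mxS ha => y [[]].
  - by apply: holo_mxS hc => y [[? ?] [? ?]].
  - by apply: holo_mxS hb => y [_ []].
by apply: (iffLR (holo_onP _ _) (h k l)).
Qed.

(** The trivializations in which [phi] is given may be chosen freely around each point: the
    matrix in those of the atlas differs by holomorphic changes. *)
Lemma mk_bundle_map r s (E : vbundle X r) (F : vbundle X s) (phi : forall x, {linear E x -> F x}) :
  (forall x, exists U t t' g, [/\ U x, local_triv (E := E) U t, local_triv (E := F) U t',
     holo_mx U g & forall y, U y -> forall v, t' y (phi y v) = t y v *m g y]) ->
  exists f : bundle_map E F, forall x v, f x v = phi x v.
Proof.
move=> H.
have hol i j : exists g : X -> 'M[CC R]_(r, s),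
    holo_mx (triv_dom i `&` triv_dom j) g /\
    (forall x, triv_dom i x -> triv_dom j x -> forall v, triv j x (phi x v) = triv i x v *m g x).
  pose g := frame_mx (triv i) (triv j) phi; exists g; split; last first.
    by move=> x ix jx v; rewrite -frame_mxP//; exact: triv_bij.
  move=> k l; apply: holo_on_local => x [ix jx].
  have [U [t [t' [c [Ux tP t'P hc cE]]]]] := H x.
  have [a [ha ua aE]] := local_triv_change (triv_local_triv i) tP.
  have [b [hb ub bE]] := local_triv_change t'P (triv_local_triv j).
  have oU := local_triv_open tP.
  pose V := (triv_dom i `&` U) `&` triv_dom j.
  have oV : open V by apply: openI; [apply: openI => // |]; exact: triv_dom_open.
  have Vx : V x by [].
  exists V; first exact: open_nbhs_nbhs.
  exists (fun y => (a y *m c y *m b y) k l); last first.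
    move=> y [[iy Uy] jy]; suff -> : g y = a y *m c y *m b y by [].
    apply/esym/frame_mx_unique; first exact: triv_bij.
    by move=> v; rewrite bE// cE// aE// !mulmxA.
  have h : holo_mx V (fun y => a y *m c y *m b y).
    apply: holo_mxM; first apply: holo_mxM.
    - by apply: holo_mxS ha => y [[]].
    - by apply: holo_mxS hc => y [[? ?] ?].
    - by apply: holo_mxS hb => y [[? ?] ?].
  by apply: (iffLR (holo_onP _ _) (h k l)).
by exists (BundleMap hol).
Qed.

(** The inverse of a holomorphic matrix is holomorphic, by Cramer's rule. *)
Lemma bijective_bundle_iso r (E F : vbundle X r) (f : bundle_map E F) :
  (forall x, bijective (f x)) -> bundle_iso f.
Proof.
move=> bf; pose phi x : {linear F x -> E x} := mk_linear (linv_linear (bf x)).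
have [|g gE] := @mk_bundle_map _ _ F E phi; last first.
  exists g; split=> x v; rewrite gE mk_linearE; [exact: linvK | exact: linvKV].
move=> x; have [i ix] := triv_cover E x; have [j jx] := triv_cover F x.
have [c [hc cE]] := bundle_fun_holo f i j.
pose U := triv_dom i `&` triv_dom j.
have oU : open U by apply: openI; exact: triv_dom_open.
have uc y : U y -> c y \in unitmx.
  move=> [iy jy]; pose tf z : {linear E z -> 'rV[CC R]_r} := triv j z \o f z.
  apply: (@frame_unit r E (triv i) tf y (c y) (triv_bij iy)).
    by apply: bij_comp; [exact: triv_bij | exact: bf].
  by move=> v; exact: cE.
exists U, (triv j), (triv i), (fun y => invmx (c y)); split.
- by [].
- by apply: local_trivS (triv_local_triv j) => // y [].
- by apply: local_trivS (triv_local_triv i) => // y [].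
- exact: holo_mxV.
move=> y Uy v; have [iy jy] := Uy; rewrite mk_linearE.
by rewrite -{2}[v](linvKV (bf y)) (cE y iy jy) mulmxK// uc.
Qed.

End LocalTriv.

(** * Degrees of bundles on an elliptic curve *)

Section Coordinates.
Context {R : realType} {X : curve R}.
Implicit Types (U V : set X) (x y p : X) (z f : X -> CC R).

Lemma local_coordS U V p z : open V -> V p -> V `<=` U -> local_coord p U z -> local_coord p V z.
Proof.
move=> oV Vp VU [oU [Up zp] hz dz zi]; split=> //.
- exact: holo_onS hz.
- by move=> i x /VU; exact: dz.
- by move=> x y /VU Ux /VU Uy; exact: zi.
Qed.

(** Points of a curve are not isolated. *)
Lemma holo_at_punctured f x : holo_at f x -> (\forall y \near x, y != x -> f y = 0) -> f x = 0.
Proof.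
move=> hf f0; apply/eqP/negP => /negP fx.
have H : \forall y \near x, f y != 0 /\ (y != x -> f y = 0).
  by move: (holo_at_neq0 hf fx) f0; apply: filterS2.
have [y [fy fy0] yx] := not_isolated H.
by move: fy; rewrite fy0// eqxx.
Qed.

(** Each of the two coordinates divides the other. *)
Lemma local_coord_unit U V p z z' : local_coord p U z -> local_coord p V z' ->
  exists2 w, holo_on (U `&` V) w &
    forall y, (U `&` V) y -> w y != 0 /\ z' y = z y * w y.
Proof.
move=> zP z'P; have [oU [Up zp] hz _ _] := zP; have [oV [Vp z'p] hz' _ _] := z'P.
have oUV : open (U `&` V) by exact: openI.
have UVp : (U `&` V) p by [].
have zP1 : local_coord p (U `&` V) z by apply: local_coordS zP => // y [].
have zP2 : local_coord p (U `&` V) z' by apply: local_coordS z'P => // y [].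
have hz1 : holo_on (U `&` V) z by apply: holo_onS hz => y [].
have hz2 : holo_on (U `&` V) z' by apply: holo_onS hz' => y [].
have [w hw wE] := holo_on_div zP1 hz2 z'p.
have [v hv vE] := holo_on_div zP2 hz1 zp.
have wvE y : (U `&` V) y -> y != p -> w y * v y = 1.
  move=> Uy yp; have zy := local_coord_neq0 zP1 Uy yp.
  by apply: (mulfI zy); rewrite mulrA -wE// -vE// mulr1.
have wvp : w p * v p = 1.
  have : w p * v p + -1 = 0.
    apply: (@holo_at_punctured (fun y => w y * v y + -1)).
      apply: holo_atD; last exact: holo_at_cst.
      exact: holo_atM (iffLR (holo_onP _ _) hw p UVp) (iffLR (holo_onP _ _) hv p UVp).
    move: (open_nbhs_nbhs (conj oUV UVp)); apply: filterS => y Uy yp.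
    by rewrite wvE// subrr.
  by move/eqP; rewrite subr_eq0 => /eqP.
exists w => // y Uy; split; last exact: wE.
have : w y * v y = 1 by have [->|yp] := eqVneq y p; [exact: wvp | exact: wvE].
by move=> E; apply/eqP => w0; move/eqP: E; rewrite w0 mul0r eq_sym oner_eq0.
Qed.

End Coordinates.

Lemma ratio_identity (K : fieldType) (a b c d u v : K) : b != 0 -> c != 0 -> d != 0 -> v != 0 ->
  a * u / (b * c * v / d) = a / b * (u / v * d / c).
Proof. by move=> b0 c0 d0 v0; field; rewrite ?b0 ?c0 ?d0 ?v0. Qed.

Section Degrees.
Context {R : realType} {X : curve R}.
Implicit Types (U V : set X) (x y p : X).

Lemma comp_bundle_map r s k (E : vbundle X r) (F : vbundle X s) (G : vbundle X k)
    (f : bundle_map E F) (g : bundle_map F G) :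
  exists h : bundle_map E G, forall x v, h x v = g x (f x v).
Proof.
have [|h hE] := @mk_bundle_map _ _ _ _ E G (fun x => g x \o f x); last by exists h.
move=> x; have [i ix] := triv_cover E x; have [j jx] := triv_cover F x.
have [l lx] := triv_cover G x.
have [a [ha aE]] := bundle_fun_holo f i j; have [b [hb bE]] := bundle_fun_holo g j l.
pose U := triv_dom i `&` triv_dom j `&` triv_dom l.
have oU : open U by apply: openI; [apply: openI |]; exact: triv_dom_open.
exists U, (triv i), (triv l), (fun y => a y *m b y); split.
- by [].
- by apply: local_trivS (triv_local_triv i) => // y [[]].
- by apply: local_trivS (triv_local_triv l) => // y [].
- apply: holo_mxM; first by apply: holo_mxS ha => y [[? ?] ?].
  by apply: holo_mxS hb => y [[? ?] ?].
- by move=> y [[iy jy] ly] v; rewrite /= (bE y jy ly) (aE y iy jy) mulmxA.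
Qed.

Lemma frame_matrix_mul r s (E : X -> lmodType (CC R)) (F : X -> lmodType (CC R)) y
    (t : {linear E y -> 'rV[CC R]_r}) (t' : {linear F y -> 'rV[CC R]_s}) k (e : 'I_k -> E y)
    (phi : E y -> F y) (g : 'M[CC R]_(r, s)) :
  (forall v, t' (phi v) = t v *m g) ->
  \matrix_(i < k) t' (phi (e i)) = (\matrix_(i < k) t (e i)) *m g.
Proof. by move=> H; apply/row_matrixP => i; rewrite row_mul !rowK. Qed.

(** In coordinates the determinants are multiplied by the determinant of the matrix of [f],
    which is a unit. *)
Lemma has_divisor_map r (E F : vbundle X r) (f : bundle_map E F) s D :
  (forall x, bijective (f x)) -> has_divisor (E := E) s D ->
  has_divisor (E := F) (fun k x => f x (s k x)) D.
Proof.
move=> bf H x; have [U [z [u [t [zP tP hu ux dE]]]]] := H x.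
have [j jx] := triv_cover F x.
have [g [hg gE]] := bundle_map_local f tP (triv_local_triv j).
have [oU [Ux _] _ _ _] := zP.
pose V := U `&` triv_dom j.
have oV : open V by apply: openI => //; exact: triv_dom_open.
have Vx : V x by [].
have gu y : V y -> g y \in unitmx.
  move=> [Uy jy]; have [_ bt _] := tP; pose tf w : {linear E w -> 'rV[CC R]_r} := triv j w \o f w.
  apply: (@frame_unit _ _ r E t tf y (g y) (bt y Uy)).
    by apply: bij_comp; [exact: triv_bij | exact: bf].
  by move=> v; exact: gE.
exists V, z, (fun y => u y * \det (g y)), (triv j); split.
- by apply: local_coordS zP => // y [].
- by apply: local_trivS (triv_local_triv j) => // y [].
- apply: holo_onM; first by apply: holo_onS hu => y [].
  exact: holo_det hg.
- by rewrite mulf_neq0//; have := gu x Vx; rewrite unitmxE unitfE.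
move=> y Vy yx; have [Uy jy] := Vy.
by rewrite (frame_matrix_mul (phi := f y) _ (gE y Uy jy)) det_mulmx dE// mulrA.
Qed.

Context (hX : elliptic_curve X).

(** The ratio of the two determinants does not depend on the trivialization. It is a function
    on the curve with divisor [D - D'] and no other zeros, which [elliptic_zero] excludes if
    [D - D'] has positive degree. *)
Lemma has_divisor_deg_le r (E : vbundle X r) s D s' D' :
  has_divisor (E := E) s D -> has_divisor (E := E) s' D' -> freeg.deg D <= freeg.deg D'.
Proof.
move=> H H'; rewrite leNgt; apply/negP => DD.
pose idx y : triv_idx E := projT1 (cid (triv_cover E y)).
have idxP y : triv_dom (idx y) y by exact: (projT2 (cid (triv_cover E y))).
pose dets (e : 'I_r -> forall x, E x) y := \det (\matrix_(k < r) triv (idx y) y (e k y)).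
pose f y := dets s y / dets s' y.
have key x : exists U z h, [/\ local_coord x U z, holo_on U h,
    (forall y, U y -> h y != 0) &
    forall y, U y -> y != x -> f y = z y ^ (coeff x (D - D')) * h y].
  have [U [z [u [t [zP tP hu ux dE]]]]] := H x.
  have [U' [z' [u' [t' [z'P t'P hu' u'x dE']]]]] := H' x.
  have [oU [Ux _] _ _ _] := zP; have [oU' [U'x _] _ _ _] := z'P.
  have [g [hg gu gE]] := local_triv_change tP t'P.
  have [w hw wE] := local_coord_unit zP z'P.
  have huy : \forall y \near x, u y != 0 /\ u' y != 0.
    have h1 := holo_at_neq0 (iffLR (holo_onP _ _) hu x Ux) ux.
    have h2 := holo_at_neq0 (iffLR (holo_onP _ _) hu' x U'x) u'x.
    by move: h1 h2; apply: filterS2.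
  pose V := (U `&` U') `&` interior (fun y => u y != 0 /\ u' y != 0).
  have oV : open V by apply: openI; [exact: openI | exact: open_interior].
  have Vx : V x by [].
  have VU : V `<=` U by move=> y [[]].
  have VUU' : V `<=` U `&` U' by move=> y [].
  have Vu y : V y -> u y != 0 /\ u' y != 0 by move=> [_ /interior_subset].
  have gdet y : V y -> \det (g y) != 0.
    by move=> /VUU'[Uy U'y]; have := gu y Uy U'y; rewrite unitmxE unitfE.
  (* The unit [g] compares the frames of the two sections, and [w] their coordinates. *)
  pose h y := u y * (u' y)^-1 * \det (g y) * (w y ^ (- coeff x D')).
  exists V, z, h; split.
  - exact: local_coordS zP.
  - apply: holo_onM; first apply: holo_onM; first apply: holo_onM.
    + exact: holo_onS hu.
    + apply: holo_onV; first by move=> y /Vu[].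
      by apply: holo_onS hu' => y /VUU'[].
    + exact: holo_onS VUU' (holo_det hg).
    + apply: holo_onXz; first exact: holo_onS VUU' hw.
      by right=> y /VUU'/wE[].
  - move=> y Vy; have [u0 u'0] := Vu y Vy; have [w0 _] := wE y (VUU' y Vy).
    by rewrite /h !mulf_neq0 ?invr_eq0 ?expfz_neq0 ?gdet.
  move=> y Vy yx; have [Uy U'y] := VUU' y Vy; have [u0 u'0] := Vu y Vy.
  have [w0 z'E] := wE y (VUU' y Vy).
  have z0 := local_coord_neq0 zP Uy yx.
  have [a [_ au aE]] := local_triv_change tP (triv_local_triv (idx y)).
  have dets_t e : dets e y = \det (\matrix_(k < r) t y (e k y)) * \det (a y).
    by rewrite /dets (frame_matrix_mul (phi := id) _ (aE y Uy (idxP y))) det_mulmx.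
  have a0 : \det (a y) != 0 by have := au y Uy (idxP y); rewrite unitmxE unitfE.
  have dt' : \det (\matrix_(k < r) t' y (s' k y)) =
      \det (\matrix_(k < r) t y (s' k y)) * \det (g y).
    by rewrite (frame_matrix_mul (phi := id) _ (gE y Uy U'y)) det_mulmx.
  have g0 := gdet y Vy.
  have ds' : \det (\matrix_(k < r) t y (s' k y)) = z' y ^ (coeff x D') * u' y / \det (g y).
    by rewrite -(dE' y U'y yx) dt' mulfK.
  rewrite /f !dets_t -mulf_div divff// mulr1 dE// ds' z'E.
  rewrite coeffB expfzDr// expfzMl /h -!invr_expz.
  have e1 : z y ^ coeff x D' != 0 by exact: expfz_neq0.
  have e2 : w y ^ coeff x D' != 0 by exact: expfz_neq0.
  exact: ratio_identity.
have D0 : 0 < freeg.deg (D - D') by rewrite degB subr_gt0.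
have [_ [_ [q _]]] := hX; pose x := q 0.
have [U [z [h [zP hh h0 fE]]]] := key x.
have [oU [Ux _] _ _ _] := zP.
have data y : exists U z h, [/\ local_coord y U z, holo_on U h &
    forall v, U v -> v != y -> f v = z v ^ (coeff y (D - D')) * h v].
  by have [U1 [z1 [h1 [zP1 hh1 _ fE1]]]] := key y; exists U1, z1, h1.
have [y [Uy yx fy]] := elliptic_zero hX data D0 (open_nbhs_nbhs (conj oU Ux)).
have := fE y Uy yx; rewrite fy => /esym/eqP.
rewrite mulf_eq0 (negPf (h0 y Uy)) orbF; apply/negP.
exact: expfz_neq0 (local_coord_neq0 zP Uy yx).
Qed.

Lemma has_divisor_degree r (E : vbundle X r) s D :
  has_divisor (E := E) s D -> degree E = freeg.deg D.
Proof.
move=> H; rewrite /degree; apply: xget_unique; first by exists s, D.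
move=> d [s' [D' [H' ->]]]; apply/eqP; rewrite eq_le.
by rewrite (has_divisor_deg_le H H') (has_divisor_deg_le H' H).
Qed.

(** The degree of a bundle without meromorphic sections is zero by convention. *)
Lemma degree_cases r (E : vbundle X r) :
  (exists s D, has_divisor (E := E) s D /\ degree E = freeg.deg D) \/ degree E = 0.
Proof.
have [[s [D H]]|no] := pselect (exists s D, has_divisor (E := E) s D).
  by left; exists s, D; split => //; exact: has_divisor_degree H.
right; rewrite /degree; apply: xgetPN => d [s [D [H _]]].
by apply: no; exists s, D.
Qed.

Lemma degree_map r (E F : vbundle X r) (f : bundle_map E F) : (forall x, bijective (f x)) ->
  degree E = degree F \/ degree E = 0.
Proof.
move=> bf; have [[s [D [H ->]]]|] := degree_cases E; last by right.
by left; apply/esym/has_divisor_degree; exact: has_divisor_map bf H.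
Qed.

End Degrees.

(** * The line bundles O(D) and their sums *)

Section OD_bundles.
Context {R : realType} {X : curve R}.
Implicit Types (U V : set X) (x y p a b : X) (D : {freeg X / int}).

Lemma centered_coord0 a : centered_coord a a = 0 :> CC R.
Proof. by rewrite /centered_coord subrr. Qed.

(** The derivative does not vanish because the opposite change of charts is also
    differentiable. *)
Lemma local_coord_centered a U : open U -> U a -> U `<=` chart_dom (centered_chart a) ->
  local_coord a U (@centered_coord R X a).
Proof.
move=> oU Ua Ui; set i := centered_chart a in Ui.
split=> //.
- by split=> //; exact: centered_coord0.
- apply: holo_onB; last exact: holo_on_cst.
  by apply: (@holo_onS R X U (chart_dom i)) => //; exact: holo_on_chart.
- move=> j x /Ui ix jx.
  have [m hm] := cder_transition jx ix; have [l hl] := cder_transition ix jx.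
  have hl' : cder (chart j \o @chart_inv R X i) ((chart i \o @chart_inv R X j) (chart j x)) l.
    by rewrite /= chartK.
  have c1 : cder id (chart j x) (l * m).
    apply: eq_near_cder (cder_comp hm hl').
    have := nbhs_chart jx (near_chart_dom ix); move: (near_chart_im jx).
    by apply: filterS2 => w [_ wE] iw /=; rewrite chartK.
  have lm : l * m = 1 := cder_unique c1 (cder_id _).
  have hz : cder (@centered_coord R X a \o @chart_inv R X j) (chart j x) (m - 0).
    exact: cderB hm (cder_cst _ _).
  have [_ ->] := iffLR (cder_is_derive _ _ _) hz; rewrite subr0.
  by apply/eqP => m0; move/eqP: lm; rewrite m0 mulr0 eq_sym oner_eq0.
move=> x y /Ui ix /Ui iy /(congr1 (fun c => c + chart i a)); rewrite /centered_coord -/i !subrK => E.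
by rewrite -(chartK ix) E chartK.
Qed.

Lemma OD_dom_chart D a : OD_dom D a `<=` chart_dom (centered_chart a).
Proof. by move=> x []. Qed.

Lemma OD_dom_self D a : OD_dom D a a.
Proof. by split; [exact: centered_chartP | left]. Qed.

Lemma OD_dom_coeff D a x : OD_dom D a x -> x != a -> coeff x D = 0.
Proof. by move=> [_ [->|//]]; rewrite eqxx. Qed.

Lemma OD_scale0 a x : OD_scale (0 : {freeg X / int}) a x = 1 :> CC R.
Proof. by rewrite /OD_scale coeff0 expr0z if_same. Qed.

(** The inclusion of [O(D')] into [O(D)], where [D = D' + a]: a meromorphic function
    is recorded by its values, except at [a], where its coordinate is multiplied by the
    value of a local coordinate, that is by zero. *)
Definition incl_factor a x : CC R := if x == a then 0 else 1.

(** In the trivializations around [b], the inclusion is multiplication by a coordinate when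
    [b = a], and the identity otherwise. *)
Lemma OD_scale_incl D' D a b x : D = D' + <<a>> -> OD_dom D b x -> OD_dom D' b x ->
  OD_scale D b x * incl_factor a x =
  OD_scale D' b x * (if b == a then centered_coord a x else 1).
Proof.
move=> DE Dx D'x; have ca y : coeff y D = coeff y D' + (a == y)%:R.
  by rewrite DE coeffD coeffU mul1r.
rewrite /OD_scale /incl_factor; case: (eqVneq x b) => [->|xb].
  by case: eqVneq => [->|]; rewrite ?centered_coord0 ?mulr0.
have xa : x != a.
  have := ca x; rewrite (OD_dom_coeff Dx xb) (OD_dom_coeff D'x xb) add0r.
  by case: (eqVneq a x) => // ->; rewrite eqxx.
rewrite (negPf xa) mulr1; case: (eqVneq b a) => [ba|ba].
  have := centered_coord_neq0 (OD_dom_chart Dx) xb.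
  by rewrite ca ba eqxx => c0; rewrite expfzDr// expr1z -ba.
by rewrite ca eq_sym (negPf ba) addr0 mulr1.
Qed.

Lemma has_divisor_OD D : has_divisor (E := OD D) (fun _ x => (1 : OD_fiber x)) D.
Proof.
move=> x; exists (OD_dom D x), (@centered_coord R X x), (fun=> 1),
  (fun y => (triv (v := OD D) x y)); split.
- by apply: local_coord_centered; [exact: OD_dom_open | exact: OD_dom_self | exact: OD_dom_chart].
- exact: (@triv_local_triv R X 1 (OD D) x).
- exact: holo_on_cst.
- exact: oner_neq0.
move=> y Uy yx; rewrite det_mx11 !mxE /= /OD_scale (negPf yx).
by rewrite mulr1.
Qed.


Lemma triv_dsumE D D' b x (v : dsum (OD D) (OD D') x) j :
  triv (v := dsum (OD D) (OD D')) (b, b) x v 0 j =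
  if j == 0 then OD_scale D b x * v.1 else OD_scale D' b x * v.2.
Proof.
rewrite /= /dsum_triv /=; case: (split_ordP j) => k ->; rewrite !ord1.
  by rewrite row_mxEl mxE.
by rewrite row_mxEr mxE.
Qed.

Lemma det_mx2 (K : comNzRingType) (A : 'M[K]_2) : \det A = A 0 0 * A 1 1 - A 0 1 * A 1 0.
Proof.
rewrite (expand_det_row _ 0) !big_ord_recl big_ord0 addr0 /cofactor !det_mx11 !mxE /=.
rewrite /bump /= expr0 expr1 mul1r mulN1r mulrN.
by congr (A _ _ * A _ _ - A _ _ * A _ _); apply/val_inj.
Qed.

Lemma matrix_of_rowsE (K : nzRingType) m n (F : 'I_m -> 'rV[K]_n) i j :
  (\matrix_k F k) i j = F i 0 j.
Proof. by rewrite mxE. Qed.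

Lemma has_divisor_dsum D D' :
  has_divisor (E := dsum (OD D) (OD D'))
    (fun k x => if k == 0 then (1, 0) else (0, 1)) (D + D').
Proof.
move=> x; pose t := triv_local_triv (E := dsum (OD D) (OD D')) (x, x).
exists (OD_dom D x `&` OD_dom D' x), (@centered_coord R X x), (fun=> 1),
  (fun y => triv (v := dsum (OD D) (OD D')) (x, x) y); split.
- apply: local_coord_centered; first exact: local_triv_open t.
    by split; exact: OD_dom_self.
  by move=> y [/OD_dom_chart].
- exact: t.
- exact: holo_on_cst.
- exact: oner_neq0.
move=> y [Uy _] yx; rewrite det_mx2 !matrix_of_rowsE !triv_dsumE /= !mulr1 !mulr0 subr0.
by rewrite /OD_scale (negPf yx) coeffD expfzDr// (centered_coord_neq0 (OD_dom_chart Uy)).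
Qed.

End OD_bundles.

Section DirectSumMaps.
Context {R : realType} {X : curve R} (r s : nat) (E : vbundle X r) (F : vbundle X s).

Lemma holo_mx_cst U m n (g : 'M[CC R]_(m, n)) : @holo_mx R X m n U (fun=> g).
Proof. by move=> i j; exact: holo_on_cst. Qed.

Let dom (ij : triv_idx E * triv_idx F) := triv_dom ij.1 `&` triv_dom ij.2.

Let lt12 ij : local_triv (E := dsum E F) (dom ij) (triv (v := dsum E F) ij).
Proof. exact: (triv_local_triv (E := dsum E F) ij). Qed.

Let lt1 ij : local_triv (E := E) (dom ij) (triv ij.1).
Proof.
apply: local_trivS (triv_local_triv ij.1); first exact: local_triv_open (lt12 ij).
by move=> x [].
Qed.

Let lt2 ij : local_triv (E := F) (dom ij) (triv ij.2).
Proof.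
apply: local_trivS (triv_local_triv ij.2); first exact: local_triv_open (lt12 ij).
by move=> x [].
Qed.

Lemma constant_bundle_map m n (A : vbundle X m) (B : vbundle X n) (phi : forall x, A x -> B x) :
  (forall x, linear (phi x)) ->
  (forall x, exists U t t' G, [/\ U x, local_triv (E := A) U t, local_triv (E := B) U t' &
     forall y v, t' y (phi y v) = t y v *m G]) ->
  exists f : bundle_map A B, forall x v, f x v = phi x v.
Proof.
move=> lphi H; have [|f fE] := @mk_bundle_map _ _ _ _ A B (fun x => mk_linear (lphi x)).
  move=> x; have [U [t [t' [G [Ux tP t'P GE]]]]] := H x.
  exists U, t, t', (fun=> G); split; [exact: Ux | exact: tP | exact: t'P | exact: holo_mx_cst |].
  by move=> y _ v; rewrite mk_linearE.
by exists f => x v; rewrite fE.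
Qed.

Lemma dsum_inj1 : exists f : bundle_map E (dsum E F), forall x v, f x v = (v, 0).
Proof.
apply: constant_bundle_map => x; first by move=> c v w; congr pair; rewrite /= scaler0 addr0.
have [ij ijx] := triv_cover (dsum E F) x.
exists (dom ij), (triv ij.1), (triv (v := dsum E F) ij), (row_mx 1%:M 0).
split; [exact: ijx | exact: lt1 | exact: lt12 |] => y v.
by rewrite /= /dsum_triv /= linear0 mul_mx_row mulmx1 mulmx0.
Qed.

Lemma dsum_inj2 : exists f : bundle_map F (dsum E F), forall x v, f x v = (0, v).
Proof.
apply: constant_bundle_map => x; first by move=> c v w; congr pair; rewrite /= scaler0 addr0.
have [ij ijx] := triv_cover (dsum E F) x.
exists (dom ij), (triv ij.2), (triv (v := dsum E F) ij), (row_mx 0 1%:M).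
split; [exact: ijx | exact: lt2 | exact: lt12 |] => y v.
by rewrite /= /dsum_triv /= linear0 mul_mx_row mulmx1 mulmx0.
Qed.

Lemma dsum_proj1 : exists f : bundle_map (dsum E F) E, forall x v, f x v = v.1.
Proof.
apply: constant_bundle_map => // x; have [ij ijx] := triv_cover (dsum E F) x.
exists (dom ij), (triv (v := dsum E F) ij), (triv ij.1), (col_mx 1%:M 0).
split; [exact: ijx | exact: lt12 | exact: lt1 |] => y v.
by rewrite /= /dsum_triv /= mul_row_col mulmx1 mulmx0 addr0.
Qed.

Lemma dsum_proj2 : exists f : bundle_map (dsum E F) F, forall x v, f x v = v.2.
Proof.
apply: constant_bundle_map => // x; have [ij ijx] := triv_cover (dsum E F) x.
exists (dom ij), (triv (v := dsum E F) ij), (triv ij.2), (col_mx 0 1%:M).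
split; [exact: ijx | exact: lt12 | exact: lt2 |] => y v.
by rewrite /= /dsum_triv /= mul_row_col mulmx1 mulmx0 add0r.
Qed.

End DirectSumMaps.

Lemma ord2P (i : 'I_2) : i = 0 \/ i = 1.
Proof. by case: i => [[|[|//]] ?]; [left | right]; exact/val_inj. Qed.

Section TriangularMaps.
Context {R : realType} {X : curve R}.
Implicit Types (x p b : X) (D : {freeg X / int}).

Definition mx2 (a b c d : CC R) : 'M[CC R]_2 :=
  \matrix_(i, j) if i == 0 then if j == 0 then a else b else if j == 0 then c else d.

Lemma mulmx_mx2 (w : 'rV[CC R]_2) (a b c d : CC R) : w *m mx2 a b c d =
  \row_j if j == 0 then w 0 0 * a + w 0 1 * c else w 0 0 * b + w 0 1 * d.
Proof. apply/rowP => j; rewrite !mxE !big_ord_recl big_ord0 addr0 (_ : fintype.lift ord0 ord0 = 1 :> 'I_2); last exact/val_inj.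
by rewrite !mxE /=; case: (j == 0). Qed.

Lemma rowP2 (v w : 'rV[CC R]_2) : v 0 0 = w 0 0 -> v 0 1 = w 0 1 -> v = w.
Proof. by move=> h0 h1; apply/rowP => j; have [->|->] := ord2P j. Qed.

Lemma holo_mx2 U (a b c d : X -> CC R) : holo_on U a -> holo_on U b -> holo_on U c -> holo_on U d ->
  holo_mx U (fun x => mx2 (a x) (b x) (c x) (d x)).
Proof.
move=> ha hb hc hd i j; under [X in holo_on _ X]funext do rewrite mxE.
case: (i == 0); case: (j == 0).
- exact: ha.
- exact: hb.
- exact: hc.
- exact: hd.
Qed.

Definition incl_coord a b x : CC R := if b == a then centered_coord a x else 1.

Lemma holo_incl_coord a b U : U `<=` chart_dom (centered_chart b) -> holo_on U (@incl_coord a b).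
Proof.
move=> Ub; rewrite /incl_coord; case: eqVneq => [<-|_]; last exact: holo_on_cst.
apply: holo_onB; last exact: holo_on_cst.
by apply: (@holo_onS R X U (chart_dom (centered_chart b))) => //; exact: holo_on_chart.
Qed.

(** All the modifications below preserve the first summand and have this triangular shape in
    the trivializations around each point, with coordinates that are either constant or those
    of an inclusion. *)
Lemma triangular_map D1 D2 D3 D4 (al be ga : X -> CC R) (fa fb fc : X -> X -> CC R) :
  let U b := (OD_dom D1 b `&` OD_dom D2 b) `&` (OD_dom D3 b `&` OD_dom D4 b) in
  (forall b, [/\ holo_on (U b) (fa b), holo_on (U b) (fb b) & holo_on (U b) (fc b)]) ->
  (forall b x, U b x -> [/\ OD_scale D3 b x * al x = OD_scale D1 b x * fa b x,
     OD_scale D3 b x * be x = OD_scale D2 b x * fb b x &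
     OD_scale D4 b x * ga x = OD_scale D2 b x * fc b x]) ->
  exists a : bundle_map (dsum (OD D1) (OD D2)) (dsum (OD D3) (OD D4)),
    (forall x v, a x v = (al x * v.1 + be x * v.2, ga x * v.2)) /\
    (forall b x v, U b x -> triv (v := dsum (OD D3) (OD D4)) (b, b) x (a x v) =
       triv (v := dsum (OD D1) (OD D2)) (b, b) x v *m mx2 (fa b x) 0 (fb b x) (fc b x)).
Proof.
move=> U hf HE.
pose phi x (v : dsum (OD D1) (OD D2) x) : dsum (OD D3) (OD D4) x :=
  (al x * v.1 + be x * v.2, ga x * v.2).
have lphi x : linear (phi x).
  move=> c v w; congr pair; rewrite /= ?scalerDr.
    rewrite -![_ *: _]/(_ * _) !mulrDr [LHS]addrACA; congr (_ + _ + _); by rewrite mulrCA.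
  by rewrite -![_ *: _]/(_ * _) mulrDr mulrCA.
have key b x v : U b x -> triv (v := dsum (OD D3) (OD D4)) (b, b) x (phi x v) =
       triv (v := dsum (OD D1) (OD D2)) (b, b) x v *m mx2 (fa b x) 0 (fb b x) (fc b x).
  move=> Ux; have [e1 e2 e3] := HE b x Ux; rewrite mulmx_mx2; apply: rowP2.
    rewrite [RHS]mxE !triv_dsumE /= mulrDr !mulrA e1 e2 -!mulrA.
    by congr (_ * _ + _ * _); rewrite mulrC.
  by rewrite [RHS]mxE !triv_dsumE /= mulr0 add0r !mulrA e3 -!mulrA; congr (_ * _); rewrite mulrC.
have [|a aE] := @mk_bundle_map _ _ _ _ (dsum (OD D1) (OD D2)) (dsum (OD D3) (OD D4))
    (fun x => mk_linear (lphi x)).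
  move=> b; have o1 := local_triv_open (triv_local_triv (E := dsum (OD D1) (OD D2)) (b, b)).
  have o2 := local_triv_open (triv_local_triv (E := dsum (OD D3) (OD D4)) (b, b)).
  have oU : open (U b) by exact: openI.
  have [ha hb hc] := hf b.
  exists (U b), (triv (v := dsum (OD D1) (OD D2)) (b, b)), (triv (v := dsum (OD D3) (OD D4)) (b, b)),
    (fun x => mx2 (fa b x) 0 (fb b x) (fc b x)); split.
  - by do 2!split; exact: OD_dom_self.
  - by apply: local_trivS (triv_local_triv (E := dsum (OD D1) (OD D2)) (b, b)) => // y [].
  - by apply: local_trivS (triv_local_triv (E := dsum (OD D3) (OD D4)) (b, b)) => // y [].
  - by apply: (holo_mx2 ha (b := fun=> 0) _ hb hc); exact: holo_on_cst.
  by move=> y Uy v; rewrite mk_linearE; exact: key.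
by exists a; split=> [x v|b x v Ux]; rewrite aE// mk_linearE; exact: key.
Qed.

End TriangularMaps.

(** * Hecke modifications *)

Section HeckeModifications.
Context {R : realType} {X : curve R}.
Implicit Types (U V : set X) (x y p q : X) (D : {freeg X / int}).

Lemma diag_mx2 (z : CC R) : diag_mx (\row_(j < 2) if j == 0 then 1 else z) = mx2 1 0 0 z.
Proof.
by apply/matrixP => i j; rewrite !mxE; have [->|->] := ord2P i; have [->|->] := ord2P j.
Qed.

Lemma mulmx2 (a b c d a' b' c' d' : CC R) : mx2 a b c d *m mx2 a' b' c' d' =
  mx2 (a * a' + b * c') (a * b' + b * d') (c * a' + d * c') (c * b' + d * d').
Proof.
apply/row_matrixP => i; rewrite row_mul mulmx_mx2; apply/rowP => j.
by rewrite !mxE /=; case: (i == 0); case: (j == 0).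
Qed.

Lemma mx2_eta (g : 'M[CC R]_2) : g = mx2 (g 0 0) (g 0 1) (g 1 0) (g 1 1).
Proof.
by apply/matrixP => i j; rewrite !mxE; have [->|->] := ord2P i; have [->|->] := ord2P j.
Qed.

Lemma det_mx2E (a b c d : CC R) : \det (mx2 a b c d) = a * d - b * c.
Proof. by rewrite det_mx2 !mxE. Qed.

(** At [p] the matrix is [diag(1, 0)], whose image is the first axis. *)
Lemma hecke_rangeP p (F E : vbundle X 2) (a : bundle_map F E) U z
    (tF : forall x, {linear F x -> 'rV[CC R]_2}) (tE : forall x, {linear E x -> 'rV[CC R]_2}) :
  local_coord p U z -> local_triv U tF -> local_triv U tE ->
  (forall x, U x -> forall v, tE x (a x v) =
     tF x v *m diag_mx (\row_(j < 2) if j == 0 then 1 else z x)) ->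
  range (a p) = [set v | tE p v 0 1 = 0].
Proof.
move=> [oU [Up zp] _ _ _] [_ bF _] [_ bE _] aE.
apply/seteqP; split=> [_ [v _ <-]|v /= v1].
  by rewrite /= aE// diag_mx2 mulmx_mx2 mxE /= zp !mulr0 addr0.
exists (linv (tF p) (tE p v)) => //; apply: (bij_inj (bE p Up)).
rewrite aE// linvKV; last exact: bF.
by rewrite diag_mx2 mulmx_mx2; apply: rowP2; rewrite mxE /= ?mulr1 ?mulr0 ?addr0// zp v1 mulr0 addr0.
Qed.

Lemma hecke_is_line p (F E : vbundle X 2) (a : bundle_map F E) : hecke p a -> is_line (range (a p)).
Proof.
move=> [_ [U [z [tF [tE [zP tFP tEP aE]]]]]].
rewrite (hecke_rangeP zP tFP tEP aE); have [oU [Up _] _ _ _] := zP.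
have [_ /(_ p Up) bE _] := tEP.
pose e0 := linv (tE p) (delta_mx 0 0).
have te0 : tE p e0 = delta_mx 0 0 by exact: linvKV.
exists e0.
  apply/eqP => e00; move: te0; rewrite e00 linear0 => /rowP/(_ 0).
  by rewrite !mxE /= => /eqP; rewrite eq_sym oner_eq0.
apply/seteqP; split=> [v /= v1|_ [c _ <-]]; last first.
  by rewrite /= linearZ /= te0 !mxE /= mulr0.
exists (tE p v 0 0) => //; apply: (bij_inj bE); rewrite linearZ /= te0.
by apply: rowP2; rewrite !mxE /= ?mulr1// mulr0.
Qed.

Lemma hecke_equiv_range p (F F' E : vbundle X 2) (a : bundle_map F E) (a' : bundle_map F' E) :
  hecke_equiv a a' -> range (a p) = range (a' p).
Proof.
move=> [phi [psi [phiK psiK]] aE]; apply/seteqP; split=> _ [v _ <-].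
  by exists (phi p v) => //; rewrite aE.
by exists (psi p v) => //; rewrite aE psiK.
Qed.

(** Off [p] the equivalence is forced to be [a'^-1 o a]. In coordinates where both maps are
    diagonal it has the matrix [diag(1, z) g diag(1, z')^-1]; equality of the images at [p]
    makes the entry [g01] vanish there, hence divisible by [z'], so this matrix extends
    over [p], with determinant [(z / z') det g]. *)
Lemma hecke_unique p (F F' E : vbundle X 2) (a : bundle_map F E) (a' : bundle_map F' E) :
  hecke p a -> hecke p a' -> range (a p) = range (a' p) -> hecke_equiv a a'.
Proof.
move=> [ba [U [z [tF [tE [zP tFP tEP aE]]]]]] [ba' [U' [z' [tF' [tE' [z'P tF'P tE'P a'E]]]]]].
rewrite (hecke_rangeP zP tFP tEP aE) (hecke_rangeP z'P tF'P tE'P a'E) => rE.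
have [oU [Up zp] hz _ _] := zP; have [oU' [U'p z'p] hz' _ _] := z'P.
have [_ bF _] := tFP; have [_ bE _] := tEP; have [_ bF' _] := tF'P; have [_ bE' _] := tE'P.
have [g [hg gu gE]] := local_triv_change tEP tE'P.
pose W := U `&` U'; have oW : open W by exact: openI.
have Wp : W p by [].
have g01p : g p 0 1 = 0.
  pose e0 := linv (tE p) (delta_mx 0 0).
  have te0 : tE p e0 = delta_mx 0 0 by apply: linvKV; exact: bE.
  have : [set v | tE' p v 0 1 = 0] e0 by rewrite -rE /= te0 mxE.
  by rewrite /= (gE p Up U'p) te0 -rowE mxE.
have z'W : local_coord p W z' by apply: local_coordS z'P => // y [].
have [k hk kE] := holo_on_div z'W (hg 0 1) g01p.
have [w hw wE] := local_coord_unit z'P zP.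
have {hw} hw : holo_on W w by apply: holo_onS hw => y [].
have {}wE y : W y -> w y != 0 /\ z y = z' y * w y by move=> [Uy U'y]; exact: wE.
pose G y := mx2 (g y 0 0) (k y) (z y * g y 1 0) (w y * g y 1 1).
have hG : holo_mx W G.
  apply: holo_mx2.
  - exact: hg.
  - exact: hk.
  - apply: holo_onM; last exact: hg.
    by apply: holo_onS hz => y [].
  - by apply: holo_onM; [exact: hw | exact: hg].
have Gdiag y : W y -> diag_mx (\row_(j < 2) if j == 0 then 1 else z y) *m g y =
    G y *m diag_mx (\row_(j < 2) if j == 0 then 1 else z' y).
  move=> Wy; have [_ zy] := wE y Wy; rewrite !diag_mx2 [g y]mx2_eta !mulmx2 kE// zy.
  congr mx2; ring.
have uG y : W y -> G y \in unitmx.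
  move=> Wy; have [w0 zy] := wE y Wy.
  have -> : G y \in unitmx = (\det (G y) != 0) by rewrite unitmxE unitfE.
  have -> : \det (G y) = w y * \det (g y).
    by rewrite det_mx2E det_mx2 kE// zy; ring.
  by have [Uy U'y] := Wy; have := gu y Uy U'y; rewrite unitmxE unitfE; exact: mulf_neq0.
pose psi y v := linv (tF' y) (tF y v *m G y).
have a'psi y v : W y -> a' y (psi y v) = a y v.
  move=> [Uy U'y]; apply: (bij_inj (bE' y U'y)).
  rewrite a'E// linvKV; last exact: bF'.
  by rewrite -mulmxA -Gdiag// mulmxA -aE// -gE.
pose phi y v := if y == p then psi y v else linv (a' y) (a y v).
have a'phi y v : a' y (phi y v) = a y v.
  rewrite /phi; case: (eqVneq y p) => [yp|yp]; first by apply: a'psi; rewrite yp.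
  by rewrite linvKV//; exact: ba'.
have phi_psi y v : W y -> phi y v = psi y v.
  move=> Wy; rewrite /phi; case: eqVneq => // yp.
  by apply: (bij_inj (ba' y yp)); rewrite a'psi// linvKV//; exact: ba'.
have tphi y v : W y -> tF' y (phi y v) = tF y v *m G y.
  by move=> Wy; rewrite phi_psi// linvKV//; case: Wy => _; exact: bF'.
have lphi y : linear (phi y).
  have [->|yp] := eqVneq y p; move=> c u v.
    by apply: (bij_inj (bF' p U'p)); rewrite linearP !tphi// linearP mulmxDl -scalemxAl.
  by apply: (bij_inj (ba' y yp)); rewrite linearP !a'phi linearP.
have bphi y : bijective (phi y).
  have [->|yp] := eqVneq y p.
    exists (fun v => linv (tF p) (tF' p v *m invmx (G p))) => v.
      rewrite tphi// mulmxK; last exact: uG.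
      by rewrite linvK//; exact: bF.
    apply: (bij_inj (bF' p U'p)); rewrite tphi// linvKV; last exact: bF.
    by rewrite mulmxKV//; exact: uG.
  exists (fun v => linv (a y) (a' y v)) => v.
    by rewrite a'phi linvK//; exact: ba.
  by apply: (bij_inj (ba' y yp)); rewrite a'phi linvKV//; exact: ba.
have [|f fE] := @mk_bundle_map _ _ _ _ F F' (fun y => mk_linear (lphi y)).
  move=> x; have [->|xp] := eqVneq x p.
    exists W, tF, tF', G; split.
    - by [].
    - by apply: local_trivS tFP => // y [].
    - by apply: local_trivS tF'P => // y [].
    - exact: hG.
    - by move=> y Wy v; rewrite mk_linearE tphi.
  have [i ix] := triv_cover F x; have [j jx] := triv_cover F' x.
  have [l lx] := triv_cover E x.
  have [A [hA AE]] := bundle_fun_holo a i l; have [B [hB BE]] := bundle_fun_holo a' j l.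
  pose V := (triv_dom i `&` triv_dom j) `&` (triv_dom l `&` [set y | y != p]).
  have oV : open V.
    apply: openI; apply: openI; first exact: triv_dom_open.
    - exact: triv_dom_open.
    - exact: triv_dom_open.
    - exact: open_neq.
  have uB y : V y -> B y \in unitmx.
    move=> [[iy jy] [ly yp]]; pose ta q : {linear F' q -> 'rV[CC R]_2} := triv l q \o a' q.
    apply: (@frame_unit _ _ 2 F' (triv j) ta y (B y) (triv_bij jy)).
      by apply: bij_comp; [exact: triv_bij | exact: ba'].
    by move=> v; exact: BE.
  have hBV : holo_mx V B by apply: holo_mxS hB => y [[_ jy] [ly _]].
  exists V, (triv i), (triv j), (fun y => A y *m invmx (B y)); split.
  - by [].
  - by apply: local_trivS (triv_local_triv i) => // y [[]].
  - by apply: local_trivS (triv_local_triv j) => // y [[]].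
  - apply: holo_mxM; last exact: (holo_mxV uB hBV oV).
    by apply: holo_mxS hA => y [[iy _] [ly _]].
  move=> y Vy v; have [[iy jy] [ly yp]] := Vy.
  by rewrite mk_linearE mulmxA -AE// -a'phi BE// mulmxK//; exact: uB.
exists f; last by move=> x v; rewrite fE a'phi.
apply: bijective_bundle_iso => x.
by apply: eq_bij (bphi x) _ _ => v; rewrite fE.
Qed.

(** The identity of the first summand and the inclusion of the second one, which is zero at
    [p], are already diagonal in the trivializations around [p]. *)
Lemma hecke_summand D D' p :
  exists a : bundle_map (dsum (OD D) (OD (D' - <<p>>))) (dsum (OD D) (OD D')),
    hecke p a /\ range (a p) = @summand1 R X 1 1 (OD D) (OD D') p.
Proof.
have [||a [aE atriv]] := @triangular_map R X D (D' - <<p>>) D D' (fun=> 1) (fun=> 0)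
   (incl_factor p) (fun _ _ => 1) (fun _ _ => 0) (incl_coord p).
- move=> b; split; [exact: holo_on_cst | exact: holo_on_cst |].
  by apply: holo_incl_coord => y [[/OD_dom_chart]].
- move=> b x [[_ h1] [_ h2]]; split; rewrite ?mulr0//.
  by apply: OD_scale_incl => //; rewrite subrK.
exists a; split; last first.
  apply/seteqP; split=> [_ [v _ <-]|_ [v _ <-]].
    by exists v.1 => //; rewrite aE /incl_factor eqxx mul1r !mul0r addr0.
  by exists (v, 0) => //; rewrite aE /incl_factor eqxx mul1r !mul0r addr0.
split=> [x xp|].
  exists id => v; rewrite aE /incl_factor (negPf xp) !mul1r mul0r addr0.
    by case: v.
  by case: v.
pose U := (OD_dom D p `&` OD_dom (D' - <<p>>) p) `&` (OD_dom D p `&` OD_dom D' p).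
have oU : open U by apply: openI; apply: openI; exact: OD_dom_open.
exists U, (@centered_coord R X p), (triv (v := dsum (OD D) (OD (D' - <<p>>))) (p, p)),
  (triv (v := dsum (OD D) (OD D')) (p, p)); split.
- apply: local_coord_centered => //; first by do 2!split; exact: OD_dom_self.
  by move=> y [[/OD_dom_chart]].
- by apply: local_trivS (triv_local_triv (E := dsum (OD D) (OD (D' - <<p>>))) (p, p)) => // y [].
- by apply: local_trivS (triv_local_triv (E := dsum (OD D) (OD D')) (p, p)) => // y [].
by move=> x Ux v; rewrite atriv// diag_mx2 /incl_coord eqxx.
Qed.

(** The inclusion of [O(q - p)] together with the graph of [c] times the section of [O(q)]
    with divisor [q]. At [p] the first map vanishes and the section does not. *)
Lemma hecke_graph p q (c : CC R) : q != p ->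
  exists a : bundle_map (dsum (OD (<<q>> - <<p>>)) (OD 0)) (dsum (OD <<q>>) (OD 0)),
    hecke p a /\ range (a p) = range (fun w : CC R => (c * w, w) : dsum (OD <<q>>) (OD 0) p).
Proof.
move=> qp; set D : {freeg X / int} := <<q>>; set D1 := D - <<p>>.
have [||a [aE atriv]] := @triangular_map R X D1 0 D 0 (incl_factor p)
   (fun x => c * incl_factor q x) (fun=> 1) (incl_coord p)
   (fun b x => c * incl_coord q b x) (fun _ _ => 1).
- move=> b; split; last exact: holo_on_cst.
    by apply: holo_incl_coord => y [[/OD_dom_chart]].
  apply: holo_onM; first exact: holo_on_cst.
  by apply: holo_incl_coord => y [[/OD_dom_chart]].
- move=> b x [[h1 h2] [h3 _]]; split=> //.
    by apply: OD_scale_incl => //; rewrite subrK.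
  rewrite mulrCA [RHS]mulrCA; congr (_ * _).
  by apply: OD_scale_incl => //; rewrite add0r.
have iq : incl_factor q p = 1 :> CC R by rewrite /incl_factor eq_sym (negPf qp).
exists a; split; last first.
  apply/seteqP; split=> [_ [v _ <-]|_ [w _ <-]].
    by exists v.2 => //; rewrite aE /incl_factor eqxx eq_sym (negPf qp) mul0r add0r mulr1 mul1r.
  by exists (0, w) => //; rewrite aE /incl_factor eqxx eq_sym (negPf qp) mul0r add0r mulr1 mul1r.
split=> [x xp|].
  exists (fun v => (v.1 - c * incl_factor q x * v.2, v.2)) => -[v w]; rewrite aE /=.
    by rewrite {1}/incl_factor (negPf xp) !mul1r addrK.
  by rewrite {1}/incl_factor (negPf xp) !mul1r subrK.
pose U := (OD_dom D1 p `&` OD_dom 0 p) `&` (OD_dom D p `&` OD_dom 0 p).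
have oU : open U by apply: openI; apply: openI; exact: OD_dom_open.
pose tF0 := triv (v := dsum (OD D1) (OD 0)) (p, p).
pose tE0 := triv (v := dsum (OD D) (OD 0)) (p, p).
have tF0P : local_triv (E := dsum (OD D1) (OD 0)) U tF0.
  by apply: local_trivS (triv_local_triv (E := dsum (OD D1) (OD 0)) (p, p)) => // y [].
have tE0P : local_triv (E := dsum (OD D) (OD 0)) U tE0.
  by apply: local_trivS (triv_local_triv (E := dsum (OD D) (OD 0)) (p, p)) => // y [].
have um (m : 'M[CC R]_2) : \det m != 0 -> m \in unitmx by rewrite unitmxE unitfE.
(* Columns are exchanged so that the matrix [[z, 0], [c, 1]] becomes [diag(1, z)]. *)
exists U, (@centered_coord R X p),
  (fun x => mulmxr (mx2 0 1 1 0) \o tF0 x : {linear dsum (OD D1) (OD 0) x -> 'rV[CC R]_2}),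
  (fun x => mulmxr (mx2 0 1 1 (- c)) \o tE0 x : {linear dsum (OD D) (OD 0) x -> 'rV[CC R]_2}); split.
- apply: local_coord_centered => //; first by do 2!split; exact: OD_dom_self.
  by move=> y [[/OD_dom_chart]].
- apply: (local_triv_mul tF0P (g := fun=> mx2 0 1 1 0)) => //; first exact: holo_mx_cst.
  by move=> x _; apply: um; rewrite det_mx2E mul0r mulr1 sub0r oppr_eq0 oner_eq0.
- apply: (local_triv_mul tE0P (g := fun=> mx2 0 1 1 (- c))) => //; first exact: holo_mx_cst.
  by move=> x _; apply: um; rewrite det_mx2E mul0r mulr1 sub0r oppr_eq0 oner_eq0.
move=> x Ux v; rewrite /= -!mulmxA /tE0 atriv// diag_mx2 -mulmxA !mulmx2.
have -> : incl_coord p p x = centered_coord p x by rewrite /incl_coord eqxx.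
have -> : incl_coord q p x = 1 by rewrite /incl_coord eq_sym (negPf qp).
by congr (_ *m mx2 _ _ _ _); ring.
Qed.

End HeckeModifications.

(** * Line subbundles of O(q) + O *)

Section LineSubbundles.
Context {R : realType} {X : curve R} (hX : elliptic_curve X).
Implicit Types (U V : set X) (x y p q : X) (D : {freeg X / int}).

Lemma mx11_neq0 (w : 'rV[CC R]_1) : (w 0 0 == 0) = (w == 0).
Proof.
apply/eqP/eqP => [w0|->]; last by rewrite mxE.
by apply/rowP => j; rewrite !ord1 w0 mxE.
Qed.

(** The image of a meromorphic section of [M] is a function on the curve whose divisor is at
    least that of the section. If the degree is positive, it has zeros in every punctured
    neighbourhood of [x], which is impossible if the map is nonzero on the fiber at [x]. *)
Lemma map_to_trivial (M : vbundle X 1) (f : bundle_map M (OD (0 : {freeg X / int}))) :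
  0 < degree M -> forall x v, f x v = 0.
Proof.
have [[s [D [H ->]]] D0|->] := degree_cases hX M; last by rewrite ltxx.
pose F y : CC R := f y (s 0 y).
have data x : exists U z h t g, [/\ local_coord x U z, local_triv (E := M) U t,
    holo_on U g, holo_on U h &
    [/\ h x != 0,
    forall y, U y -> y != x -> t y (s 0 y) 0 0 = z y ^ (coeff x D) * h y &
    forall y v, U y -> f y v = (t y v 0 0 * g y : CC R)]].
  have [U [z [u [t [zP tP hu ux sE]]]]] := H x.
  have [g [hg gE]] := bundle_map_local f tP (triv_local_triv (E := OD 0) x).
  have [oU [Ux _] _ _ _] := zP.
  pose V := U `&` OD_dom 0 x; have oV : open V by apply: openI => //; exact: OD_dom_open.
  have Vx : V x by split => //; exact: OD_dom_self.
  exists V, z, u, t, (fun y => g y 0 0); split.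
  - by apply: local_coordS zP => // y [].
  - by apply: local_trivS tP => // y [].
  - exact: hg.
  - by apply: holo_onS hu => y [].
  split=> // [y [Uy _] yx|y v [Uy Vy]].
    by rewrite -(sE y Uy yx) det_mx11 matrix_of_rowsE.
  have /rowP/(_ 0) := gE y Uy Vy v.
  by rewrite mxE [RHS]mxE big_ord1 OD_scale0 mul1r.
have zero : forall x V, nbhs x V -> exists y, [/\ V y, y != x & F y = 0].
  apply: (elliptic_zero hX (D := D)) => // x.
  have [U [z [h [t [g [zP _ hg hh [_ sE fE]]]]]]] := data x.
  exists U, z, (fun y => h y * g y); split; [exact: zP | exact: (holo_onM hh hg) |].
  by move=> y Uy yx; rewrite /F fE// sE// mulrA.
move=> x v; have [U [z [h [t [g [zP tP hg hh [hx sE fE]]]]]]] := data x.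
have [oU [Ux _] _ _ _] := zP; rewrite fE//.
suff -> : g x = 0 by rewrite mulr0.
apply/eqP/negP => /negP gx.
have gn := holo_at_neq0 (iffLR (holo_onP _ _) hg x Ux) gx.
have hn := holo_at_neq0 (iffLR (holo_onP _ _) hh x Ux) hx.
have [|y [[Uy gy hy] yx Fy]] := zero x (fun y => [/\ U y, g y != 0 & h y != 0]).
  by move: (open_nbhs_nbhs (conj oU Ux)) gn hn; apply: filterS3.
move/eqP: Fy; rewrite /F fE// sE// !mulf_eq0 (negPf gy) (negPf hy) !orbF.
by apply/negP; apply: expfz_neq0; exact: (local_coord_neq0 zP).
Qed.

(** Fibers of line bundles are lines. *)
Lemma line_injective_bij (L M : vbundle X 1) x (f : {linear L x -> M x}) :
  injective f -> bijective f.
Proof.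
move=> fi; have [i ix] := triv_cover L x; have [j jx] := triv_cover M x.
have bi := triv_bij ix; have bj := triv_bij jx.
pose e := linv (triv i x) (const_mx 1); pose c := triv j x (f e) 0 0.
have te : triv i x e = const_mx 1 by exact: linvKV.
have c0 : c != 0.
  rewrite mx11_neq0; apply/eqP => E.
  have fe : f e = f 0 by apply: (bij_inj bj); rewrite E !linear0.
  move: te; rewrite (fi _ _ fe) linear0 => /rowP/(_ 0); rewrite !mxE => /esym/eqP.
  by rewrite oner_eq0.
have cb w : f ((triv j x w 0 0 / c) *: e) = w.
  apply: (bij_inj bj); rewrite !linearZ /=; apply/rowP => k; rewrite !ord1 mxE.
  by rewrite -/c divfK.
by exists (fun w => (triv j x w 0 0 / c) *: e) => // v; apply: fi; rewrite cb.
Qed.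


Lemma degree_OD D : degree (OD D) = freeg.deg D.
Proof. exact: (has_divisor_degree hX (has_divisor_OD D)). Qed.

Lemma degree_dsum_OD D D' : degree (dsum (OD D) (OD D')) = freeg.deg D + freeg.deg D'.
Proof. by rewrite (has_divisor_degree hX (has_divisor_dsum D D')) degD. Qed.

Section SubbundlesOfE.
Variable q : X.
Let E : vbundle X 2 := dsum (OD <<q>>) (OD 0).

Lemma positive_sub_snd (M : vbundle X 1) (f : bundle_map M E) : 0 < degree M ->
  forall x v, (f x v).2 = 0.
Proof.
move=> M0 x v; have [p2 p2E] := dsum_proj2 (OD <<q>>) (OD (0 : {freeg X / int})).
have [h hE] := comp_bundle_map f p2.
by have := map_to_trivial h M0 v; rewrite hE p2E.
Qed.

(** Being killed by the second projection, such a subbundle is contained in the first summand,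
    hence equal to it. *)
Lemma positive_sub_degree (M : vbundle X 1) (f : bundle_map M E) :
  line_subbundle f -> 0 < degree M -> degree M = 1 /\
  forall x, range (f x) = @summand1 R X 1 1 (OD <<q>>) (OD 0) x.
Proof.
move=> fi M0; have f2 := positive_sub_snd f M0.
have [p1 p1E] := dsum_proj1 (OD <<q>>) (OD (0 : {freeg X / int})).
have [h hE] := comp_bundle_map f p1.
have hi x : injective (h x).
  move=> v w; rewrite !hE !p1E => vw; apply: fi.
  by rewrite [LHS]surjective_pairing [RHS]surjective_pairing !f2 vw.
have hb x : bijective (h x) by exact: line_injective_bij.
split.
  have [->|h0] := degree_map hX hb; first by rewrite degree_OD degU.
  by move: M0; rewrite h0 ltxx.
move=> x; apply/seteqP; split=> [_ [v _ <-]|_ [w _ <-]].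
  by exists (f x v).1 => //; rewrite [RHS]surjective_pairing f2.
have [k hk kh] := hb x; exists (k w) => //.
by rewrite [LHS]surjective_pairing f2 -p1E -hE kh.
Qed.

Lemma sub_degree_le1 (M : vbundle X 1) (f : bundle_map M E) : line_subbundle f -> degree M <= 1.
Proof.
move=> fi; case: (ltP 0 (degree M)) => [M0|h]; last exact: le_trans h ler01.
by have [-> _] := positive_sub_degree fi M0.
Qed.

Lemma max_inj1 : exists f : bundle_map (OD <<q>>) E,
  max_line_subbundle f /\ forall x v, f x v = (v, 0).
Proof.
have [f fE] := dsum_inj1 (OD <<q>>) (OD (0 : {freeg X / int})).
exists f; split=> //; split; first by move=> x v w; rewrite !fE => -[].
by move=> M' f' /sub_degree_le1; rewrite degree_OD degU.
Qed.

Lemma max_sub (M : vbundle X 1) (f : bundle_map M E) : max_line_subbundle f ->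
  degree M = 1 /\ forall x, range (f x) = @summand1 R X 1 1 (OD <<q>>) (OD 0) x.
Proof.
move=> [fi fm]; apply: (positive_sub_degree fi).
have [f1 [[f1i _] _]] := max_inj1.
by have := fm _ _ f1i; rewrite degree_OD degU; exact: lt_le_trans.
Qed.

(** The second summand maps isomorphically to the quotient by any maximal subbundle. *)
Lemma max_quotient_degree (M Q : vbundle X 1) (f : bundle_map M E) (h : bundle_map E Q) :
  max_line_subbundle f -> quotient_bundle f h -> degree Q = 0.
Proof.
move=> fm hq; have [_ fr] := max_sub fm.
have [i2 i2E] := dsum_inj2 (OD <<q>>) (OD (0 : {freeg X / int})).
have [k kE] := comp_bundle_map i2 h.
have kb x : bijective (k x).
  apply: line_injective_bij => v w; rewrite !kE !i2E => /eqP.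
  rewrite -subr_eq0 -linearB /= => /eqP/(iffLR ((hq x).2 _))[m fm'].
  have : range (f x) (f x m) by exists m.
  rewrite fr fm' => -[u _ [_ /esym/eqP]].
  by rewrite subr_eq0 => /eqP.
by rewrite (has_divisor_degree hX (has_divisor_map kb (has_divisor_OD 0))) deg0.
Qed.

Lemma instability_degree_E : instability_degree E = 1.
Proof.
apply: xget_unique.
  have [f [fm fE]] := max_inj1.
  have [h hE] := dsum_proj2 (OD <<q>>) (OD (0 : {freeg X / int})).
  exists (OD <<q>>), (OD 0), f, h; split=> //; last by rewrite !degree_OD degU deg0 subr0.
  move=> x; split=> [w|v]; first by exists (0, w); rewrite hE.
  rewrite hE; split=> [v2|[m <-]]; last by rewrite fE.
  by exists v.1; rewrite fE [RHS]surjective_pairing v2.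
move=> d [M [Q [f [h [fm hq ->]]]]].
by have [-> _] := max_sub fm; rewrite (max_quotient_degree fm hq) subr0.
Qed.

Lemma unstable_E : unstable E.
Proof.
have [f [[fi _] _]] := max_inj1; exists (OD <<q>>), f; split=> //.
by rewrite /slope degree_dsum_OD degree_OD degU deg0 addr0.
Qed.

Lemma summand_is_line p : is_line (@summand1 R X 1 1 (OD <<q>>) (OD 0) p).
Proof.
exists (1, 0); first by apply/eqP => -[/eqP]; rewrite oner_eq0.
apply/seteqP; split=> [_ [v _ <-]|_ [c _ <-]].
  by exists v => //; congr pair; [exact: mulr1 | exact: mulr0].
by exists c => //; congr pair; [exact/esym/mulr1 | exact/esym/mulr0].
Qed.

(** A line other than the first axis is the graph of a linear map from the second axis. *)
Lemma line_cases p (l : set (E p)) : is_line l ->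
  l = @summand1 R X 1 1 (OD <<q>>) (OD 0) p \/
  exists c : CC R, l = range (fun w : CC R => (c * w, w) : dsum (OD <<q>>) (OD 0) p).
Proof.
move=> [[v1 v2] v0 ->]; have [v20|v20] := eqVneq (v2 : CC R) 0.
  have v10 : (v1 : CC R) != 0.
    by apply: contra v0 => /eqP E1; apply/eqP; congr pair.
  left; apply/seteqP; split=> [_ [c _ <-]|_ [w _ <-]].
    exists (c * v1) => //; congr pair; rewrite v20; exact/esym/mulr0.
  exists (w / v1) => //; congr pair; first exact: divfK.
  by rewrite v20; exact: mulr0.
right; exists (v1 / v2 : CC R); apply/seteqP; split=> [_ [c _ <-]|_ [w _ <-]].
  by exists (c * v2) => //; congr pair; rewrite mulrCA divfK.
exists (w / v2) => //; congr pair; last exact: divfK.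
by rewrite -[LHS]/(w / v2 * v1); rewrite mulrAC mulrC mulrA -mulrA mulrC; ring.
Qed.

End SubbundlesOfE.

End LineSubbundles.

Theorem theorem5p17 (R : realType) (X : curve R) (hX : elliptic_curve X)
    (p q : X) (hqp : q != p) :
  let E : vbundle X 2 := dsum (OD <<q>>) (OD 0) in
  let Oq_p : set (E p) := @summand1 R X 1 1 (OD <<q>>) (OD 0) p in
  unstable E /\ instability_degree E = 1 /\
  (* Hecke modifications at p are parameterized by lines in E_p *)
  (forall (F : vbundle X 2) (a : bundle_map F E),
     hecke p a -> is_line (range (a p))) /\
  (forall (F F' : vbundle X 2) (a : bundle_map F E) (a' : bundle_map F' E),
     hecke p a -> hecke p a' ->
     (hecke_equiv a a' <-> range (a p) = range (a' p))) /\
  (forall l : set (E p), is_line l ->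
     exists (F : vbundle X 2) (a : bundle_map F E),
       hecke p a /\ range (a p) = l) /\
  (* the modification determined by each line *)
  is_line Oq_p /\
  (forall (F : vbundle X 2) (a : bundle_map F E), hecke p a ->
     (range (a p) = Oq_p ->
        bad_line (range (a p)) /\
        isomorphic F (dsum (OD <<q>>) (OD (- <<p>>)))) /\
     (range (a p) <> Oq_p ->
        good_line (range (a p)) /\
        isomorphic F (dsum (OD (<<q>> - <<p>>)) (OD 0)))).
Proof.
move=> E Oq_p.
have [a1 [ha1 ra1]] : exists a : bundle_map (dsum (OD <<q>>) (OD (- <<p>>))) E,
    hecke p a /\ range (a p) = Oq_p.
  by have := hecke_summand <<q>> 0 p; rewrite sub0r.
split; first exact: unstable_E.
split; first exact: instability_degree_E.
split; first by move=> F a; exact: hecke_is_line.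
split.
  move=> F F' a a' ha ha'; split; first exact: hecke_equiv_range.
  exact: hecke_unique ha ha'.
split.
  move=> l /line_cases[->|[c ->]]; first by exists (dsum (OD <<q>>) (OD (- <<p>>))), a1.
  by have [a2 H] := hecke_graph c hqp; exists (dsum (OD (<<q>> - <<p>>)) (OD 0)), a2.
split; first exact: summand_is_line.
move=> F a ha; have la := hecke_is_line ha; split=> ra.
  split; last first.
    have [|phi iphi _] := hecke_unique ha ha1; first by rewrite ra ra1.
    by exists phi.
  split=> //; have [f [fm fE]] := max_inj1 hX q.
  exists (OD <<q>>), f; split=> //; rewrite ra.
  by apply/seteqP; split=> [_ [v _ <-]|_ [v _ <-]]; exists v; rewrite ?fE.
split.
  by split=> // -[_ [M [f [fm fr]]]]; apply: ra; rewrite -fr; exact: (max_sub hX fm).2.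
have [//|[c rc]] := line_cases la.
have [a2 [ha2 ra2]] := hecke_graph c hqp.
have [|phi iphi _] := hecke_unique ha ha2; first by rewrite rc ra2.
by exists phi.
Qed.
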